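(* Let $f$ be a non-vanishing holomorphic function on some open neighbourhood of $\partial\mathcal{D}_1$ such that $\ln f$ is also holomorphic on this neighbourhood. Let $h_1,\dots,h_n\in\{1,\dots,N\}$ and $p_1,\dots,p_n\in\mathbb{Z}\setminus\{1,\dots,N\}$ be pairwise distinct, and likewise let $t_1,\dots,t_r\in\{1,\dots,N\}$ and $k_1,\dots,k_r\in\mathbb{Z}\setminus\{1,\dots,N\}$ be pairwise distinct. Define $\ell_a=a$ for $a\in\{1,\dots,N\}\setminus\{h_1,\dots,h_n\}$, $\ell_{h_a}=p_a$ for $a=1,\dots,n$, and $m_a=a$ for $a\in\{1,\dots,N\}\setminus\{t_1,\dots,t_r\}$, $m_{t_a}=k_a$ for $a=1,\dots,r$. Assume that $\{h_a\}_1^n$ and $\{t_b\}_1^r$ are well-ordered with overlap $c\in\{0,\dots,\min(r,n)\}$. Then, provided that $N$ is large enough, $$\det_N\big[c_{\ell_a-m_b}[f]\big]=\det_N\big[c_{a-b}[f]\big]\cdot\det_{n+r}\big[\mathcal{N}\big],$$ where $$\mathcal{N}=\begin{pmatrix}\mathcal{N}_{I;I}&\mathcal{N}_{I;II}\\ \mathcal{N}_{II;I}&\mathcal{N}_{II;II}\end{pmatrix}$$ has blocks given, for $A\in\{I,II\}$, by $$(\mathcal{N}_{A;I})_{ab}=\delta_{A;I}\,\delta_{ab}\,\delta_{b>c}+\oint_{\partial\mathcal{D}_1}U_{A;a}(z)\,v_{I;b}(z)\,dz,\qquad (\mathcal{N}_{A;II})_{ab}=\delta_{A;II}\,\delta_{ab}\,\delta_{b\le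 c}+\oint_{\partial\mathcal{D}_1}U_{A;a}(z)\,v_{II;b}(z)\,dz,$$ indices attached to $I$ running from $1$ to $n$ and indices attached to $II$ running from $1$ to $r$. Here $U_{A;a}=(I-R_0)[u_{A;a}]$ with $$u_{I;a}(z)=\frac{f(z)}{2i\pi}z^{\frac N2-p_a}-\frac{z^{\frac N2-h_a}}{2i\pi}\big(\delta_{a\le c}+\delta_{a>c}f(z)\big),\qquad u_{II;a}(z)=\frac{f(z)-1}{2i\pi}z^{\frac N2-t_a},$$ and $$v_{I;b}(z)=\delta_{b\le c}\,z^{k_b-\frac N2-1}+\delta_{b>c}\,z^{h_b-1-\frac N2},\qquad v_{II;b}(z)=-\delta_{b\le c}\,z^{t_b-\frac N2-1}+\delta_{b>c}\,z^{k_b-1-\frac N2}.$$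
   Context: $\partial\mathcal{D}_1$ is the counter-clockwise oriented unit circle and $c_m[f]=\oint_{\partial\mathcal{D}_1}\frac{f(z)}{z^{m+1}}\frac{dz}{2i\pi}$. $\det_N[\,\cdot_{ab}]$ is the determinant of the $N\times N$ matrix indexed by $1\le a,b\le N$. Well-ordered with overlap $c$ means: $h_a=t_a$ for $a=1,\dots,c$, and $\{h_{c+1},\dots,h_n\}\cap\{t_{c+1},\dots,t_r\}=\emptyset$. (This can always be achieved by relabelling.) $\delta_{ab}$ and $\delta_{A;B}$ are Kronecker symbols; $\delta_{b\le c}$ (resp. $\delta_{b>c}$) equals $1$ if $b\le c$ (resp. $b>c$) and $0$ otherwise. $I+V_0$ is the integral operator on $L^2(\partial\mathcal{D}_1)$ with kernel $$V_0(z,s)=(f(z)-1)\cdot\frac{z^{N/2}s^{-N/2}-z^{-N/2}s^{N/2}}{2i\pi(z-s)},$$ i.e. $(V_0g)(z)=\oint_{\partial\mathcal{D}_1}V_0(z,s)g(s)\,ds$. For $N$ large enough it is invertible, and $R_0$ is defined by $(I+V_0)^{-1}=I-R_0$. When $N$ is odd, half-integer powers are defined through one fixed branch of $z^{1/2}$ on $\partial\mathcal{D}_1$, used consistently throughout. *)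

(* Defs.v *)
From HB Require Import structures.
From mathcomp Require Import all_boot all_order all_algebra.
From mathcomp Require Import all_classical all_reals all_analysis.
From mathcomp.real_closed Require Import complex.
Set Implicit Arguments.
Unset Strict Implicit.
Unset Printing Implicit Defensive.
Import Order.TTheory GRing.Theory Num.Theory.
Import numFieldNormedType.Exports.
Local Open Scope classical_set_scope.
Local Open Scope complex_scope.
Local Open Scope ring_scope.

Section UnitCircle.
Variable R : realType.
Local Notation C := R[i].

Definition unit_circle : set C := [set z | `|z| = 1].

Definition cis (x : R) : C := cos x +i* sin x.

Definition cexp (z : C) : C := (expR (complex.Re z))%:C * cis (complex.Im z).

Definition holomorphic_on (U : set C) (f : C -> C) : Prop :=
  forall z, U z -> derivable (f : C^o -> C^o) z 1.

Definition twoipi : C := 2%:R * ('i)%C * pi%:C.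

(* The circle is run through counter-clockwise by [cis], so that
   [dz = i * cis x dx]. *)
Definition circle_integral (F : C -> C) : C :=
  let G x := F (cis x) * (('i)%C * cis x) in
  (\int[lebesgue_measure]_(x in `[0, 2 * pi]) complex.Re (G x))%R +i*
  (\int[lebesgue_measure]_(x in `[0, 2 * pi]) complex.Im (G x))%R.

Definition laurent_coef (f : C -> C) (m : int) : C :=
  circle_integral (fun z => f z / z ^ (m + 1) / twoipi).

Definition circle_ae_eq (g h : C -> C) : Prop :=
  ae_eq lebesgue_measure `[0, 2 * pi]%classic (g \o cis) (h \o cis).

Definition sqnormC (z : C) : R := complex.Re z ^+ 2 + complex.Im z ^+ 2.

Definition L2_sqnorm (g : C -> C) : \bar R :=
  (\int[lebesgue_measure]_(x in `[0%R, (2 * pi)%R])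
     (sqnormC (g (cis x)))%:E)%E.

Definition in_L2 (g : C -> C) : Prop :=
  [/\ measurable_fun `[0, 2 * pi]%classic (@complex.Re R \o g \o cis),
      measurable_fun `[0, 2 * pi]%classic (@complex.Im R \o g \o cis) &
      (L2_sqnorm g < +oo)%E].

(* Elements of L^2 are represented by functions, considered up to
   [circle_ae_eq]. *)
Definition L2_bounded_operator (T : (C -> C) -> (C -> C)) : Prop :=
  [/\ forall g, in_L2 g -> in_L2 (T g),
      forall g h, in_L2 g -> in_L2 h ->
        circle_ae_eq g h -> circle_ae_eq (T g) (T h),
      forall (a : C) g h, in_L2 g -> in_L2 h ->
        circle_ae_eq (T (fun z => a * g z + h z))
                     (fun z => a * T g z + T h z) &
      exists M : R, forall g, in_L2 g ->
        (L2_sqnorm (T g) <= M%:E * L2_sqnorm g)%E].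

Definition L2_inverse (T S : (C -> C) -> (C -> C)) : Prop :=
  [/\ L2_bounded_operator T, L2_bounded_operator S,
      forall g, in_L2 g -> circle_ae_eq (T (S g)) g &
      forall g, in_L2 g -> circle_ae_eq (S (T g)) g].

Definition id_plus (V : (C -> C) -> (C -> C)) (g : C -> C) : C -> C :=
  fun z => g z + V g z.

Definition id_minus (V : (C -> C) -> (C -> C)) (g : C -> C) : C -> C :=
  fun z => g z - V g z.

Definition sqrt_branch (q : C -> C) : Prop :=
  (forall z, unit_circle z -> q z ^+ 2 = z) /\
  (exists2 z0, unit_circle z0 &
     {within (unit_circle `\ z0 : set C^o), continuous (q : C^o -> C^o)}).

(* [half_pow q z j] is z^(j/2), for the branch [q] of the square root; for
   even [j] it is the integer power of [z], whatever the branch. *)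
Definition half_pow (q : C -> C) (z : C) (j : int) : C := q z ^ j.

(* The kernel is only used under an integral in [s], so that the conventional
   value at [s = z] is irrelevant. *)
Definition V0_kernel (f q : C -> C) (N : nat) (z s : C) : C :=
  (f z - 1) *
  ((half_pow q z N%:Z * half_pow q s (- N%:Z)
    - half_pow q z (- N%:Z) * half_pow q s N%:Z) / (twoipi * (z - s))).

Definition V0 (f q : C -> C) (N : nat) (g : C -> C) : C -> C :=
  fun z => circle_integral (fun s => V0_kernel f q N z s * g s).

(* Finite families are 0-indexed: with [a] counted from 0, the condition
   "a <= c" on 1-based indices reads [(a < c)%N]. *)
Section Families.
Variables (f q : C -> C) (N c : nat) (h p t k : seq int).

Definition u_I (a : nat) : C -> C := fun z =>
  f z / twoipi * half_pow q z (N%:Z - 2 * p`_a)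
  - half_pow q z (N%:Z - 2 * h`_a) / twoipi
    * ((a < c)%N%:R + (c <= a)%N%:R * f z).

Definition u_II (a : nat) : C -> C := fun z =>
  (f z - 1) / twoipi * half_pow q z (N%:Z - 2 * t`_a).

Definition v_I (b : nat) : C -> C := fun z =>
  (b < c)%N%:R * half_pow q z (2 * k`_b - N%:Z - 2)
  + (c <= b)%N%:R * half_pow q z (2 * h`_b - 2 - N%:Z).

Definition v_II (b : nat) : C -> C := fun z =>
  - (b < c)%N%:R * half_pow q z (2 * t`_b - N%:Z - 2)
  + (c <= b)%N%:R * half_pow q z (2 * k`_b - 2 - N%:Z).

End Families.

Definition calN (f q : C -> C) (N c n r : nat) (h p : n.-tuple int)
    (t k : r.-tuple int) (R0 : (C -> C) -> (C -> C)) : 'M[C]_(n + r) :=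
  let U_I a := id_minus R0 (u_I f q N c h p a) in
  let U_II a := id_minus R0 (u_II f q N t a) in
  let vI := v_I q N c h k in
  let vII := v_II q N c t k in
  block_mx
    (\matrix_(a < n, b < n) ((a == b)%:R * (c <= b)%N%:R
        + circle_integral (fun z => U_I a z * vI b z)))
    (\matrix_(a < n, b < r) circle_integral (fun z => U_I a z * vII b z))
    (\matrix_(a < r, b < n) circle_integral (fun z => U_II a z * vI b z))
    (\matrix_(a < r, b < r) ((a == b)%:R * (b < c)%N%:R
        + circle_integral (fun z => U_II a z * vII b z))).

End UnitCircle.

Definition in_range (N : nat) (x : int) : bool := 1 <= x <= N%:Z.

(* [substituted h p a] is p_i if a = h_i, and a if a is none of the h_i. *)
Definition substituted (h p : seq int) (a : int) : int :=
  if a \in h then p`_(index a h) else a.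

Definition admissible (N n : nat) (h p : n.-tuple int) : Prop :=
  [/\ uniq h, uniq p, all (in_range N) h & all (fun x => ~~ in_range N x) p].

Definition well_ordered (n r c : nat) (h : n.-tuple int) (t : r.-tuple int) :
    Prop :=
  (forall a, (a < c)%N -> h`_a = t`_a) /\
  (forall a b, (c <= a < n)%N -> (c <= b < r)%N -> h`_a <> t`_b).

(* Main.v *)
Require Import Defs.
From HB Require Import structures.
From mathcomp Require Import all_boot all_order all_algebra.
From mathcomp Require Import all_classical all_reals all_analysis.
From mathcomp.real_closed Require Import complex.
From mathcomp Require Import measurable_realfun ring lra zify.
Import Order.TTheory GRing.Theory Num.Theory.
Import numFieldNormedType.Exports.
Local Open Scope classical_set_scope.
Local Open Scope complex_scope.
Local Open Scope ring_scope.
Import ComplexField.Normc.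
Set Implicit Arguments.
Unset Strict Implicit.
Unset Printing Implicit Defensive.

(** The kernel of [V0] is a sum of [N] products: since
    [(z^N - s^N) / (z - s)] is a geometric sum, [V0] is the finite rank
    operator [g |-> sum_a e_a moment_a(g)], where
    [e_a = (f - 1) z^(N/2 - a) / (2 i pi)] and [moment_j] integrates against
    [s^(j - 1 - N/2)]. As [moment_b (e_a) = c_(a-b)[f] - delta_ab], the operator
    [I + V0] acts on the vector of moments as the Toeplitz matrix
    [T = (c_(a-b)[f])]. Hence it is invertible on L^2 as soon as [T] is, with an
    inverse of the same finite rank form, and any inverse has moments that are
    determined by [T^-1] ([moment_inverse], [resolvent]).

    The determinant identity is then finite dimensional linear algebra. The
    minor on the left is [T] with the rows [h_a] and the columns [t_b] replaced.
    Writing it as [T + X Y] with [X] of width [n + r], the identity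
    [det (T + X Y) = det T * det (1 + Y T^-1 X)] extracts [det T] and leaves an
    [(n + r)]-square determinant in [T^-1] ([det_replace]). The matrix [calN] of
    the statement is that one, up to adding rows and up to a quarter turn that
    exchanges, for [b <= c], the columns attached to [h_b] and to [k_b]; both
    operations have determinant one ([minor_factorization]).

    What remains is that [T] is invertible for large [N]
    ([toeplitz_invertible]). By Fejer's theorem [Im (ln f)] is uniformly close to the
    imaginary part of a polynomial [P], so that [f] times the conjugate of
    [exp P] takes its values in a sector around the positive axis, and so does
    [f exp (- P)]. As [exp P] is approximated by the polynomials [(1 + P/n)^n],
    there are polynomials [psi1] and [psi2] such that [Re (f conj psi1)]
    and [Re (f psi2)] are bounded below by a positive constant on the circle
    ([sectorial_multipliers]). Let [x] be a polynomial of degree less than [N]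
    in the kernel of [T], that is, such that the Fourier coefficients of index
    [0, ..., N - 1] of [f x] vanish. Damp it to [x1] by the ramp [1 - i/N] on
    its coefficients. The product [psi1 x1] has no negative frequency, and the
    ramp makes what it has beyond [N] negligible; as the ramp almost commutes
    with multiplication by [f], the pairing of [f x1] with [psi1 x1] is almost a
    pairing of [f x] with a polynomial of degree less than [N], hence almost
    zero. Coercivity gives that [x1] is small compared with [x]
    ([kernel_low_mass]). Reversing the coefficients, [psi2] shows the same for
    the complementary ramp. Together the two ramps control [x], so [x = 0]. *)

(** * Complex numbers and the unit circle *)

Section CircleBasics.
Variable R : realType.
Local Notation C := R[i].
Local Notation Re := (@complex.Re R).
Local Notation Im := (@complex.Im R).
Implicit Types (x y : R) (z w : C).

Lemma eq_ReIm z w : Re z = Re w -> Im z = Im w -> z = w.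
Proof. by case: z => a b; case: w => a' b' /= -> ->. Qed.

Lemma cReD z w : Re (z + w) = Re z + Re w. Proof. by case: z; case: w. Qed.
Lemma cImD z w : Im (z + w) = Im z + Im w. Proof. by case: z; case: w. Qed.
Lemma cReN z : Re (- z) = - Re z. Proof. by case: z. Qed.
Lemma cImN z : Im (- z) = - Im z. Proof. by case: z. Qed.
Lemma cReB z w : Re (z - w) = Re z - Re w. Proof. by rewrite cReD cReN. Qed.
Lemma cImB z w : Im (z - w) = Im z - Im w. Proof. by rewrite cImD cImN. Qed.
Lemma cReM z w : Re (z * w) = Re z * Re w - Im z * Im w.
Proof. by case: z; case: w. Qed.
Lemma cImM z w : Im (z * w) = Re z * Im w + Im z * Re w.
Proof. by case: z => a b; case: w => a' b' /=; rewrite mulrC [b * _]mulrC addrC. Qed.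
Lemma cReJ z : Re z^* = Re z. Proof. by case: z. Qed.
Lemma cImJ z : Im z^* = - Im z. Proof. by case: z. Qed.

Definition ReIm := (cReD, cImD, cReN, cImN, cReM, cImM, cReJ, cImJ).

Lemma cReZ x z : Re (x%:C * z) = x * Re z.
Proof. by rewrite cReM /= mul0r subr0. Qed.

Lemma conjcM z w : (z * w)^* = z^* * w^*.
Proof. exact: rmorphM. Qed.

Lemma Re_sum (I : Type) (r : seq I) (P : pred I) (F : I -> C) :
  Re (\sum_(i <- r | P i) F i) = \sum_(i <- r | P i) Re (F i).
Proof. exact: (big_morph Re cReD (erefl _)). Qed.

Lemma sqnormCE z : sqnormC z = Re (z * z^*).
Proof. by rewrite /sqnormC !ReIm; ring. Qed.

Lemma sqnormC_ge0 z : 0 <= sqnormC z.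
Proof. by rewrite addr_ge0 ?sqr_ge0. Qed.

Lemma mulcJ z : z * z^* = (sqnormC z)%:C.
Proof. by apply: eq_ReIm; rewrite ?sqnormCE // !ReIm /=; ring. Qed.

Lemma sqnormCM z w : sqnormC (z * w) = sqnormC z * sqnormC w.
Proof. by rewrite /sqnormC !ReIm; ring. Qed.

Lemma sqnormCJ z : sqnormC z^* = sqnormC z.
Proof. by rewrite /sqnormC !ReIm sqrrN. Qed.

Lemma sqr_normcE z : normc z ^+ 2 = sqnormC z.
Proof. by case: z => a b; rewrite /= sqr_sqrtr // addr_ge0 ?sqr_ge0. Qed.

Lemma normc_ge0 z : 0 <= normc z.
Proof. by case: z => a b; rewrite sqrtr_ge0. Qed.

Lemma normc_conj z : normc z^* = normc z.
Proof. by case: z => a b /=; rewrite sqrrN. Qed.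

Lemma Re_le_normc z : `|Re z| <= normc z.
Proof.
by rewrite -(ler_pXn2r (n := 2)) ?nnegrE ?normc_ge0 // sqr_normcE real_normK
  ?num_real // lerDl sqr_ge0.
Qed.

Lemma Im_le_normc z : `|Im z| <= normc z.
Proof.
by rewrite -(ler_pXn2r (n := 2)) ?nnegrE ?normc_ge0 // sqr_normcE real_normK
  ?num_real // lerDr sqr_ge0.
Qed.

Lemma normc_le_ReIm z : normc z <= `|Re z| + `|Im z|.
Proof.
rewrite -(ler_pXn2r (n := 2)) ?nnegrE ?normc_ge0 ?addr_ge0 //.
rewrite sqr_normcE sqrrD !real_normK ?num_real // /sqnormC.
by rewrite -addrA lerD2l lerDr mulrn_wge0 // mulr_ge0.
Qed.

Lemma normcD z w : normc (z + w) <= normc z + normc w.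
Proof. exact: le_normcD. Qed.

Lemma normcB z w : normc (z - w) = normc (w - z).
Proof. by rewrite -normcN opprB. Qed.

Lemma normc_real x : normc x%:C = `|x|.
Proof. by rewrite /= expr0n /= addr0 sqrtr_sqr. Qed.

Lemma unit_circleE z : unit_circle z <-> sqnormC z = 1.
Proof.
rewrite /unit_circle /= -sqr_normcE; change `|z| with ((normc z)%:C).
split=> [[->]|]; first by rewrite expr1n.
move/eqP; rewrite sqrf_eq1 => /orP[/eqP -> //|/eqP h].
by exfalso; have := normc_ge0 z; rewrite h; lra.
Qed.

Lemma unit_normc z : unit_circle z -> normc z = 1.
Proof. by case. Qed.

Lemma unit_neq0 z : unit_circle z -> z != 0.
Proof.
by move=> /unit_circleE h; apply/eqP => z0; move: h; rewrite z0 /sqnormC /=;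
  rewrite !expr0n /= addr0 => /esym/eqP; rewrite oner_eq0.
Qed.

Lemma unit_mulJ z : unit_circle z -> z * z^* = 1.
Proof. by move=> /unit_circleE h; rewrite mulcJ h. Qed.

Lemma unit_inv z : unit_circle z -> z^-1 = z^*.
Proof.
move=> h; apply: (mulfI (unit_neq0 h)).
by rewrite unit_mulJ // divff // unit_neq0.
Qed.

Lemma unitM z w : unit_circle z -> unit_circle w -> unit_circle (z * w).
Proof.
by rewrite !unit_circleE sqnormCM => -> ->; rewrite mulr1.
Qed.

Lemma unitJ z : unit_circle z -> unit_circle z^*.
Proof. by rewrite !unit_circleE sqnormCJ. Qed.

Lemma unitV z : unit_circle z -> unit_circle z^-1.
Proof. by move=> h; rewrite unit_inv //; apply: unitJ. Qed.

Lemma unitX z n : unit_circle z -> unit_circle (z ^+ n).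
Proof.
move=> h; elim: n => [|n ih]; last by rewrite exprS; apply: unitM.
by apply/unit_circleE; rewrite /sqnormC /=; ring.
Qed.

Lemma unitXz z (k : int) : unit_circle z -> unit_circle (z ^ k).
Proof.
by case: k => n h; [apply: unitX | rewrite NegzE -exprz_inv; apply/unitX/unitV].
Qed.

Lemma unitXz_conj z (k : int) : unit_circle z -> (z ^ k)^* = z ^ (- k).
Proof. by move=> h; rewrite -unit_inv ?invr_expz //; apply: unitXz. Qed.

Lemma cis_unit x : unit_circle (cis x).
Proof. by apply/unit_circleE; rewrite /sqnormC /= cos2Dsin2. Qed.

Lemma cis0 : cis (0 : R) = 1.
Proof. by rewrite /cis cos0 sin0. Qed.

Lemma cisD x y : cis (x + y) = cis x * cis y.
Proof. by apply: eq_ReIm; rewrite /= ?cosD ?sinD; ring. Qed.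

Lemma cisN x : cis (- x) = (cis x)^-1.
Proof. rewrite unit_inv; last exact: cis_unit.
by apply: eq_ReIm; rewrite ?cReJ ?cImJ /= ?cosN ?sinN. Qed.

Lemma cisXn x n : cis x ^+ n = cis (n%:R * x).
Proof.
elim: n => [|n ih]; first by rewrite mul0r cis0.
by rewrite exprS ih -cisD -[in RHS]natr1; congr cis; ring.
Qed.

Lemma cisXz x (k : int) : cis x ^ k = cis (k%:~R * x).
Proof.
case: k => n; first by rewrite -exprnP cisXn.
by rewrite NegzE mulrNz mulNr cisN -exprnN; congr (_^-1); rewrite cisXn.
Qed.

Lemma sin_le x : 0 <= x -> sin x <= x.
Proof.
move=> x0; have [->|xn0] := eqVneq x 0; first by rewrite sin0.
have xp : 0 < x by rewrite lt_def xn0.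
have sC : {within `[0, x], continuous (@sin R)}.
  by apply: continuous_subspaceT => t; exact: continuous_sin.
have [t _] := @MVT R sin cos 0 x xp (fun t _ => is_derive_sin t) sC.
rewrite sin0 !subr0 => ->.
by rewrite ler_piMl // cos_le1.
Qed.

Lemma sqr_sin_le x : sin x ^+ 2 <= x ^+ 2.
Proof.
wlog x0 : x / 0 <= x.
  move=> h; have [x0|/ltW x0] := leP 0 x; first exact: h.
  by have := h (- x); rewrite sinN !sqrrN oppr_ge0; apply.
have [h|h] := leP 0 (sin x).
  by rewrite ler_pXn2r ?nnegrE // sin_le.
have [x1|x1] := leP 1 x.
  apply: (@le_trans _ _ 1); last by rewrite expr_ge1.
  by have := cos2Dsin2 x; have := sqr_ge0 (cos x); lra.
have : 0 <= sin x by apply: sin_ge0_pi; rewrite x0 /=; have := pi_ge2 R; lra.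
by rewrite leNgt h.
Qed.

(** By the half-angle formula this is [sin^2 (x/2) <= (x/2)^2]; it bounds chords
    of the circle by arcs and keeps cosines of small angles away from zero. *)
Lemma cos_ge x : 1 - x ^+ 2 / 2 <= cos x.
Proof.
have e : x = (x / 2) *+ 2 by rewrite mulr2n; field.
have -> : cos x = 2 * cos (x / 2) ^+ 2 - 1.
  by rewrite {1}e cos_mulr2n mulr_natl.
have := sqr_sin_le (x / 2); have := cos2Dsin2 (x / 2).
have -> : (x / 2) ^+ 2 = x ^+ 2 / 4 by field.
by lra.
Qed.

Lemma sqnormC_cisB x y : sqnormC (cis x - cis y) <= (x - y) ^+ 2.
Proof.
have : sqnormC (cis x - cis y) = 2 - 2 * cos (x - y).
  rewrite /sqnormC !cReB !cImB /= cosB.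
  by have := cos2Dsin2 x; have := cos2Dsin2 y; set a := cos _; set b := sin _;
    set c := cos _; set d := sin _; nra.
by move=> ->; have := cos_ge (x - y); lra.
Qed.

Lemma normc_cisB x y : normc (cis x - cis y) <= `|x - y|.
Proof.
rewrite -(ler_pXn2r (n := 2)) ?nnegrE ?normc_ge0 // sqr_normcE real_normK
  ?num_real //; exact: sqnormC_cisB.
Qed.

(** Points of the circle can be reached by an angle of the compact interval on
    which integrals are taken, which makes compactness available on the circle. *)
Lemma unit_cis z : unit_circle z -> exists2 x, 0 <= x <= 2 * pi & z = cis x.
Proof.
case: z => a b /unit_circleE; rewrite /sqnormC /= => ab.
have a1 : -1 <= a <= 1 by apply/andP; split; nra.
have sa : sin (acos a) = `|b|.
  have -> : sin (acos a) = Num.sqrt (b ^+ 2) by rewrite sin_acos // -ab; congr Num.sqrt; ring.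
  by rewrite sqrtr_sqr.
have ca : cos (acos a) = a by apply: acosK; rewrite in_itv.
have [b0|b0] := leP 0 b.
  exists (acos a); first by have := acos_ge0 a1; have := acos_lepi a1; lra.
  by rewrite /cis sa ca ger0_norm.
exists (- acos a + pi *+ 2).
  have := acos_ge0 a1; have := acos_lepi a1; rewrite mulr2n; lra.
by rewrite /cis cosD2pi sinD2pi cosN sinN sa ca ltr0_norm // opprK.
Qed.

End CircleBasics.

(** * Integrals of complex functions over a period *)

Section Integration.
Variable R : realType.
Local Notation C := R[i].
Local Notation Re := (@complex.Re R).
Local Notation Im := (@complex.Im R).
Local Notation mu := (@lebesgue_measure R).
Local Notation J := (`[0, 2 * pi]%classic : set R).
Implicit Types (G H : R -> C).

Definition cint G : C :=
  (\int[mu]_(x in J) Re (G x))%R +i* (\int[mu]_(x in J) Im (G x))%R.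

Definition cmeas G :=
  measurable_fun J (Re \o G) /\ measurable_fun J (Im \o G).

(** Integrability is asked of the real and imaginary parts, as the integral of
    a complex function is defined from theirs. *)
Definition cintegrable G :=
  mu.-integrable J (EFin \o (Re \o G)) /\ mu.-integrable J (EFin \o (Im \o G)).

(** The multipliers that preserve both integrable and square integrable
    functions: all coefficient functions of the problem are of this kind,
    including half-integer powers, which jump at one point of the circle. *)
Definition bounded_meas G := cmeas G /\ exists M : R, forall x, normc (G x) <= M.

Lemma measurable_J : measurable J. Proof. exact: measurable_itv. Qed.
Hint Resolve measurable_J : core.

Lemma muJ : mu J = (2 * pi)%:E.
Proof.
rewrite lebesgue_measure_itv /= lte_fin mulr_gt0 ?pi_gt0 //.
by rewrite -EFinB subr0.
Qed.

Lemma Rintegral_cstJ (r : R) : (\int[mu]_(x in J) r)%R = r * (2 * pi).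
Proof. by rewrite Rintegral_cst // -[X in fine X]/(mu J) muJ. Qed.

Lemma cint_ext G H : (forall x, J x -> G x = H x) -> cint G = cint H.
Proof.
move=> e; rewrite /cint; congr (_ +i* _); apply: eq_Rintegral => x /set_mem /e.
- by move=> ->.
- by move=> ->.
Qed.

Lemma bm_ext G H : (forall x, G x = H x) -> bounded_meas G -> bounded_meas H.
Proof. by move=> /funext ->. Qed.

Lemma cintegrable_ext G H :
  (forall x, G x = H x) -> cintegrable G -> cintegrable H.
Proof. by move=> /funext ->. Qed.

Lemma cmeasD G H : cmeas G -> cmeas H -> cmeas (fun x => G x + H x).
Proof.
move=> [a b] [c d]; split.
- rewrite (_ : _ \o _ = (Re \o G) \+ (Re \o H)); last first.
    by apply/funext => x /=; rewrite cReD.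
  exact: measurable_funD.
- rewrite (_ : _ \o _ = (Im \o G) \+ (Im \o H)); last first.
    by apply/funext => x /=; rewrite cImD.
  exact: measurable_funD.
Qed.

Lemma cmeasM G H : cmeas G -> cmeas H -> cmeas (fun x => G x * H x).
Proof.
move=> [a b] [c d]; split.
- rewrite (_ : _ \o _ = ((Re \o G) \* (Re \o H)) \- ((Im \o G) \* (Im \o H))).
    by apply: measurable_funB; apply: measurable_funM.
  by apply/funext => x /=; rewrite cReM.
- rewrite (_ : _ \o _ = ((Re \o G) \* (Im \o H)) \+ ((Im \o G) \* (Re \o H))).
    by apply: measurable_funD; apply: measurable_funM.
  by apply/funext => x /=; rewrite cImM.
Qed.

Lemma cmeas_cst (k : C) : cmeas (fun=> k).
Proof. by split; exact: measurable_cst. Qed.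

Lemma cmeasJ G : cmeas G -> cmeas (fun x => (G x)^*).
Proof.
move=> [a b]; split.
- by rewrite (_ : _ \o _ = Re \o G) //; apply/funext => x /=; rewrite cReJ.
- rewrite (_ : _ \o _ = \- (Im \o G)); last first.
    by apply/funext => x /=; rewrite cImJ.
  exact: measurable_funN.
Qed.

Lemma bm_cst (k : C) : bounded_meas (fun=> k).
Proof. by split; [exact: cmeas_cst | exists (normc k)]. Qed.

Lemma bmD G H : bounded_meas G -> bounded_meas H -> bounded_meas (fun x => G x + H x).
Proof.
move=> [a [M hM]] [b [M' hM']]; split; first exact: cmeasD.
by exists (M + M') => x; apply: le_trans (normcD _ _) _; apply: lerD.
Qed.

Lemma bmM G H : bounded_meas G -> bounded_meas H -> bounded_meas (fun x => G x * H x).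
Proof.
move=> [a [M hM]] [b [M' hM']]; split; first exact: cmeasM.
by exists (M * M') => x; rewrite normcM; apply: ler_pM => //; apply: normc_ge0.
Qed.

Lemma bmZ (k : C) G : bounded_meas G -> bounded_meas (fun x => k * G x).
Proof. by move=> h; apply: bmM => //; apply: bm_cst. Qed.

Lemma bmN G : bounded_meas G -> bounded_meas (fun x => - G x).
Proof. by move=> /(bmZ (-1)); apply: bm_ext => x; rewrite mulN1r. Qed.

Lemma bmB G H : bounded_meas G -> bounded_meas H -> bounded_meas (fun x => G x - H x).
Proof. by move=> a b; apply: bmD => //; apply: bmN. Qed.

Lemma bmJ G : bounded_meas G -> bounded_meas (fun x => (G x)^*).
Proof.
move=> [a [M hM]]; split; first exact: cmeasJ.
by exists M => x; rewrite normc_conj.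
Qed.

Lemma bm_sum (I : Type) (r : seq I) (F : I -> R -> C) :
  (forall i, bounded_meas (F i)) -> bounded_meas (fun x => \sum_(i <- r) F i x).
Proof.
move=> h; elim: r => [|i r ih].
  by apply: bm_ext (bm_cst 0) => x; rewrite big_nil.
by apply: bm_ext (bmD (h i) ih) => x; rewrite big_cons.
Qed.

Lemma bmX n G : bounded_meas G -> bounded_meas (fun x => G x ^+ n).
Proof.
move=> h; elim: n => [|n ih].
  by apply: bm_ext (bm_cst 1) => x; rewrite expr0.
by apply: bm_ext (bmM h ih) => x; rewrite exprS.
Qed.

Lemma bm_continuous G : continuous (Re \o G : R -> R) ->
  continuous (Im \o G : R -> R) ->
  (exists M : R, forall x, normc (G x) <= M) -> bounded_meas G.
Proof.
move=> a b h; split=> //; split.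
- by apply: measurable_funS (continuous_measurable_fun a).
- by apply: measurable_funS (continuous_measurable_fun b).
Qed.

Lemma bm_cis : bounded_meas (@cis R).
Proof.
apply: bm_continuous.
- exact: continuous_cos.
- exact: continuous_sin.
- by exists 1 => x; rewrite unit_normc //; exact: cis_unit.
Qed.

Lemma bm_cisXz (k : int) : bounded_meas (fun x => cis x ^ k).
Proof.
case: k => n; first exact: bmX bm_cis.
apply: bm_ext (bmX n.+1 (bmJ bm_cis)) => x.
by rewrite NegzE -exprz_inv unit_inv ?exprnP //; exact: cis_unit.
Qed.

Lemma bounded_integrable (g : R -> R) (M : R) :
  measurable_fun J g -> (forall x, `|g x| <= M) -> mu.-integrable J (EFin \o g).
Proof.
move=> mg hM; apply: measurable_bounded_integrable => //.
  by apply: le_lt_trans (ltry (2 * pi)); rewrite -muJ.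
by exists M; split; rewrite ?num_real // => t Mt x _; apply: le_trans (hM x) (ltW Mt).
Qed.

Lemma bm_cintegrable G : bounded_meas G -> cintegrable G.
Proof.
move=> [[a b] [M hM]]; split; apply: (bounded_integrable (M := M)) => // x.
- exact: le_trans (Re_le_normc _) (hM x).
- exact: le_trans (Im_le_normc _) (hM x).
Qed.

Lemma cintegrable_cmeas G : cintegrable G -> cmeas G.
Proof.
by move=> [/measurable_int/measurable_EFinP a /measurable_int/measurable_EFinP b].
Qed.

Lemma cintegrableD G H : cintegrable G -> cintegrable H ->
  cintegrable (fun x => G x + H x).
Proof.
move=> [a b] [c d]; split.
- apply: eq_integrable (integrableD _ a c) => // x _ /=; by rewrite cReD.
- apply: eq_integrable (integrableD _ b d) => // x _ /=; by rewrite cImD.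
Qed.

Lemma integrable_bmM (g h : R -> R) (M : R) : measurable_fun J g ->
  (forall x, `|g x| <= M) -> mu.-integrable J (EFin \o h) ->
  mu.-integrable J (EFin \o (fun x => g x * h x)).
Proof.
move=> mg hM ih; have := @integrableMr _ _ _ mu _ measurable_J g _ mg _ ih.
by apply; exists M; split; rewrite ?num_real // => t Mt x _;
  apply: le_trans (hM x) (ltW Mt).
Qed.

Lemma cintegrableM G H : bounded_meas G -> cintegrable H -> cintegrable (fun x => G x * H x).
Proof.
move=> [[a b] [M hM]] [c d].
have hR x : `|(Re \o G) x| <= M by apply: le_trans (Re_le_normc _) (hM x).
have hI x : `|(Im \o G) x| <= M by apply: le_trans (Im_le_normc _) (hM x).
split.
- rewrite (_ : EFin \o _ = (EFin \o (fun x => Re (G x) * Re (H x))%R) \-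
      (EFin \o (fun x => Im (G x) * Im (H x))%R))%E; last first.
    by apply/funext => x /=; rewrite cReM.
  apply: integrableB => //.
    exact: (integrable_bmM a hR c).
  exact: (integrable_bmM b hI d).
- rewrite (_ : EFin \o _ = (EFin \o (fun x => Re (G x) * Im (H x))%R) \+
      (EFin \o (fun x => Im (G x) * Re (H x))%R))%E; last first.
    by apply/funext => x /=; rewrite cImM.
  apply: integrableD => //.
    exact: (integrable_bmM a hR d).
  exact: (integrable_bmM b hI c).
Qed.

Lemma cintegrableZ (k : C) G : cintegrable G -> cintegrable (fun x => k * G x).
Proof. by apply: cintegrableM; apply: bm_cst. Qed.

Lemma cintegrable_sum (I : Type) (r : seq I) (F : I -> R -> C) :
  (forall i, cintegrable (F i)) -> cintegrable (fun x => \sum_(i <- r) F i x).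
Proof.
move=> h; elim: r => [|i r ih].
  by apply: cintegrable_ext (bm_cintegrable (bm_cst 0)) => x; rewrite big_nil.
by apply: cintegrable_ext (cintegrableD (h i) ih) => x; rewrite big_cons.
Qed.

Lemma cintD G H : cintegrable G -> cintegrable H ->
  cint (fun x => G x + H x) = cint G + cint H.
Proof.
move=> [a b] [c d]; apply: eq_ReIm; rewrite ?cReD ?cImD /= -RintegralD //.
- by apply: eq_Rintegral => x _; rewrite cReD.
- by apply: eq_Rintegral => x _; rewrite cImD.
Qed.

Lemma cintZ (k : C) G : cintegrable G -> cint (fun x => k * G x) = k * cint G.
Proof.
move=> [a b].
have ZI (s : R) (g : R -> R) : mu.-integrable J (EFin \o g) ->
    mu.-integrable J (EFin \o (fun x => s * g x)).
  by move=> h; apply: eq_integrable (integrableZl _ s h).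
apply: eq_ReIm; rewrite ?cReM ?cImM /=.
- rewrite -!RintegralZl // -RintegralB //; try exact: ZI.
  by apply: eq_Rintegral => x _; rewrite cReM.
- rewrite -!RintegralZl // -RintegralD //; try exact: ZI.
  by apply: eq_Rintegral => x _; rewrite cImM.
Qed.

Lemma cintN G : cintegrable G -> cint (fun x => - G x) = - cint G.
Proof.
move=> h; rewrite -mulN1r -cintZ //; apply: cint_ext => x _; by rewrite mulN1r.
Qed.

Lemma cintB G H : cintegrable G -> cintegrable H ->
  cint (fun x => G x - H x) = cint G - cint H.
Proof.
move=> a b; rewrite cintD ?cintN //.
by apply: cintegrable_ext (cintegrableZ (-1) b) => x; rewrite mulN1r.
Qed.

Lemma cint0 : cint (fun=> 0) = 0.
Proof. by rewrite /cint /= !Rintegral_cst // !mul0r. Qed.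

Lemma cint_sum (I : Type) (r : seq I) (F : I -> R -> C) :
  (forall i, cintegrable (F i)) ->
  cint (fun x => \sum_(i <- r) F i x) = \sum_(i <- r) cint (F i).
Proof.
move=> h; elim: r => [|i r ih].
  by rewrite big_nil -[RHS]cint0; apply: cint_ext => x _; rewrite big_nil.
rewrite big_cons -ih -cintD //; last exact: cintegrable_sum.
by apply: cint_ext => x _; rewrite big_cons.
Qed.

Lemma Re_cint_le G H : cintegrable G -> cintegrable H ->
  (forall x, Re (G x) <= Re (H x)) -> Re (cint G) <= Re (cint H).
Proof. by move=> [a b] [c d] h; apply: le_Rintegral. Qed.

Lemma cint_real G : (forall x, Im (G x) = 0) -> Im (cint G) = 0.
Proof.
move=> h; rewrite /cint /=.
under eq_Rintegral do rewrite h.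
by rewrite Rintegral_cst // mul0r.
Qed.

Lemma cintJ G : cintegrable G -> cint (fun x => (G x)^*) = (cint G)^*.
Proof.
move=> [a b]; apply: eq_ReIm; rewrite ?cReJ ?cImJ /=.
- by apply: eq_Rintegral => x _; rewrite cReJ.
- rewrite -[RHS]mulN1r -RintegralZl //.
  by apply: eq_Rintegral => x _; rewrite cImJ mulN1r.
Qed.

(** The antiderivatives of [cos (k x)] and [sin (k x)] are periodic when [k] is
    not zero. *)
Lemma cint_cis (k : int) : cint (fun x => cis x ^ k) = (2 * pi * (k == 0)%:R)%:C.
Proof.
have [->|k0] := eqVneq k 0.
  by rewrite mulr1 /cint /= !Rintegral_cstJ mul0r mul1r.
have kR : k%:~R != 0 :> R by rewrite intr_eq0.
set a := k%:~R : R.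
have a0 : a != 0 by rewrite intr_eq0.
have lin : continuous (fun x : R => a * x).
  by move=> x; apply: cvgM; [exact: cvg_cst | exact: cvg_id].
have tp0 : 0 < 2 * pi :> R by rewrite mulr_gt0 ?pi_gt0.
have per : cis (a * (2 * pi)) = 1.
  rewrite -[a * _]/(_ * _ : R) -cisXz (_ : cis (2 * pi) = 1) ?exp1rz //.
  by rewrite /cis mulr_natl cos2pi sin2pi.
have [co si] : cos (a * (2 * pi)) = 1 /\ sin (a * (2 * pi)) = 0.
  by move: per => [-> ->].
have FTC (F f : R -> R) : continuous f -> (forall x : R, is_derive x 1 F (f x)) ->
    F (2 * pi) = F 0 -> (\int[mu]_(x in J) f x)%R = 0.
  move=> cf dF e; rewrite /Rintegral (@continuous_FTC2 _ f F) //.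
  - by rewrite e subee.
  - by apply: continuous_subspaceT.
  - have cF : continuous F.
      by move=> x; apply: differentiable_continuous; apply/derivable1_diffP.
    split; first by move=> x _.
      by apply: cvg_at_right_filter; exact: cF.
    by apply: cvg_at_left_filter; exact: cF.
  - by move=> x _; rewrite derive1E; apply: derive_val.
rewrite mulr0; apply: eq_ReIm => /=.
- under eq_Rintegral do rewrite cisXz /=.
  apply: (FTC (fun x => sin (a * x) / a)) => //.
  + move=> x; apply: continuous_comp; [exact: lin | exact: continuous_cos].
  + move=> x; apply: is_derive_eq; rewrite ?scaler0 ?add0r /GRing.scale /= ?mulr1.
 by rewrite mulrC mulfK.
  + by rewrite si mulr0 sin0.
- under eq_Rintegral do rewrite cisXz /=.
  apply: (FTC (fun x => - cos (a * x) / a)) => //.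
  + move=> x; apply: continuous_comp; [exact: lin | exact: continuous_sin].
  + move=> x; apply: is_derive_eq; rewrite ?scaler0 ?add0r /GRing.scale /= ?mulr1.
    rewrite mulNr opprK mulrC mulfK //.
  + by rewrite co mulr0 cos0.
Qed.

End Integration.

(** * Means over the circle and Fejer's theorem *)

Section Fejer.
Variable R : realType.
Local Notation C := R[i].
Local Notation Re := (@complex.Re R).
Local Notation Im := (@complex.Im R).
Local Notation J := (`[0, 2 * pi]%classic : set R).
Implicit Types (z w : C) (v : C -> R).

Definition mean (G : R -> C) : C := (2 * pi)^-1%:C * cint G.

(** Continuity of the restriction to the circle, with real tolerances and real
    distances. *)
Definition circle_continuous v := forall z, unit_circle z -> forall e : R, 0 < e ->
  exists2 d : R, 0 < d & forall w, unit_circle w -> normc (w - z) < d ->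
    `|v w - v z| < e.

Lemma circle_continuous_cis v : circle_continuous v ->
  continuous (v \o @cis R : R -> R).
Proof.
move=> cv x; apply/cvgrPdist_lt => e e0.
have [d d0 hd] := cv _ (cis_unit x) e e0.
near=> y; rewrite /= distrC; apply: hd; first exact: cis_unit.
apply: le_lt_trans (normc_cisB _ _) _; rewrite distrC.
by near: y; apply: cvgr_dist_lt.
Unshelve. all: by end_near. Qed.

Lemma circle_continuous_bounded v : circle_continuous v ->
  exists M : R, forall z, unit_circle z -> `|v z| <= M.
Proof.
move=> cv.
have tp0 : 0 <= 2 * pi :> R by rewrite mulr_ge0 ?pi_ge0.
have cn : {within `[0, 2 * pi], continuous (fun x => `|v (cis x)| : R)}.
  apply: continuous_subspaceT => x; apply: continuous_comp.
    exact: (circle_continuous_cis cv).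
  exact: norm_continuous.
have [c _ hc] := EVT_max tp0 cn.
exists `|v (cis c)| => z /unit_cis [x xJ ->]; by apply: hc; rewrite in_itv.
Qed.

(** Heine's theorem, from the compactness of the parameter interval. *)
Lemma circle_continuous_uniform v : circle_continuous v -> forall e : R, 0 < e ->
  exists2 d : R, 0 < d & forall z w, unit_circle z -> unit_circle w ->
    normc (w - z) < d -> `|v w - v z| < e.
Proof.
move=> cv e e0.
have cJ : compact (`[0, 2 * pi]%classic : set R) by exact: segment_compact.
have /compact_near_coveringP := cJ => nc.
(* [P d x] is stable under small moves of [x] at the price of halving [d]. *)
pose P (d x : R) := forall w, unit_circle w -> normc (w - cis x) < d ->
    `|v w - v (cis x)| < e.
have [] := nc R (0^'+) P _.
  move=> x _.
  have [d d0 hd] := cv _ (cis_unit x) (e / 2) (divr_gt0 e0 (ltr0n R 2)).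
  have d20 : 0 < d / 2 by lra.
  exists (ball x (d / 2), [set t : R | t < d / 2]) => /=.
    split; first exact: nbhsx_ballx.
    exact: nbhs_right_lt.
  move=> [y t] /= [xy td] w uw wt.
  have h1 : normc (cis y - cis x) < d / 2.
    by apply: le_lt_trans (normc_cisB _ _) _; rewrite distrC.
  have h2 : normc (w - cis x) < d.
    rewrite (_ : w - cis x = (w - cis y) + (cis y - cis x)); last by ring.
    by apply: le_lt_trans (normcD _ _) _; lra.
  have := hd _ uw h2; have : `|v (cis y) - v (cis x)| < e / 2.
    by apply: hd; [exact: cis_unit | lra].
  rewrite !ltr_norml; lra.
move=> d /= d0 hd.
exists (d / 2); first lra.
move=> z w /unit_cis [x xJ ->] uw h.
apply: (hd (d / 2)) => //=; first by rewrite sub0r normrN ger0_norm; lra.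
  by lra.
Qed.

(** Uniform continuity handles close points; for distant ones the quadratic term
    is at least twice the bound of [v]. This replaces the splitting of the circle
    into near and far arcs in Fejer's theorem. *)
Lemma circle_continuous_quadratic v : circle_continuous v -> forall e : R, 0 < e ->
  exists2 K : R, 0 <= K & forall z w, unit_circle z -> unit_circle w ->
    `|v w - v z| <= e + K * sqnormC (w - z).
Proof.
move=> cv e e0.
have [d d0 hd] := circle_continuous_uniform cv e0.
have [M hM] := circle_continuous_bounded cv.
have M0 : 0 <= M by apply: le_trans (hM 1 _) => //; rewrite -cis0; exact: cis_unit.
exists (2 * M / d ^+ 2); first by rewrite divr_ge0 ?sqr_ge0 ?mulr_ge0.
move=> z w uz uw; have [h|h] := ltP (normc (w - z)) d.
  apply: le_trans (ltW (hd _ _ uz uw h)) _; rewrite lerDl mulr_ge0 ?sqnormC_ge0 //.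
  by rewrite divr_ge0 ?sqr_ge0 ?mulr_ge0.
apply: (@le_trans _ _ (2 * M)).
  by apply: le_trans (ler_normB _ _) _; have := hM _ uz; have := hM _ uw; lra.
apply: (@le_trans _ _ (2 * M / d ^+ 2 * d ^+ 2)).
  by rewrite divfK // sqrf_eq0 gt_eqF.
apply: ler_wpDl; first exact: ltW.
apply: ler_wpM2l; first by rewrite divr_ge0 ?sqr_ge0 ?mulr_ge0.
by rewrite -sqr_normcE ler_pXn2r // nnegrE ?normc_ge0 // ltW.
Qed.

Lemma bm_circle_continuous (F : C -> C) :
  circle_continuous (Re \o F) -> circle_continuous (Im \o F) ->
  bounded_meas (F \o @cis R).
Proof.
move=> cR cI; apply: bm_continuous.
- exact: (circle_continuous_cis cR).
- exact: (circle_continuous_cis cI).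
have [M hM] := circle_continuous_bounded cR.
have [M' hM'] := circle_continuous_bounded cI.
exists (M + M') => x; apply: le_trans (normc_le_ReIm _) _.
by apply: lerD; [apply: hM | apply: hM']; exact: cis_unit.
Qed.

Lemma meanD G H : cintegrable G -> cintegrable H ->
  mean (fun x => G x + H x) = mean G + mean H.
Proof. by move=> a b; rewrite /mean cintD // mulrDr. Qed.

Lemma meanB G H : cintegrable G -> cintegrable H ->
  mean (fun x => G x - H x) = mean G - mean H.
Proof. by move=> a b; rewrite /mean cintB // mulrBr. Qed.

Lemma meanZ (k : C) G : cintegrable G -> mean (fun x => k * G x) = k * mean G.
Proof. by move=> a; rewrite /mean cintZ // mulrCA. Qed.

Lemma mean_sum (I : Type) (r : seq I) (F : I -> R -> C) :
  (forall i, cintegrable (F i)) ->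
  mean (fun x => \sum_(i <- r) F i x) = \sum_(i <- r) mean (F i).
Proof. by move=> h; rewrite /mean cint_sum // mulr_sumr. Qed.

Lemma mean_ext G H : (forall x, G x = H x) -> mean G = mean H.
Proof. by move=> /funext ->. Qed.

Lemma mean_cis (k : int) : mean (fun x => cis x ^ k) = (k == 0)%:R.
Proof.
rewrite /mean cint_cis -rmorphM mulrA mulVf; last by rewrite mulf_neq0 ?gt_eqF ?pi_gt0.
by rewrite mul1r; case: (k == 0).
Qed.

Lemma mean_cst (k : C) : mean (fun=> k) = k.
Proof.
rewrite -[RHS]mulr1 -[X in _ = _ * X]/((0 == 0 :> int)%:R) -mean_cis -meanZ.
  by apply: mean_ext => x; rewrite mulr1.
exact/bm_cintegrable/bm_cisXz.
Qed.

Lemma Re_mean_le G H : cintegrable G -> cintegrable H ->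
  (forall x, Re (G x) <= Re (H x)) -> Re (mean G) <= Re (mean H).
Proof.
move=> a b h; rewrite /mean !cReM /= !mul0r !subr0.
apply: ler_wpM2l; last exact: Re_cint_le.
by rewrite invr_ge0 mulr_ge0 ?pi_ge0.
Qed.

Lemma meanJ G : cintegrable G -> mean (fun x => (G x)^*) = (mean G)^*.
Proof.
by move=> a; rewrite /mean cintJ //; apply: eq_ReIm; rewrite !ReIm /=; ring.
Qed.

Lemma mean_real G : (forall x, Im (G x) = 0) -> Im (mean G) = 0.
Proof. by move=> h; rewrite /mean cImM (cint_real h) mulr0 mul0r addr0. Qed.

Definition trig_poly (s : seq (C * int)) z : C :=
  \sum_(p <- s) p.1 * z ^ p.2.

Lemma bm_trig s : bounded_meas (fun x => trig_poly s (cis x)).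
Proof. by apply: bm_sum => p; apply: bmZ; apply: bm_cisXz. Qed.

Lemma bm_real v : circle_continuous v -> bounded_meas (fun x => (v (cis x))%:C).
Proof.
move=> cv; apply: (@bm_circle_continuous (fun z => (v z)%:C)) => //.
by move=> z _ e e0; exists 1 => // w _ _; rewrite /= subrr normr0.
Qed.

(** The Fejer kernel as the square modulus of a geometric sum, a form from which
    its positivity is clear. *)
Definition fejer (m : nat) z : C := m.+1%:R^-1 * (sqnormC (\sum_(j < m.+1) z ^+ j))%:C.

Lemma fejerE m z : unit_circle z -> fejer m z =
  m.+1%:R^-1 * \sum_(i < m.+1) \sum_(j < m.+1) z ^ (i%:Z - j%:Z).
Proof.
move=> uz; rewrite /fejer -mulcJ rmorph_sum mulr_suml; congr (_ * _).
apply: eq_bigr => i _; rewrite mulr_sumr; apply: eq_bigr => j _.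
rewrite expfzDr ?unit_neq0 //; congr (_ * _); exact: (unitXz_conj j uz).
Qed.

(** Averaging against the kernel yields a trigonometric polynomial because the
    kernel is one in [z], with coefficients that are powers of the other point. *)
Lemma mean_fejer_mul v m z : circle_continuous v -> unit_circle z ->
  mean (fun x => (v (cis x))%:C * fejer m (z / cis x)) =
  trig_poly [seq (m.+1%:R^-1 *
      mean (fun x => (v (cis x))%:C * cis x ^ ((p : 'I_m.+1 * 'I_m.+1).2%:Z - p.1%:Z)),
      (p.1%:Z - p.2%:Z)) | p <- enum {: 'I_m.+1 * 'I_m.+1}] z.
Proof.
move=> cv uz; rewrite /trig_poly big_map big_enum /=.
have ib (k : int) : cintegrable (fun x => (v (cis x))%:C * cis x ^ k).
  by apply: bm_cintegrable; apply: bmM; [exact: bm_real | exact: bm_cisXz].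
under [LHS]mean_ext => x.
  have uu : unit_circle (z / cis x).
    by apply: unitM => //; apply/unitV/cis_unit.
  rewrite fejerE // pair_big /= mulrCA mulr_sumr -big_enum.
  over.
rewrite /= meanZ; last first.
  apply: cintegrable_sum => -[i j].
  apply: cintegrable_ext (cintegrableZ (z ^ (i%:Z - j%:Z)) (ib (j%:Z - i%:Z))) => x /=.
  rewrite exprzMl ?unitfE ?invr_eq0 ?unit_neq0 //; last exact: cis_unit.
  by rewrite exprz_inv opprB mulrCA.
rewrite mean_sum; last first.
  move=> -[i j].
  apply: cintegrable_ext (cintegrableZ (z ^ (i%:Z - j%:Z)) (ib (j%:Z - i%:Z))) => x /=.
  rewrite exprzMl ?unitfE ?invr_eq0 ?unit_neq0 //; last exact: cis_unit.
  by rewrite exprz_inv opprB mulrCA.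
rewrite mulr_sumr big_enum; apply: eq_bigr => -[i j] _ /=.
rewrite -mulrA; congr (_ * _); rewrite mulrC -meanZ //; apply: mean_ext => x.
rewrite exprzMl ?unitfE ?invr_eq0 ?unit_neq0 //; last exact: cis_unit.
by rewrite exprz_inv opprB mulrCA.
Qed.

Lemma mean_fejer m z : unit_circle z -> mean (fun x => fejer m (z / cis x)) = 1.
Proof.
move=> uz.
have c1 : circle_continuous (fun=> 1).
  by move=> w _ e e0; exists 1 => // t _ _; rewrite subrr normr0.
have := mean_fejer_mul m c1 uz.
rewrite (_ : mean _ = mean (fun x => fejer m (z / cis x))); last first.
  by apply: mean_ext => x; rewrite mul1r.
move=> ->; rewrite /trig_poly big_map big_enum /=.
rewrite -(pair_bigA _ (fun i j : 'I_m.+1 => m.+1%:R^-1 *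
   mean (fun x => 1%:C * cis x ^ (j%:Z - i%:Z)) * z ^ (i%:Z - j%:Z))) /=.
under eq_bigr => i _.
  rewrite (bigD1 i) //= big1 ?addr0; last first.
    move=> j ji; rewrite (_ : mean _ = 0) ?mulr0 ?mul0r //.
    under mean_ext do rewrite mul1r.
    rewrite mean_cis subr_eq0 (_ : _ == _ = false) //.
    by apply/negbTE; apply: contraNneq ji => -[] /val_inj ->.
  rewrite (_ : mean _ = 1) ?mulr1 ?subrr ?expr0z ?mulr1; last first.
    under mean_ext do rewrite mul1r.
    by rewrite ?mean_cis ?mean_cst.
  over.
by rewrite sumr_const card_ord -[LHS]mulr_natr mulVf // pnatr_eq0.
Qed.

(** Multiplying by [|z - 1|^2] telescopes the geometric sum, leaving
    [|z^(m+1) - 1|^2 <= 4]: the kernel has little mass away from one. *)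
Lemma fejer_tail m z : unit_circle z ->
  sqnormC (z - 1) * Re (fejer m z) <= 4 / m.+1%:R.
Proof.
move=> uz; rewrite /fejer.
rewrite (_ : m.+1%:R^-1 = (m.+1%:R^-1 : R)%:C); last by rewrite fmorphV rmorph_nat.
rewrite -rmorphM /= mulrCA -sqnormCM -subrX1 mulrC ler_pM2r ?invr_gt0 ?ltr0n //.
rewrite -sqr_normcE.
have : normc (z ^+ m.+1 - 1) <= 2.
  apply: le_trans (normcD _ _) _; rewrite normcN normc1.
  by rewrite (unit_normc (unitX _ uz)).
have := normc_ge0 (z ^+ m.+1 - 1); set a := normc _; nra.
Qed.

Lemma Im_fejer m z : Im (fejer m z) = 0.
Proof.
rewrite /fejer (_ : m.+1%:R^-1 = (m.+1%:R^-1 : R)%:C); last by rewrite fmorphV rmorph_nat.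
by rewrite -rmorphM.
Qed.

Lemma Re_fejer_ge0 m z : 0 <= Re (fejer m z).
Proof.
rewrite /fejer (_ : m.+1%:R^-1 = (m.+1%:R^-1 : R)%:C); last by rewrite fmorphV rmorph_nat.
by rewrite -rmorphM /= mulr_ge0 ?sqnormC_ge0 // invr_ge0 ler0n.
Qed.

Lemma bm_fejer m z : unit_circle z -> bounded_meas (fun x => fejer m (z / cis x)).
Proof.
move=> uz; have b : bounded_meas (fun x => z / cis x).
  apply: bmZ; apply: bm_ext (bmJ (bm_cis R)) => x.
  by rewrite unit_inv //; exact: cis_unit.
have bs : bounded_meas (fun x => \sum_(j < m.+1) (z / cis x) ^+ j).
  by apply: bm_sum => j; apply: bmX.
by apply: bm_ext (bmZ m.+1%:R^-1 (bmM bs (bmJ bs))) => x; rewrite /fejer -mulcJ.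
Qed.

(** The error is an average of [v z - v w] against the positive kernel of total
    mass one. The quadratic modulus of continuity splits it into the tolerance
    and a multiple of the quantity bounded in [fejer_tail]. *)
Theorem fejer_density v : circle_continuous v -> forall e : R, 0 < e ->
  exists s, forall z, unit_circle z -> normc ((v z)%:C - trig_poly s z) <= e.
Proof.
move=> cv e e0.
have e20 : 0 < e / 2 by lra.
have [K K0 hK] := circle_continuous_quadratic cv e20.
(* Chosen so that [4 K / (m + 1)] is at most [e / 2]. *)
pose m := Num.trunc (8 * K / e).
have hm : K * (4 / m.+1%:R) <= e / 2.
  have : 8 * K / e < m.+1%:R by exact: truncnS_gt.
  have mp : 0 < m.+1%:R :> R by rewrite ltr0n.
  rewrite ltr_pdivrMr // mulrA ler_pdivrMr // => ?; nra.
exists [seq (m.+1%:R^-1 *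
      mean (fun x => (v (cis x))%:C * cis x ^ ((p : 'I_m.+1 * 'I_m.+1).2%:Z - p.1%:Z)),
      (p.1%:Z - p.2%:Z)) | p <- enum {: 'I_m.+1 * 'I_m.+1}] => z uz.
rewrite -mean_fejer_mul //.
have bF := bm_fejer m uz.
have bv := bm_real cv.
have -> : (v z)%:C - mean (fun x => (v (cis x))%:C * fejer m (z / cis x)) =
    mean (fun x => ((v z)%:C - (v (cis x))%:C) * fejer m (z / cis x)).
  rewrite -[X in X - _ = _]mulr1 -(mean_fejer m uz) -meanZ; last exact: bm_cintegrable.
  rewrite -meanB; try by apply: bm_cintegrable; first [exact: bmZ | exact: bmM].
  by apply: mean_ext => x; rewrite mulrBl.
set D := mean _.
have im0 : Im D = 0.
  apply: mean_real => x; rewrite cImM Im_fejer mulr0 add0r.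
  by rewrite (_ : Im (_ - _) = 0) ?mul0r //= subr0.
have iD : bounded_meas (fun x => ((v z)%:C - (v (cis x))%:C) * fejer m (z / cis x)).
  by apply: bmM => //; apply: bmB => //; apply: bm_cst.
have key x : `|(v z - v (cis x)) * Re (fejer m (z / cis x))| <=
    e / 2 * Re (fejer m (z / cis x)) + K * (4 / m.+1%:R).
  have uw := cis_unit x; have uu : unit_circle (z / cis x) by apply: unitM => //; apply: unitV.
  rewrite normrM [`|Re _|]ger0_norm ?Re_fejer_ge0 //.
  have h1 := hK _ _ uw uz; have h2 := fejer_tail m uu; have h3 := Re_fejer_ge0 m (z / cis x).
  have e2 : sqnormC (z / cis x - 1) = sqnormC (z - cis x).
    have <- : (z / cis x - 1) * cis x = z - cis x.
      by rewrite mulrBl divfK ?unit_neq0 // mul1r.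
    by rewrite sqnormCM (proj1 (unit_circleE _) uw) mulr1.
  rewrite e2 in h2.
  apply: (@le_trans _ _ ((e / 2 + K * sqnormC (z - cis x)) * Re (fejer m (z / cis x)))).
    exact: ler_wpM2r.
  by rewrite mulrDl lerD2l -mulrA ler_wpM2l.
have ReD x : Re (((v z)%:C - (v (cis x))%:C) * fejer m (z / cis x)) =
     (v z - v (cis x)) * Re (fejer m (z / cis x)).
  by rewrite cReM Im_fejer mulr0 subr0 cReB.
have bH : bounded_meas (fun x => (e / 2)%:C * fejer m (z / cis x) + (K * (4 / m.+1%:R))%:C).
  by apply: bmD; [exact: bmZ | exact: bm_cst].
have eH : Re (mean (fun x => (e / 2)%:C * fejer m (z / cis x) + (K * (4 / m.+1%:R))%:C))
    = e / 2 + K * (4 / m.+1%:R).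
  rewrite meanD; try by apply: bm_cintegrable; first [exact: bmZ | exact: bm_cst].
  by rewrite meanZ ?mean_fejer ?mean_cst ?mulr1 //; exact: bm_cintegrable.
have up : `|Re D| <= e / 2 + K * (4 / m.+1%:R).
  rewrite ler_norml -eH; apply/andP; split.
    rewrite lerNl -cReN -mulN1r /D -meanZ; last exact: bm_cintegrable.
    apply: Re_mean_le; first [exact: bm_cintegrable | by apply: bm_cintegrable; exact: bmZ | idtac].
    move=> x; rewrite mulN1r cReN ReD cReD cReM Im_fejer mulr0 subr0 /=.
    by have := key x; rewrite ler_norml => /andP[h _]; rewrite lerNl.
  apply: Re_mean_le; try exact: bm_cintegrable.
  move=> x; rewrite ReD cReD cReM Im_fejer mulr0 subr0 /=.
  by have := key x; rewrite ler_norml => /andP[].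
apply: le_trans (normc_le_ReIm _) _; rewrite im0 normr0 addr0.
by apply: le_trans up _; rewrite [leRHS](splitr e) lerD2l.
Qed.

End Fejer.

(** * Polynomial multipliers making the symbol sectorial *)

Section Sectorial.
Variable R : realType.
Local Notation C := R[i].
Local Notation Re := (@complex.Re R).
Local Notation Im := (@complex.Im R).
Implicit Types (z w : C).

Lemma cexpE z : Re (cexp z) = expR (Re z) * cos (Im z) /\
                Im (cexp z) = expR (Re z) * sin (Im z).
Proof. by split; rewrite /cexp ?cReM ?cImM /= mul0r ?subr0 ?addr0. Qed.

Lemma cexpD z w : cexp (z + w) = cexp z * cexp w.
Proof. by rewrite /cexp cReD cImD expRD cisD rmorphM /=; ring. Qed.

Lemma cexp0 : cexp (0 : C) = 1.
Proof. by rewrite /cexp /= expR0 cis0 mulr1. Qed.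

Lemma cexp_mulrn z n : cexp (z *+ n) = cexp z ^+ n.
Proof.
elim: n => [|n ih]; first by rewrite mulr0n cexp0.
by rewrite mulrS cexpD ih exprS.
Qed.

Lemma cexpJ z : (cexp z)^* = cexp z^*.
Proof.
by have [a b] := cexpE z; have [c d] := cexpE z^*; apply: eq_ReIm;
  rewrite ?cReJ ?cImJ ?a ?b ?c ?d ?cReJ ?cImJ ?cosN ?sinN ?mulrN.
Qed.

Lemma normc_cexp z : normc (cexp z) = expR (Re z).
Proof.
rewrite /cexp normcM normc_real (unit_normc (cis_unit _)) mulr1.
by rewrite ger0_norm // expR_ge0.
Qed.

Lemma sin_sub_le (t : R) : `|t| <= 1 -> `|sin t - t| <= t ^+ 2.
Proof.
wlog t0 : t / 0 <= t.
  move=> h; have [t0|/ltW t0] := leP 0 t; first exact: h.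
  have := h (- t); rewrite sinN normrN sqrrN oppr_ge0 => /(_ t0) h1 /h1.
  by rewrite -opprD normrN.
rewrite ger0_norm // => t1.
have [->|tn0] := eqVneq t 0; first by rewrite sin0 subrr normr0 expr0n.
have tp : 0 < t by rewrite lt_def tn0.
have sC : {within `[0, t], continuous (@sin R)}.
  by apply: continuous_subspaceT => x; exact: continuous_sin.
have [x] := @MVT R sin cos 0 t tp (fun x _ => is_derive_sin x) sC.
rewrite in_itv /= sin0 !subr0 => /andP[x0 xt] ->.
have := cos_le1 x; have := cos_ge x; rewrite ler_norml => h1 h2.
have : x ^+ 2 <= t by nra.
by move=> ?; apply/andP; split; nra.
Qed.

Lemma expR_sub_le (s : R) : `|s| <= 1 / 2 ->
  [/\ `|expR s - 1 - s| <= 2 * s ^+ 2 & expR s <= 2].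
Proof.
rewrite ler_norml => /andP[s1 s2].
have h1 := expR_ge1Dx s; have h2 := expR_ge1Dx (- s).
have h3 : expR s * expR (- s) = 1 by rewrite -expRD subrr expR0.
have h4 := expR_gt0 s.
set a := expR s in h1 h3 h4 *; set b := expR (- s) in h2 h3.
have ab : a * (1 - s) <= 1 by nra.
have a2 : a <= 2 by nra.
by split=> //; rewrite ler_norml; apply/andP; split; nra.
Qed.

(** Componentwise Taylor estimates; the constant 10 leaves room for crude
    bounds of the two components. *)
Lemma cexp_first_order w : normc w <= 1 / 2 ->
  normc (cexp w - (1 + w)) <= 10 * normc w ^+ 2.
Proof.
move=> w1; have hs := Re_le_normc w; have ht := Im_le_normc w.
set r := normc w in w1 hs ht *; have r0 : 0 <= r := normc_ge0 w.
have [c d] := cexpE w.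
apply: le_trans (normc_le_ReIm _) _.
rewrite cReB cImB c d cReD cImD [Re 1]/= [Im 1]/= add0r.
set s := Re w in hs *; set t := Im w in ht *.
have [e1 e2] := expR_sub_le (le_trans hs w1).
have e0 := expR_ge0 s.
have t1 : `|t| <= 1 by lra.
have st := sin_sub_le t1.
have c1 := cos_le1 t; have c2 := cos_ge t.
have s2 : s ^+ 2 <= r ^+ 2 by rewrite -(real_normK (num_real s)) ler_pXn2r ?nnegrE.
have t2 : t ^+ 2 <= r ^+ 2 by rewrite -(real_normK (num_real t)) ler_pXn2r ?nnegrE.
have A : `|expR s * cos t - (1 + s)| <= 3 * r ^+ 2.
  have -> : expR s * cos t - (1 + s) = (expR s - 1 - s) - expR s * (1 - cos t) by ring.
  apply: le_trans (ler_normB _ _) _.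
  have : `|expR s * (1 - cos t)| <= r ^+ 2.
    by rewrite ger0_norm; [nra | apply: mulr_ge0 => //; lra].
  lra.
have B : `|expR s * sin t - t| <= 4 * r ^+ 2.
  have -> : expR s * sin t - t = expR s * (sin t - t) + (expR s - 1) * t by ring.
  apply: le_trans (ler_normD _ _) _; rewrite !normrM (ger0_norm e0).
  have b1 : `|expR s - 1| <= 2 * r.
    rewrite (_ : expR s - 1 = (expR s - 1 - s) + s); last by ring.
    apply: le_trans (ler_normD _ _) _; nra.
  have b2 : `|expR s - 1| * `|t| <= 2 * r * r by apply: ler_pM.
  have b3 : expR s * `|sin t - t| <= 2 * r ^+ 2.
    by apply: ler_pM => //; apply: le_trans t2.
  by rewrite expr2 in b3 *; lra.
by have := sqr_ge0 r; lra.
Qed.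

Lemma normcXB (a b : C) (M : R) n : 1 <= M -> normc a <= M -> normc b <= M ->
  normc (a ^+ n - b ^+ n) <= n%:R * M ^+ n * normc (a - b).
Proof.
move=> M1 aM bM; elim: n => [|n ih]; first by rewrite subrr normc0 !mul0r.
have M0 : 0 <= M by lra.
have -> : a ^+ n.+1 - b ^+ n.+1 = a * (a ^+ n - b ^+ n) + (a - b) * b ^+ n.
  by rewrite !exprS; ring.
have d0 := normc_ge0 (a - b).
apply: le_trans (normcD _ _) _; rewrite !normcM.
have h1 : normc a * normc (a ^+ n - b ^+ n) <=
    M * (n%:R * M ^+ n * normc (a - b)) by apply: ler_pM => //; apply: normc_ge0.
have h2 : normc (b ^+ n) <= M ^+ n.
  elim: n {ih h1} => [|n ih]; first by rewrite !expr0 normc1.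
  by rewrite !exprS normcM; apply: ler_pM => //; apply: normc_ge0.
have h3 : normc (a - b) * normc (b ^+ n) <= normc (a - b) * M ^+ n.+1.
  apply: ler_wpM2l => //; apply: le_trans h2 _; rewrite exprS ler_peMl //.
  exact: exprn_ge0.
apply: le_trans (lerD h1 h3) _.
by rewrite -[in leRHS]natr1 exprS le_eqVlt; apply/orP; left; apply/eqP; ring.
Qed.

(** The polynomials that approximate the exponential uniformly on discs. Both
    [1 + w/n] and [exp (w/n)] have modulus at most [exp (K/n)] and differ by
    [O (1/n^2)], so their [n]-th powers differ by [O (1/n)]. *)
Lemma cexp_limit (K e : R) : 0 < e ->
  exists n, forall w, normc w <= K ->
    normc ((1 + n.+1%:R^-1 * w) ^+ n.+1 - cexp w) <= e.
Proof.
move=> e0.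
(* [B e / n] is the error bound obtained below for the [n]-th power. *)
pose B := 10 * K ^+ 2 * expR K / e.
pose n := maxn (Num.trunc (2 * K)) (Num.trunc B); exists n => w wK.
have K0 : 0 <= K by apply: le_trans wK; exact: normc_ge0.
set m : R := n.+1%:R.
have m0 : 0 < m by rewrite ltr0n.
have [mK mB] : 2 * K <= m /\ B <= m.
  split; apply: le_trans (ltW (truncnS_gt _)) _; rewrite ler_nat ltnS.
    exact: leq_maxl.
  exact: leq_maxr.
have em : (n.+1%:R^-1 : C) = (m^-1)%:C by rewrite fmorphV rmorph_nat.
set u := n.+1%:R^-1 * w.
have nu : normc u = normc w / m.
  by rewrite /u em normcM normc_real ger0_norm ?invr_ge0 ?(ltW m0) // mulrC.
have uK : normc u <= K / m by rewrite nu ler_pM2r ?invr_gt0.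
have u2 : normc u <= 1 / 2.
  apply: le_trans uK _; rewrite ler_pdivrMr //; lra.
have -> : cexp w = cexp u ^+ n.+1.
  rewrite -cexp_mulrn /u -[_ *+ _]mulr_natl mulrA mulfV ?mul1r //.
have M1 : 1 <= expR (K / m).
  by rewrite -expR0 ler_expR divr_ge0 // ltW.
have a1 : normc (1 + u) <= expR (K / m).
  apply: le_trans (normcD _ _) _; rewrite normc1.
  by apply: le_trans (expR_ge1Dx _); rewrite lerD2l.
have a2 : normc (cexp u) <= expR (K / m).
  rewrite normc_cexp ler_expR; apply: le_trans uK.
  exact: le_trans (ler_norm _) (Re_le_normc _).
apply: le_trans (normcXB _ M1 a1 a2) _.
have -> : expR (K / m) ^+ n.+1 = expR K.
  by rewrite -expRM_natl -/m mulrC divfK // gt_eqF.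
rewrite normcB -/m.
have h := cexp_first_order u2.
have h2 : 10 * normc u ^+ 2 <= 10 * (K / m) ^+ 2.
  by rewrite ler_pM2l // ler_pXn2r // ?nnegrE ?normc_ge0 // divr_ge0 // ltW.
apply: (@le_trans _ _ (m * expR K * (10 * (K / m) ^+ 2))).
  apply: ler_wpM2l; first by rewrite mulr_ge0 ?expR_ge0 ?ltW.
  exact: le_trans h h2.
have -> : m * expR K * (10 * (K / m) ^+ 2) = B * e / m.
  rewrite /B; field; by rewrite ?gt_eqF.
by rewrite ler_pdivrMr // mulrC ler_pM2l.
Qed.

Lemma poly_bounded (p : {poly C}) :
  exists M : R, forall z, unit_circle z -> normc p.[z] <= M.
Proof.
elim/poly_ind: p => [|p c [M hM]].
  by exists 0 => z _; rewrite horner0 normc0.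
exists (M + normc c) => z uz; rewrite hornerMXaddC.
apply: le_trans (normcD _ _) _; rewrite lerD2r normcM (unit_normc uz) mulr1.
exact: hM.
Qed.

(** Conjugating a coefficient and inverting the power it multiplies leaves the
    real part unchanged on the circle, so negative frequencies can be folded. *)
Lemma Re_trig_poly (s : seq (C * int)) :
  exists P : {poly C}, forall z, unit_circle z -> Re P.[z] = Re (trig_poly s z).
Proof.
elim: s => [|[a k] s [P hP]].
  by exists 0 => z _; rewrite horner0 /trig_poly big_nil.
case: k => n.
- pose Q : {poly C} := a *: (GRing.exp (polyX C) n) + P; exists Q => z uz; rewrite /Q {Q}.
  by rewrite /trig_poly big_cons hornerD hornerZ hornerXn !cReD -hP.
- pose Q : {poly C} := a^* *: (GRing.exp (polyX C) n.+1) + P; exists Q => z uz; rewrite /Q {Q}.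
  rewrite /trig_poly big_cons hornerD hornerZ hornerXn !cReD -hP //=.
  rewrite NegzE -(unitXz_conj n.+1 uz) -exprnP !cReM !cReJ !cImJ; ring.
Qed.

(** When the arguments of [exp g] and [exp P] differ by at most one, the number
    [exp g conj (exp P)] has an argument whose cosine is at least 1/2; replacing
    [exp P] by a close [psi] costs at most half of the resulting lower bound. *)
Lemma near_exp_sector (g : C) (P psi : C) (K : R) :
  `|Re g| <= K -> normc P <= K -> `|Im g - Im P| <= 1 ->
  normc (psi - cexp P) <= expR (- (3 * K)) / 4 ->
  expR (- (2 * K)) / 4 <= Re (cexp g * psi^*).
Proof.
move=> gK PK im1 hpsi.
have -> : cexp g * psi^* = cexp (g + P^*) + cexp g * (psi - cexp P)^*.
  by rewrite cexpD -cexpJ rmorphB /=; ring.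
rewrite cReD (cexpE _).1 cReD cImD cReJ cImJ.
have PR : `|Re P| <= K by apply: le_trans PK; exact: Re_le_normc.
have h1 : expR (- (2 * K)) <= expR (Re g + Re P).
  by rewrite ler_expR; move: gK PR; rewrite !ler_norml; lra.
have h2 : 1 / 2 <= cos (Im g - Im P).
  have := cos_ge (Im g - Im P); have : (Im g - Im P) ^+ 2 <= 1.
    by rewrite -(real_normK (num_real _)) exprn_ile1.
  lra.
have h3 : `|Re (cexp g * (psi - cexp P)^*)| <= expR (- (2 * K)) / 4.
  apply: le_trans (Re_le_normc _) _; rewrite normcM normc_conj normc_cexp.
  apply: (@le_trans _ _ (expR K * (expR (- (3 * K)) / 4))).
    apply: ler_pM; rewrite ?expR_ge0 ?normc_ge0 // ler_expR.
    by move: gK; rewrite ler_norml; lra.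
  by rewrite mulrA -expRD (_ : K - 3 * K = - (2 * K)) //; ring.
have := expR_gt0 (- (2 * K)); move: h3; rewrite ler_norml => /andP[h3 _] h4.
have : expR (- (2 * K)) * (1 / 2) <= expR (Re g + Re P) * cos (Im g - Im P).
  by apply: ler_pM => //; apply: expR_ge0.
lra.
Qed.

(** Polynomials close to [exp P] and [exp (- P)], where the imaginary part of [P]
    approximates that of [g]. The first turns the symbol into a coercive one from
    the side of low frequencies, the second from the side of high frequencies. *)
Theorem sectorial_multipliers (f g : C -> C) :
  (forall z, unit_circle z -> cexp (g z) = f z) ->
  circle_continuous (Re \o g) -> circle_continuous (Im \o g) ->
  exists psi1 psi2 : {poly C}, exists2 c : R, 0 < c &
    forall z, unit_circle z ->
      c <= Re (f z * (psi1.[z])^*) /\ c <= Re (f z * psi2.[z]).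
Proof.
move=> fE cR cI.
have [s hs] := fejer_density cI (@ltr01 R).
have [P0 hP0] := Re_trig_poly s.
pose P := 'i *: P0.
have ImP z : unit_circle z -> `|Im (g z) - Im P.[z]| <= 1.
  move=> uz; rewrite /P hornerZ cImM /= mul0r add0r mul1r hP0 //.
  by apply: le_trans (hs z uz); apply: le_trans (Re_le_normc _); rewrite cReB.
have [K1 hK1] := circle_continuous_bounded cR.
have [K2 hK2] := poly_bounded P.
pose K := Num.max K1 K2.
have e0 : 0 < expR (- (3 * K)) / 4 by rewrite divr_gt0 ?expR_gt0.
have [n hn] := cexp_limit K e0.
pose psi (s : C) : {poly C} := (1 + (n.+1%:R^-1 * s) *: P) ^+ n.+1.
have psiE (s0 z : C) : (psi s0).[z] = (1 + n.+1%:R^-1 * (s0 * P.[z])) ^+ n.+1.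
  by rewrite /psi horner_exp hornerD hornerZ hornerE mulrA.
exists (psi 1), (psi (-1)); exists (expR (- (2 * K)) / 4).
  by rewrite divr_gt0 ?expR_gt0.
move=> z uz.
have g1 : `|Re (g z)| <= K by apply: le_trans (hK1 z uz) _; rewrite le_max lexx.
have p1 : normc P.[z] <= K by apply: le_trans (hK2 z uz) _; rewrite le_max lexx orbT.
rewrite -fE //; split.
  apply: (near_exp_sector (P := P.[z])) => //; first exact: ImP.
  by rewrite psiE mul1r; apply: hn.
rewrite -[(psi (-1)).[z]]conjCK; apply: (near_exp_sector (P := - (P.[z])^*)) => //.
- by rewrite normcN normc_conj.
- by rewrite cImN cImJ opprK; exact: ImP.
have -> : - (P.[z])^* = (- P.[z])^* by apply: eq_ReIm; rewrite !ReIm.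
have -> : ((psi (-1)).[z])^* - cexp ((- P.[z])^*) =
    ((psi (-1)).[z] - cexp (- P.[z]))^* by rewrite -cexpJ rmorphB.
rewrite normc_conj psiE mulN1r; apply: hn.
by rewrite normcN.
Qed.

End Sectorial.

(** * Invertibility of large Toeplitz matrices *)

Section FiniteSection.
Variable R : realType.
Local Notation C := R[i].
Local Notation Re := (@complex.Re R).
Local Notation Im := (@complex.Im R).
Implicit Types (z w : C) (p q x : {poly C}).

Lemma trig_density (f : C -> C) :
  circle_continuous (Re \o f) -> circle_continuous (Im \o f) ->
  forall e : R, 0 < e ->
  exists s, forall z, unit_circle z -> normc (f z - trig_poly s z) <= e.
Proof.
move=> cR cI e e0; have e20 : 0 < e / 2 by lra.
have [s1 h1] := fejer_density cR e20; have [s2 h2] := fejer_density cI e20.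
exists (s1 ++ [seq ('i * a.1, a.2) | a <- s2]) => z uz.
rewrite /trig_poly big_cat big_map /=.
under [X in _ - (_ + X)]eq_bigr do rewrite -mulrA.
rewrite -mulr_sumr.
have -> : f z - (trig_poly s1 z + 'i * trig_poly s2 z) =
    ((Re (f z))%:C - trig_poly s1 z) + 'i * ((Im (f z))%:C - trig_poly s2 z).
  by apply: eq_ReIm; rewrite !ReIm /=; ring.
apply: le_trans (normcD _ _) _; rewrite normcM.
have -> : normc ('i : C) = 1 by rewrite /= expr0n expr1n add0r sqrtr1.
by rewrite mul1r [leRHS](splitr e); apply: lerD; [exact: h1 | exact: h2].
Qed.

Lemma bm_horner p : bounded_meas (fun t => p.[cis t]).
Proof.
apply: bm_ext (bm_sum (index_enum _) (fun i : 'I_(size p) => bmZ p`_i (bmX i (bm_cis R)))) => t.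
by rewrite horner_coef.
Qed.

(** The squared L^2 norm on the circle, by Parseval's identity [pnorm_mean]. *)
Definition pnorm p : R := \sum_(i < size p) sqnormC p`_i.

Lemma pnorm_wide p n : (size p <= n)%N -> pnorm p = \sum_(i < n) sqnormC p`_i.
Proof.
move=> h; rewrite /pnorm (big_ord_widen n (fun i => sqnormC p`_i)) // big_mkcond.
apply: eq_bigr => i _; case: ltnP => // hi.
by rewrite nth_default // /sqnormC /= expr0n addr0.
Qed.

Lemma pnorm_ge0 p : 0 <= pnorm p.
Proof. by apply: sumr_ge0 => i _; apply: sqnormC_ge0. Qed.

Lemma mean_pair (k : int) p q n m : (size p <= n)%N -> (size q <= m)%N ->
  mean (fun t => cis t ^ k * p.[cis t] * (q.[cis t])^*) =
  \sum_(i < n) \sum_(j < m) p`_i * (q`_j)^* * (k + i%:Z - j%:Z == 0)%:R.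
Proof.
move=> hp hq.
have b (l : int) : cintegrable (fun t => cis t ^ l : C) by exact/bm_cintegrable/bm_cisXz.
under eq_bigr => i _ do under eq_bigr => j _ do rewrite -mean_cis -meanZ //.
under eq_bigr => i _.
  rewrite -mean_sum; last by move=> j; apply: cintegrableZ.
  over.
rewrite -mean_sum; last first.
  by move=> i; apply: cintegrable_sum => j; apply: cintegrableZ.
apply: mean_ext => t; rewrite (horner_coef_wide _ hp) (horner_coef_wide _ hq).
rewrite [cis t ^ k * _]mulr_sumr mulr_suml; apply: eq_bigr => i _.
rewrite rmorph_sum mulr_sumr; apply: eq_bigr => j _.
have u := cis_unit t; have n0 := unit_neq0 u.
have cj : (cis t ^+ j)^* = cis t ^ (- j%:Z) := unitXz_conj j u.
rewrite rmorphM /= cj !expfzDr // -[cis t ^ i%:Z]exprnP.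
set a := cis t ^ k; set b2 := cis t ^+ i; set e := cis t ^ _. by ring.
Qed.

Lemma pnorm_mean p : Re (mean (fun t => p.[cis t] * (p.[cis t])^*)) = pnorm p.
Proof.
have -> : mean (fun t => p.[cis t] * (p.[cis t])^*) =
    mean (fun t => cis t ^ (0 : int) * p.[cis t] * (p.[cis t])^*).
  by apply: mean_ext => t; rewrite expr0z mul1r.
rewrite (mean_pair 0 (leqnn _) (leqnn _)) Re_sum; apply: eq_bigr => i _.
rewrite (bigD1 i) //= big1 ?addr0; last first.
  move=> j ji; rewrite add0r subr_eq0 (_ : _ == _ = false) ?mulr0 //.
  by apply/negbTE; apply: contraNneq ji => -[] /val_inj ->.
by rewrite add0r subrr eqxx mulr1 sqnormCE.
Qed.

Lemma bm_pair (A : R -> C) p q : bounded_meas A ->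
  bounded_meas (fun t => A t * p.[cis t] * (q.[cis t])^*).
Proof. by move=> h; apply: bmM; [apply: bmM | apply: bmJ] => //; apply: bm_horner. Qed.

(** Young's inequality under the integral, with a free weight [s] that is tuned
    when one of the two polynomials is much smaller than the other. *)
Lemma Re_mean_pair_le (A : R -> C) p q (d s : R) : bounded_meas A ->
  (forall t, normc (A t) <= d) -> 0 < s ->
  Re (mean (fun t => A t * p.[cis t] * (q.[cis t])^*)) <=
  d / 2 * (s * pnorm p + pnorm q / s).
Proof.
move=> bA hA s0.
have d0 : 0 <= d by apply: le_trans (hA 0); apply: normc_ge0.
have bp (r : {poly C}) : bounded_meas (fun t : R => r.[cis t] * (r.[cis t])^*).
  by apply: bmM; [|apply: bmJ]; apply: bm_horner.
pose H t := (d / 2 * s)%:C * (p.[cis t] * (p.[cis t])^*) +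
            (d / 2 / s)%:C * (q.[cis t] * (q.[cis t])^*).
have bH : bounded_meas H by apply: bmD; apply: bmZ.
have -> : d / 2 * (s * pnorm p + pnorm q / s) = Re (mean H).
  rewrite meanD; try by apply: bm_cintegrable; apply: bmZ.
  rewrite !meanZ; try exact: bm_cintegrable.
  by rewrite cReD 2!cReZ !pnorm_mean; ring.
apply: Re_mean_le; try apply: bm_cintegrable => //; first exact: bm_pair.
move=> t; rewrite /H cReD 2!cReZ -!sqnormCE -!sqr_normcE.
apply: le_trans (le_trans (ler_norm _) (Re_le_normc _)) _.
rewrite !normcM normc_conj.
set a := normc (A t); set b := normc p.[_]; set e := normc q.[_].
have a0 : 0 <= a := normc_ge0 _; have b0 : 0 <= b := normc_ge0 _.
have e0 : 0 <= e := normc_ge0 _.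
apply: (@le_trans _ _ (d * (b * e))).
  by rewrite -mulrA ler_wpM2r ?mulr_ge0 //; exact: hA.
have -> : d / 2 * s * b ^+ 2 + d / 2 / s * e ^+ 2 =
    d * (b * e) + d / 2 / s * (s * b - e) ^+ 2.
  by field; rewrite gt_eqF.
rewrite lerDl mulr_ge0 ?sqr_ge0 //.
by apply: divr_ge0; [exact: divr_ge0 | exact: ltW].
Qed.

Lemma pnormM (psi p : {poly C}) (M : R) :
  (forall z, unit_circle z -> normc psi.[z] <= M) ->
  pnorm (psi * p) <= M ^+ 2 * pnorm p.
Proof.
move=> hM.
have bp (r : {poly C}) : bounded_meas (fun t : R => r.[cis t] * (r.[cis t])^*).
  by apply: bmM; [|apply: bmJ]; apply: bm_horner.
rewrite -!pnorm_mean.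
have -> : M ^+ 2 * Re (mean (fun t => p.[cis t] * (p.[cis t])^*)) =
    Re (mean (fun t => (M ^+ 2)%:C * (p.[cis t] * (p.[cis t])^*))).
  by rewrite meanZ 1?cReZ //; exact: bm_cintegrable.
apply: Re_mean_le; try apply: bm_cintegrable => //; first exact: bmZ.
move=> t; rewrite cReZ -!sqnormCE hornerM sqnormCM.
rewrite ler_wpM2r ?sqnormC_ge0 // -sqr_normcE.
have h := hM _ (cis_unit t); have h0 := normc_ge0 (psi.[cis t]).
by rewrite ler_pXn2r // nnegrE //; apply: le_trans h.
Qed.

Lemma sqnormCZ (a : R) z : sqnormC (a%:C * z) = a ^+ 2 * sqnormC z.
Proof. by rewrite sqnormCM /sqnormC /= expr0n addr0. Qed.

(** The Fourier multiplier that damps high frequencies linearly. It vanishes at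
    index [N] and changes by [1/N] per index; these two facts give smallness
    beyond [N] and a small commutator with multiplications. *)
Definition ramp (N : nat) p : {poly C} :=
  \poly_(i < size p) ((1 - i%:R / N%:R : R)%:C * p`_i).

Lemma coef_ramp N p i : (ramp N p)`_i = (1 - i%:R / N%:R : R)%:C * p`_i.
Proof.
rewrite coef_poly; case: ltnP => // h; by rewrite [p`_i]nth_default ?mulr0.
Qed.

Lemma size_ramp N p : (size (ramp N p) <= size p)%N.
Proof. exact: size_poly. Qed.

(** Multiplication by [z^k] shifts indices by [k], over which the ramp varies by
    [k / N]. *)
Lemma ramp_commutator N (k : int) p q :
  mean (fun t => cis t ^ k * (ramp N p).[cis t] * (q.[cis t])^*) =
  mean (fun t => cis t ^ k * p.[cis t] * ((ramp N q).[cis t])^*) +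
  (k%:~R / N%:R : R)%:C * mean (fun t => cis t ^ k * p.[cis t] * (q.[cis t])^*).
Proof.
rewrite (mean_pair k (size_ramp N p) (leqnn (size q))).
rewrite (mean_pair k (leqnn (size p)) (size_ramp N q)).
rewrite (mean_pair k (leqnn (size p)) (leqnn (size q))).
rewrite mulr_sumr -big_split; apply: eq_bigr => i _.
rewrite mulr_sumr -big_split; apply: eq_bigr => j _ /=.
have [e|] := eqVneq (k + i%:Z - j%:Z) 0; last by rewrite !mulr0 addr0.
rewrite !mulr1 !coef_ramp.
have -> : ((1 - j%:R / N%:R : R)%:C * q`_j)^* = (1 - j%:R / N%:R : R)%:C * (q`_j)^*.
  by apply: eq_ReIm; rewrite !ReIm /=; ring.
have -> : (1 - i%:R / N%:R : R)%:C = (1 - j%:R / N%:R : R)%:C + (k%:~R / N%:R : R)%:C.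
  rewrite -rmorphD; congr (_%:C).
  have -> : k = j%:Z - i%:Z by lia.
  by rewrite rmorphB /= -!pmulrn; ring.
ring.
Qed.

Lemma ramp_pnorm N p : (size p <= N)%N -> pnorm (ramp N p) <= pnorm p.
Proof.
move=> h; rewrite (pnorm_wide (leq_trans (size_ramp N p) h)) (pnorm_wide h).
apply: ler_sum => i _; rewrite coef_ramp sqnormCZ ler_piMl ?sqnormC_ge0 //.
have N0 : 0 < N%:R :> R by rewrite ltr0n; apply: leq_ltn_trans (ltn_ord i).
have i1 : i%:R / N%:R <= 1 :> R by rewrite ler_pdivrMr // mul1r ler_nat ltnW.
have i0 : 0 <= i%:R / N%:R :> R by rewrite divr_ge0.
nra.
Qed.

(** The kernel of the [N]-th Toeplitz matrix of [f], in terms of the polynomial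
    with the given coefficients. *)
Definition in_kernel (f : C -> C) N p := (size p <= N)%N /\
  forall n, (n < N)%N ->
    mean (fun t => f (cis t) * p.[cis t] * (cis t ^+ n)^*) = 0.

Lemma kernel_pair f N p q : bounded_meas (f \o @cis R) -> in_kernel f N p ->
  (size q <= N)%N ->
  mean (fun t => f (cis t) * p.[cis t] * (q.[cis t])^*) = 0.
Proof.
move=> bf [_ hp] hq.
have b n : cintegrable (fun t => f (cis t) * p.[cis t] * (cis t ^+ n)^*).
  apply: bm_cintegrable; apply: bmM; last by apply/bmJ/bmX/bm_cis.
  by apply: bmM => //; exact: bm_horner.
have -> : mean (fun t => f (cis t) * p.[cis t] * (q.[cis t])^*) =
  mean (fun t => \sum_(i < N) (q`_i)^* * (f (cis t) * p.[cis t] * (cis t ^+ i)^*)).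
  apply: mean_ext => t; rewrite (horner_coef_wide _ hq) rmorph_sum mulr_sumr.
  by apply: eq_bigr => i _; rewrite rmorphM /=; ring.
rewrite mean_sum => [|i]; last exact: cintegrableZ.
by rewrite big1 // => i _; rewrite meanZ // hp ?mulr0.
Qed.

(** Coercivity bounds [c |x1|^2] by the pairing of [f x1] with [W = psi x1], where
    [x1] is the damped [x]. With [f] replaced by a trigonometric polynomial, the
    ramp moves from [x1] to [W] at the price of a commutator of order [1/N]. The
    part of index less than [N] of the damped [W] is orthogonal to [f x] up to
    the approximation error, and the rest, of index at most [N] plus the degree
    of [psi], has been damped by a factor of order [1/N]. *)
Lemma kernel_low_mass (f : C -> C) (psi : {poly C}) (c : R) :
  circle_continuous (Re \o f) -> circle_continuous (Im \o f) -> 0 < c ->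
  (forall z, unit_circle z -> c <= Re (f z * (psi.[z])^*)) ->
  forall e : R, 0 < e -> exists N0, forall N, (N0 <= N)%N -> forall p,
    in_kernel f N p -> pnorm (ramp N p) <= e * pnorm p.
Proof.
move=> cR cI c0 hpsi e e0.
have bf := bm_circle_continuous cR cI.
have [M0 hM0] := poly_bounded psi.
pose M := Num.max M0 0.
have M0' : 0 <= M by rewrite /M le_max lexx orbT.
have hM z : unit_circle z -> normc psi.[z] <= M.
  by move=> uz; apply: le_trans (hM0 z uz) _; rewrite /M le_max lexx.
have M2 : 0 < 1 + M ^+ 2 by have := sqr_ge0 M; lra.
(* The approximation error enters twice, each time with weight
   [(1 + M^2) / 2]: it consumes half of [e c]. *)
pose d := e * c / (2 * (1 + M ^+ 2)).
have d0 : 0 < d by rewrite /d divr_gt0 ?mulr_gt0.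
have d20 : 0 <= d / 2 by lra.
have [s hs] := trig_density cR cI d0.
pose B := \sum_(a <- s) normc a.1.
pose B' := \sum_(a <- s) normc a.1 * `|a.2%:~R|.
have B0 : 0 <= B by apply: sumr_ge0 => a _; apply: normc_ge0.
have B'0 : 0 <= B' by apply: sumr_ge0 => a _; apply: mulr_ge0 => //; apply: normc_ge0.
have normc_sum (F : C * int -> C) : normc (\sum_(a <- s) F a) <= \sum_(a <- s) normc (F a).
  elim: (s) => [|a r ih]; first by rewrite !big_nil normc0.
  by rewrite !big_cons; apply: le_trans (normcD _ _) _; rewrite lerD2l.
pose k : R := (size psi)%:R.
(* The commutator and the part beyond [N] contribute at most [E / N], the other
   half of [e c]. *)
pose E := B' * (1 + M ^+ 2) / 2 + B * (1 + k ^+ 2 * M ^+ 2) / 2.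
pose N0 := (Num.trunc (2 * E / (e * c))).+1.
exists N0 => N hN p kp; have [sp _] := kp.
have NR : 0 < N%:R :> R by rewrite ltr0n; apply: leq_trans hN.
have EN : E / N%:R <= e * c / 2.
  have : 2 * E / (e * c) < N%:R.
    by apply: lt_le_trans (truncnS_gt _) _; rewrite ler_nat.
  rewrite ltr_pdivrMr ?mulr_gt0 // => h; rewrite ler_pdivrMr //; nra.
set p1 := ramp N p; set W := psi * p1.
have np1 : pnorm p1 <= pnorm p by exact: ramp_pnorm.
have nW : pnorm W <= M ^+ 2 * pnorm p.
  by apply: le_trans (pnormM _ hM) _; rewrite ler_wpM2l ?sqr_ge0.
have sW : (size W <= N + size psi)%N.
  apply: leq_trans (size_polyMleq _ _) _; have := size_ramp N p; rewrite -/p1.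
  move: sp; lia.
(* [Q] is paired with [f x] to zero; [S] is what the ramp damps. *)
pose Q : {poly C} := \poly_(i < N) (ramp N W)`_i.
pose S : {poly C} := ramp N W - Q.
have sQ : (size Q <= N)%N by exact: size_poly.
have nQ : pnorm Q <= pnorm W.
  rewrite (pnorm_wide (leq_trans sQ (leq_addr (size psi) N))) (pnorm_wide sW).
  apply: ler_sum => i _; rewrite coef_poly; case: ltnP => hi; last first.
    by rewrite {1}/sqnormC /= expr0n addr0 sqnormC_ge0.
  rewrite coef_ramp sqnormCZ ler_piMl ?sqnormC_ge0 //.
  have i1 : i%:R / N%:R <= 1 :> R by rewrite ler_pdivrMr // mul1r ler_nat ltnW.
  have i0 : 0 <= i%:R / N%:R :> R by rewrite divr_ge0.
  nra.
have nS : pnorm S <= (k / N%:R) ^+ 2 * pnorm W.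
  have sS : (size S <= N + size psi)%N.
    apply: leq_trans (size_polyD _ _) _; rewrite size_polyN geq_max.
    by rewrite (leq_trans (size_ramp _ _) sW) (leq_trans sQ) ?leq_addr.
  rewrite (pnorm_wide sS) (pnorm_wide sW) mulr_sumr.
  apply: ler_sum => i _; rewrite coefB [Q`_i]coef_poly; case: ltnP => hi.
    by rewrite subrr {1}/sqnormC /= expr0n addr0 mulr_ge0 ?sqr_ge0 ?sqnormC_ge0.
  rewrite subr0 coef_ramp sqnormCZ ler_wpM2r ?sqnormC_ge0 //.
  have -> : 1 - i%:R / N%:R = - ((i - N)%:R / N%:R) :> R.
    by rewrite natrB // mulrBl divff ?gt_eqF //; ring.
  rewrite sqrrN ler_pXn2r ?nnegrE ?divr_ge0 // ler_pM2r ?invr_gt0 // ler_nat.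
  by have := ltn_ord i; lia.
pose fs t := trig_poly s (cis t : C).
have bs : bounded_meas fs by exact: bm_trig.
have fE t : f (cis t) = (f (cis t) - fs t) + fs t by rewrite subrK.
have bd : bounded_meas (fun t => f (cis t) - fs t) by exact: bmB.
have bd' : bounded_meas (fun t => fs t - f (cis t)) by exact: bmB.
pose A t := \sum_(a <- s) a.1 * (a.2%:~R / N%:R : R)%:C * cis t ^ a.2.
have bA : bounded_meas A by apply: bm_sum => a; apply: bmZ; exact: bm_cisXz.
have ib F q r : bounded_meas F -> cintegrable (fun t => F t * q.[cis t] * (r.[cis t])^* : C).
  by move=> bF; apply: bm_cintegrable; apply: bm_pair.
have bc (l : int) : bounded_meas (fun t => cis t ^ l : C) by exact: bm_cisXz.
have comm : mean (fun t => fs t * p1.[cis t] * (W.[cis t])^*) =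
    mean (fun t => fs t * p.[cis t] * ((ramp N W).[cis t])^*) +
    mean (fun t => A t * p.[cis t] * (W.[cis t])^*).
  have expand (b : C * int -> C) (q r : {poly C}) :
      mean (fun t => (\sum_(a <- s) b a * cis t ^ a.2) * q.[cis t] * (r.[cis t])^*) =
      \sum_(a <- s) b a * mean (fun t => cis t ^ a.2 * q.[cis t] * (r.[cis t])^*).
    transitivity (\sum_(a <- s)
        mean (fun t => b a * (cis t ^ a.2 * q.[cis t] * (r.[cis t])^*))); last first.
      by apply: eq_bigr => a _; rewrite meanZ //; exact: ib.
    rewrite -mean_sum; last by move=> a; apply: cintegrableZ; apply: ib.
    apply: mean_ext => t; rewrite !mulr_suml; apply: eq_bigr => a _; ring.
  rewrite /fs /trig_poly /A !expand -big_split; apply: eq_bigr => a _ /=.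
  by rewrite ramp_commutator mulrDr mulrA.
have split1 : mean (fun t => f (cis t) * p1.[cis t] * (W.[cis t])^*) =
    mean (fun t => (f (cis t) - fs t) * p1.[cis t] * (W.[cis t])^*) +
    mean (fun t => fs t * p1.[cis t] * (W.[cis t])^*).
  rewrite -meanD; try exact: ib.
  by apply: mean_ext => t; rewrite {1}fE; ring.
have split2 : mean (fun t => fs t * p.[cis t] * ((ramp N W).[cis t])^*) =
    mean (fun t => (fs t - f (cis t)) * p.[cis t] * (Q.[cis t])^*) +
    mean (fun t => fs t * p.[cis t] * (S.[cis t])^*).
  transitivity (mean (fun t => fs t * p.[cis t] * (Q.[cis t])^*) +
                mean (fun t => fs t * p.[cis t] * (S.[cis t])^*)).
    rewrite -meanD; try exact: ib.
    apply: mean_ext => t; rewrite -mulrDr -rmorphD -hornerD /=.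
    by rewrite /S addrC subrK.
  congr (_ + _); rewrite -[LHS]subr0 -(kernel_pair bf kp sQ) -meanB; try exact: ib.
  by apply: mean_ext => t; ring.
have t1 : Re (mean (fun t => (f (cis t) - fs t) * p1.[cis t] * (W.[cis t])^*)) <=
    d / 2 * (1 + M ^+ 2) * pnorm p.
  apply: le_trans (Re_mean_pair_le p1 W bd _ ltr01) _.
    by move=> t; apply: hs; exact: cis_unit.
  by rewrite mul1r divr1 -[leRHS]mulrA (ler_wpM2l d20) //; lra.
have t3 : Re (mean (fun t => (fs t - f (cis t)) * p.[cis t] * (Q.[cis t])^*)) <=
    d / 2 * (1 + M ^+ 2) * pnorm p.
  apply: le_trans (Re_mean_pair_le p Q bd' _ ltr01) _.
    by move=> t; rewrite normcB; apply: hs; exact: cis_unit.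
  rewrite mul1r divr1 -[leRHS]mulrA (ler_wpM2l d20) //; lra.
have hA t : normc (A t) <= B' / N%:R.
  apply: le_trans (normc_sum _) _; rewrite /B' mulr_suml; apply: ler_sum => a _.
  rewrite !normcM normc_real (unit_normc (unitXz _ (cis_unit t))) mulr1.
  by rewrite normrM mulrA normfV (ger0_norm (ltW NR)).
have t2 : Re (mean (fun t => A t * p.[cis t] * (W.[cis t])^*)) <=
    B' / N%:R / 2 * (1 + M ^+ 2) * pnorm p.
  apply: le_trans (Re_mean_pair_le p W bA hA ltr01) _.
  rewrite mul1r divr1 -[leRHS]mulrA ler_wpM2l ?divr_ge0 ?(ltW NR) //; lra.
have hfs t : normc (fs t) <= B.
  apply: le_trans (normc_sum _) _; apply: ler_sum => a _.
  by rewrite normcM (unit_normc (unitXz _ (cis_unit t))) mulr1.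
have t4 : Re (mean (fun t => fs t * p.[cis t] * (S.[cis t])^*)) <=
    B / 2 * ((1 + k ^+ 2 * M ^+ 2) / N%:R) * pnorm p.
  have s0 : 0 < N%:R^-1 :> R by rewrite invr_gt0.
  apply: le_trans (Re_mean_pair_le p S bs hfs s0) _.
  rewrite -[leRHS]mulrA ler_wpM2l ?divr_ge0 // invrK.
  have : pnorm S <= (k / N%:R) ^+ 2 * (M ^+ 2 * pnorm p).
    by apply: le_trans nS _; rewrite ler_wpM2l ?sqr_ge0.
  move=> h; have : pnorm S * N%:R <= (k / N%:R) ^+ 2 * (M ^+ 2 * pnorm p) * N%:R.
    by apply: (ler_wpM2r (ltW NR)); exact: h.
  have -> : (k / N%:R) ^+ 2 * (M ^+ 2 * pnorm p) * N%:R =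
      k ^+ 2 * M ^+ 2 / N%:R * pnorm p by field; rewrite gt_eqF.
  have -> : (1 + k ^+ 2 * M ^+ 2) / N%:R * pnorm p =
     N%:R^-1 * pnorm p + k ^+ 2 * M ^+ 2 / N%:R * pnorm p by ring.
  by move=> {}h; rewrite lerD2l.
have low : c * pnorm p1 <= Re (mean (fun t => f (cis t) * p1.[cis t] * (W.[cis t])^*)).
  have bp (r : {poly C}) : bounded_meas (fun t : R => r.[cis t] * (r.[cis t])^* : C).
    by apply: bmM; [|apply: bmJ]; apply: bm_horner.
  have -> : c * pnorm p1 = Re (mean (fun t => c%:C * (p1.[cis t] * (p1.[cis t])^*))).
    rewrite meanZ; last exact: bm_cintegrable.
    by rewrite cReZ pnorm_mean.
  apply: Re_mean_le; try apply: bm_cintegrable => //; first exact: bmZ.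
    exact: bm_pair.
  move=> t; rewrite /W hornerM rmorphM /=.
  have -> : f (cis t) * p1.[cis t] * ((psi.[cis t])^* * (p1.[cis t])^*) =
    f (cis t) * (psi.[cis t])^* * (p1.[cis t] * (p1.[cis t])^*) by ring.
  rewrite mulcJ cReZ [X in _ <= Re X]mulrC cReZ [leRHS]mulrC ler_wpM2r ?sqnormC_ge0 //.
  by apply: hpsi; exact: cis_unit.
rewrite split1 comm split2 !cReD in low.
have p0 := pnorm_ge0 p.
have fin : c * pnorm p1 <= e * c * pnorm p.
  apply: le_trans low _.
  apply: (@le_trans _ _ ((d * (1 + M ^+ 2) + E / N%:R) * pnorm p)).
    have -> : (d * (1 + M ^+ 2) + E / N%:R) * pnorm p =
       d / 2 * (1 + M ^+ 2) * pnorm p + (d / 2 * (1 + M ^+ 2) * pnorm p +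
       B / 2 * ((1 + k ^+ 2 * M ^+ 2) / N%:R) * pnorm p +
       B' / N%:R / 2 * (1 + M ^+ 2) * pnorm p).
      by rewrite /E; field; rewrite gt_eqF.
    by apply: lerD => //; apply: lerD => //; apply: lerD.
  rewrite ler_wpM2r //.
  have -> : d * (1 + M ^+ 2) = e * c / 2 by rewrite /d; field; rewrite gt_eqF.
  lra.
by rewrite -(ler_pM2l c0) mulrA [c * e]mulrC.
Qed.

Definition fourier (f : C -> C) (k : int) : C :=
  mean (fun t => f (cis t) * cis t ^ (- k)).

(** On the circle [dz] is [i z] times the angle element, which turns the contour
    integral into a Fourier coefficient. *)
Lemma laurent_coefE (f : C -> C) (k : int) : bounded_meas (f \o @cis R) ->
  laurent_coef f k = fourier f k.
Proof.
move=> bf; rewrite /laurent_coef /circle_integral /fourier /mean -cintZ; last first.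
  by apply: bm_cintegrable; apply: bmM => //; exact: bm_cisXz.
apply: cint_ext => t _; have n0 := unit_neq0 (cis_unit t).
rewrite expfzDr // expr1z invfM invr_expz /twoipi.
have -> : (2%:R * 'i%C * pi%:C)^-1 = 'i%C^-1 * (2 * pi)^-1%:C :> C.
  rewrite fmorphV -invfM; congr (_^-1); apply: eq_ReIm; rewrite !ReIm /=; ring.
have i0 : ('i%C : C) != 0 by apply/eqP => -[] /eqP; rewrite oner_eq0.
move: i0; set ii := 'i%C => i0; set zk := _ ^ (- k); set z := cis t in n0 *.
by move: ((2 * pi)^-1)%:C => d; field; rewrite n0 i0.
Qed.

(** On the circle this is [z^(N-1)] times the conjugate of [p]; it exchanges low
    and high frequencies and transposes Toeplitz matrices. *)
Definition conj_reverse N p : {poly C} := \poly_(i < N) (p`_(N.-1 - i))^*.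

Lemma pnorm_conj_reverse N p : (size p <= N)%N -> pnorm (conj_reverse N p) = pnorm p.
Proof.
move=> h; rewrite (pnorm_wide h) (pnorm_wide (size_poly _ _)).
rewrite (reindex_inj rev_ord_inj) /=; apply: eq_bigr => i _.
rewrite coef_poly ifT; last by have := ltn_ord i; lia.
by rewrite sqnormCJ; congr (sqnormC p`__); have := ltn_ord i; lia.
Qed.

Lemma kernel_conj_reverse f N p : bounded_meas (f \o @cis R) -> in_kernel f N p ->
  in_kernel (fun z => (f z)^*) N (conj_reverse N p).
Proof.
move=> bf [sp hp]; split; first exact: size_poly.
move=> n nN.
transitivity ((mean (fun t => f (cis t) * p.[cis t] * (cis t ^+ (N.-1 - n))^*))^*).
  2: by rewrite hp; [exact: rmorph0 | lia].
rewrite -meanJ; last first.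
  apply: bm_cintegrable; apply: bmM; last by apply/bmJ/bmX/bm_cis.
  by apply: bmM => //; exact: bm_horner.
apply: mean_ext => t; have u := cis_unit t; have n0 := unit_neq0 u.
have cX m : (cis t ^+ m)^* = cis t ^ (- m%:Z) := unitXz_conj m u.
rewrite !conjcM conjCK -!mulrA; congr (_ * _).
rewrite (horner_coef_wide _ sp) (horner_coef_wide _ (size_poly _ _)) cX.
rewrite rmorph_sum !mulr_suml (reindex_inj rev_ord_inj) /=; apply: eq_bigr => i _.
rewrite coef_poly ifT; last by have := ltn_ord i; lia.
rewrite conjcM cX (_ : (N.-1 - (N - i.+1) = i)%N); last by have := ltn_ord i; lia.
rewrite -!mulrA; congr (_ * _); rewrite !exprnP -!expfzDr //; congr (_ ^ _).
by have := ltn_ord i; lia.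
Qed.

Lemma circle_continuous_opp (v : C -> R) :
  circle_continuous v -> circle_continuous (fun z => - v z).
Proof.
move=> cv z uz e e0; have [d d0 hd] := cv z uz e e0; exists d => // w uw wz.
by rewrite -opprD normrN; exact: hd.
Qed.

(** The squares of the two weights [1 - i/N] and [(i+1)/N] add up to at least 1/2
    because their sum is at least one. *)
Lemma ramp_partition N p : (0 < N)%N -> (size p <= N)%N ->
  pnorm p / 2 <= pnorm (ramp N p) + pnorm (ramp N (conj_reverse N p)).
Proof.
move=> N0 sp; have N0' : 0 < N%:R :> R by rewrite ltr0n.
rewrite (pnorm_wide sp) (pnorm_wide (leq_trans (size_ramp _ _) sp)).
rewrite (pnorm_wide (leq_trans (size_ramp _ _) (size_poly _ _))).
rewrite [X in _ <= _ + X](reindex_inj rev_ord_inj) -big_split mulr_suml /=.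
apply: ler_sum => i _; rewrite !coef_ramp !sqnormCZ coef_poly ifT; last first.
  by have := ltn_ord i; lia.
rewrite (_ : (N.-1 - (N - i.+1) = i)%N); last by have := ltn_ord i; lia.
rewrite sqnormCJ -mulrDl [leLHS]mulrC ler_wpM2r ?sqnormC_ge0 //.
rewrite natrB // -[i.+1%:R]natr1.
have -> : 1 - (N%:R - (i%:R + 1)) / N%:R = i%:R / N%:R + 1 / N%:R :> R.
  by field; rewrite gt_eqF.
have i0 : 0 <= i%:R / N%:R :> R by rewrite divr_ge0.
have n0 : 0 <= 1 / N%:R :> R by rewrite divr_ge0.
set a := i%:R / N%:R in i0 *; set b := 1 / _ in n0 *.
have := sqr_ge0 (2 * a - 1); nra.
Qed.

(** A kernel vector is small after damping at either end, by [kernel_low_mass]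
    for [f] and for its conjugate, so that [ramp_partition] forces it to
    vanish. *)
Theorem toeplitz_invertible (f : C -> C) (psi1 psi2 : {poly C}) (c : R) :
  circle_continuous (Re \o f) -> circle_continuous (Im \o f) -> 0 < c ->
  (forall z, unit_circle z ->
      c <= Re (f z * (psi1.[z])^*) /\ c <= Re (f z * psi2.[z])) ->
  exists N0, forall N, (N0 <= N)%N ->
    \det (\matrix_(a < N, b < N) fourier f (a.+1%:Z - b.+1%:Z)) != 0.
Proof.
move=> cR cI c0 hpsi.
have bf := bm_circle_continuous cR cI.
have e0 : 0 < 1 / 8 :> R by [].
have [N1 h1] := kernel_low_mass cR cI c0 (fun z uz => (hpsi z uz).1) e0.
have cR' : circle_continuous (Re \o (fun z => (f z)^*)).
  by rewrite (_ : _ \o _ = Re \o f) //; apply/funext => z /=; rewrite cReJ.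
have cI' : circle_continuous (Im \o (fun z => (f z)^*)).
  rewrite (_ : _ \o _ = fun z => - (Im \o f) z); first exact: circle_continuous_opp.
  by apply/funext => z /=; rewrite cImJ.
have hpsi' z : unit_circle z -> c <= Re ((f z)^* * (psi2.[z])^*).
  by move=> uz; rewrite -rmorphM /= cReJ; exact: (hpsi z uz).2.
have [N2 h2] := kernel_low_mass cR' cI' c0 hpsi' e0.
exists (maxn 1 (maxn N1 N2)) => N; rewrite !geq_max => /and3P[N0 hN1 hN2].
apply/negP => /eqP det0.
set T := \matrix_(_, _) _ in det0.
have /det0P [v v0 vT] : \det T^T == 0 by rewrite det_tr det0.
pose p := rVpoly v.
have sp : (size p <= N)%N by exact: size_poly.
have kp : in_kernel f N p.
  split=> // n nN; have := congr1 (fun M : 'rV_N => M 0 (Ordinal nN)) vT.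
  rewrite !mxE => <-.
  have b (k : int) : cintegrable (fun t => f (cis t) * cis t ^ k).
    by apply: bm_cintegrable; apply: bmM => //; exact: bm_cisXz.
  under [RHS]eq_bigr => j _ do rewrite !mxE /fourier -meanZ //.
  rewrite -mean_sum; last by move=> j; apply: cintegrableZ.
  apply: mean_ext => t; have u := cis_unit t; have n0 := unit_neq0 u.
  have cX m : (cis t ^+ m)^* = cis t ^ (- m%:Z) := unitXz_conj m u.
  rewrite (horner_coef_wide _ sp) mulr_sumr mulr_suml; apply: eq_bigr => j _.
  rewrite coef_rVpoly_ord cX (_ : - (n.+1%:Z - j.+1%:Z) = j%:Z + - n%:Z); last by lia.
  by rewrite expfzDr // -[cis t ^ j%:Z]exprnP /=; ring.
have := ramp_partition N0 sp.
have k1 := h1 N hN1 p kp.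
have := h2 N hN2 _ (kernel_conj_reverse bf kp); rewrite pnorm_conj_reverse // => k2.
have p0 := pnorm_ge0 p => h3.
have /eqP : pnorm p = 0 by lra.
rewrite (pnorm_wide sp) psumr_eq0; last by move=> i _; exact: sqnormC_ge0.
move=> /allP hall; case/eqP: v0; apply/rowP => i; rewrite mxE.
have := hall i (mem_index_enum _); rewrite /= coef_rVpoly_ord -sqr_normcE sqrf_eq0.
by move=> /eqP/eq0_normc.
Qed.

End FiniteSection.

(** * Determinants with replaced rows and columns *)

Ltac simp_ring := rewrite /= ?(mulr0n, mulr1n, mul0r, mul1r, mulN1r, mulr0, mulr1,
  oppr0, add0r, addr0, subr0); try ring.

Section Determinants.
Variable F : fieldType.

(** Two factorizations of one block matrix, eliminating either diagonal block. *)
Lemma det_add_mulmx (N m : nat) (T : 'M[F]_N) (X : 'M[F]_(N, m)) (Y : 'M[F]_(m, N)) :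
  T \in unitmx -> \det (T + X *m Y) = \det T * \det (1%:M + Y *m invmx T *m X).
Proof.
move=> uT.
have e1 : block_mx T (- X) Y 1%:M =
    block_mx 1%:M 0 (Y *m invmx T) 1%:M *m
    block_mx T (- X) 0 (1%:M + Y *m invmx T *m X).
  rewrite mulmx_block !mul1mx !mul0mx !addr0 mulmxKV // mulmxN.
  by rewrite [_ + (1%:M + _)]addrC addrK.
have e2 : block_mx T (- X) Y 1%:M =
    block_mx (T + X *m Y) (- X) 0 1%:M *m block_mx 1%:M 0 Y 1%:M.
  by rewrite mulmx_block !mulmx1 !mulmx0 ?mul0mx !mul1mx !add0r mulNmx addrK.
have := congr1 determinant e2; rewrite e1 !det_mulmx !det_ublock !det_lblock !det1.
by rewrite !mul1r !mulr1.
Qed.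

(** With [Eh] and [Et] formed of distinct columns of the identity matrix, the
    matrix on the left is [T] with the rows selected by [Eh] replaced by [P], the
    columns selected by [Et] replaced by [D], and [G] where both cross. It is a
    perturbation of [T] of rank at most [n + r]. *)
Lemma det_replace (N n r : nat) (T : 'M[F]_N) (Eh : 'M[F]_(N, n)) (Et : 'M[F]_(N, r))
    (P : 'M[F]_(n, N)) (D : 'M[F]_(N, r)) (G : 'M[F]_(n, r)) :
  T \in unitmx -> Eh^T *m Eh = 1%:M -> Et^T *m Et = 1%:M ->
  \det ((1%:M - Eh *m Eh^T) *m (T *m (1%:M - Et *m Et^T) + D *m Et^T) +
        Eh *m (P *m (1%:M - Et *m Et^T) + G *m Et^T)) =
  \det T * \det (block_mx (P *m invmx T *m Eh) (G - P *m invmx T *m D)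
                   (- (Et^T *m invmx T *m Eh)) (Et^T *m invmx T *m D)).
Proof.
move=> uT hh tt.
set Ti := invmx T.
(* The correction at the crossings, after rows and columns have been replaced
   independently. *)
pose G' := G - P *m Et - Eh^T *m (D - T *m Et).
pose X := row_mx Eh (D - T *m Et).
pose Y := col_mx (P - Eh^T *m T + G' *m Et^T) Et^T.
set M := (M in \det M = _).
have -> : M = T + X *m Y.
  rewrite /M /X /Y mul_row_col /G' !(mulmxDl, mulmxDr, mulNmx, mulmxN, mul1mx, mulmx1, mulmxA).
  apply/matrixP => i j.
  set a1 := T *m Et *m Et^T; set a2 := D *m Et^T; set a3 := Eh *m Eh^T *m T.
  set a4 := a3 *m Et *m Et^T; set a5 := Eh *m Eh^T *m D *m Et^T.
  set a6 := Eh *m P; set a7 := a6 *m Et *m Et^T; set a8 := Eh *m G *m Et^T.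
  clearbody a1 a2 a4 a5 a7 a8; clearbody a3 a6; rewrite !mxE; ring.
rewrite det_add_mulmx //; congr (_ * _).
pose A1 := P *m Ti *m Eh; pose A2 := P *m Ti *m D.
pose B1 := Et^T *m Ti *m Eh; pose B2 := Et^T *m Ti *m D.
(* The unitriangular factor removes [G'] times the last rows; conjugation by the
   diagonal matrix of signs puts the signs in place. *)
have -> : 1%:M + Y *m Ti *m X =
    block_mx 1%:M G' 0 1%:M *m (block_mx 1%:M 0 0 (- 1%:M) *m
      block_mx A1 (G - A2) (- B1) B2 *m block_mx 1%:M 0 0 (- 1%:M)).
  rewrite /Y /X mul_col_mx mul_col_row scalar_mx_block add_block_mx.
  rewrite !mulmx_block !(mulmx1, mul1mx, mulmx0, mul0mx, mulNmx, mulmxN, addr0, add0r, opprK).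
  have TiT : Ti *m T = 1%:M by rewrite mulVmx.
  have q1 (g : 'M[F]_(n, r)) : (P - Eh^T *m T + g *m Et^T) *m Ti *m Eh = A1 - 1%:M + g *m B1.
    rewrite !(mulmxDl, mulNmx) /B1 !mulmxA; congr (_ - _ + _).
    by rewrite mulmxK.
  have q2 (g : 'M[F]_(n, r)) : (P - Eh^T *m T + g *m Et^T) *m Ti *m (D - T *m Et) =
      A2 - P *m Et - Eh^T *m (D - T *m Et) + (g *m B2 - g).
    have e1 : P *m Ti *m (T *m Et) = P *m Et by rewrite mulmxA mulmxKV.
    have e3 : Et^T *m Ti *m (T *m Et) = 1%:M by rewrite mulmxA mulmxKV.
    rewrite !(mulmxDl, mulNmx) mulmxK // mulmxBr e1 -/A2.
    by rewrite -!(mulmxA g) (mulmxBr (Et^T *m Ti)) e3 -/B2 (mulmxBr g) mulmx1.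
  have q3 : Et^T *m Ti *m (D - T *m Et) = B2 - 1%:M.
    by rewrite mulmxBr mulmxA mulmxKV // tt.
  rewrite q1 q2 q3 -/B1; congr block_mx; apply/matrixP => i j.
  - by set g := G' *m B1; clearbody g; rewrite !mxE; ring.
  - rewrite /G'; set g := _ *m B2; set u := Eh^T *m _; set w := P *m Et.
    clearbody g u w; rewrite !mxE; ring.
  - by clearbody B2; rewrite !mxE; ring.
rewrite !det_mulmx det_ublock !det1 !mul1r !det_ublock !det1 !mul1r.
by rewrite mulrAC -det_mulmx mulNmx mulmxN opprK mulmx1 det1 mul1r.
Qed.

(** The matrix rotates by a quarter turn each of the [c] planes spanned by two
    paired basis vectors; a rotation is a product of three shears. *)
Lemma det_quarter_turn (n r c : nat) : (c <= minn n r)%N ->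
  \det (block_mx (copid_mx c) (- pid_mx c) (pid_mx c) (copid_mx c) : 'M[F]_(n + r)) = 1.
Proof.
rewrite leq_min => /andP[cn cr].
pose U : 'M[F]_(n + r) := block_mx 1%:M (- pid_mx c) 0 1%:M.
pose L : 'M[F]_(n + r) := block_mx 1%:M 0 (pid_mx c) 1%:M.
have -> : block_mx (copid_mx c) (- pid_mx c) (pid_mx c) (copid_mx c) = U *m L *m U.
  rewrite /U /L !mulmx_block !(mulmx1, mul1mx, mulmx0, mul0mx, mulNmx, mulmxN, addr0, add0r, opprK).
  rewrite !pid_mx_id //; congr block_mx.
  - by rewrite mulmxBl mul1mx pid_mx_id // subrr oppr0 add0r.
  - by rewrite /copid_mx addrC.
by rewrite !det_mulmx /U /L !det_ublock det_lblock !det1 !mulr1.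
Qed.

Lemma mul_pid_mx_fun (m n r c : nat) (f : nat -> nat -> F) : (c <= n)%N ->
  (\matrix_(a < m, b < n) f a b) *m (pid_mx c : 'M[F]_(n, r)) =
  \matrix_(a, b) (if (b < c)%N then f a b else 0).
Proof.
move=> cn; apply/matrixP => a b; rewrite !mxE.
case: ifP => bc.
  have bn : (b < n)%N by apply: leq_trans bc cn.
  rewrite (bigD1 (Ordinal bn)) //= big1 ?addr0; first by rewrite !mxE /= eqxx bc mulr1.
  move=> i ib; rewrite !mxE /= (_ : _ == _ = false) ?mulr0 //.
  by apply/negbTE; apply: contraNneq ib => e; apply/eqP/val_inj.
rewrite big1 // => i _; rewrite !mxE; case: eqP => [e|]; last by rewrite mulr0.
by rewrite e bc mulr0.
Qed.

Lemma pid_mx_mul_fun (m n r c : nat) (f : nat -> nat -> F) : (c <= n)%N ->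
  (pid_mx c : 'M[F]_(r, n)) *m (\matrix_(a < n, b < m) f a b) =
  \matrix_(a, b) (if (a < c)%N then f a b else 0).
Proof.
move=> cn; apply: trmx_inj; rewrite trmx_mul tr_pid_mx.
have -> : (\matrix_(a < n, b < m) f a b)^T =
    \matrix_(b < m, a < n) (fun x y => f y x) (nat_of_ord b) (nat_of_ord a).
  by apply/matrixP => i j; rewrite !mxE.
rewrite (mul_pid_mx_fun m r (fun x y => f y x) cn).
by apply/matrixP => i j; rewrite !mxE.
Qed.

Section Minor.
Variables (cf : int -> F) (N n r c : nat) (h p : n.-tuple int) (t k : r.-tuple int).
Hypotheses (hp : admissible N h p) (tk : admissible N t k).
Hypotheses (cnr : (c <= minn r n)%N) (wo : well_ordered c h t).

Let T : 'M[F]_N := \matrix_(a < N, b < N) cf (a.+1%:Z - b.+1%:Z).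
Hypothesis uT : T \in unitmx.

(** The moment of index [j] of the solution [U] of [(I + V0) U = u], as a function
    of the moments [w] of [u]; [moment_inverse] justifies the formula. Outside
    [1, ..., N] the first term in the last factor vanishes; inside, the
    expression reduces to [w T^-1]. *)
Definition resolvent (w : int -> F) (j : int) : F :=
  w j + \sum_(a < N) \sum_(b < N)
    w a.+1%:Z * invmx T a b * ((j == b.+1%:Z)%:R - cf (b.+1%:Z - j)).

Let selection (m : nat) (s : seq int) : 'M[F]_(N, m) :=
  \matrix_(i, a) (s`_a == i.+1%:Z)%:R.

Lemma in_rangeP (x : int) : in_range N x -> exists a : 'I_N, x = a.+1%:Z.
Proof.
case: x => [[|m]|m] // xN.
have mN : (m < N)%N by move: xN; rewrite /in_range; lia.
by exists (Ordinal mN).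
Qed.

Lemma nth_in_range m (s : m.-tuple int) (a : 'I_m) :
  all (in_range N) s -> in_range N s`_a.
Proof. by move=> /allP; apply; apply: mem_nth; rewrite size_tuple. Qed.

Lemma tr_sel_mul (m l : nat) (s : m.-tuple int) (g : int -> nat -> F) :
  all (in_range N) s ->
  (selection m s)^T *m (\matrix_(i < N, b < l) g i.+1%:Z b) = \matrix_(a, b) g s`_a b.
Proof.
move=> hs; apply/matrixP => a b; rewrite !mxE.
have [i e] := in_rangeP (nth_in_range a hs).
rewrite (bigD1 i) //= big1 ?addr0; first by rewrite !mxE e eqxx mul1r.
move=> j ji; rewrite !mxE e (_ : _ == _ = false) ?mul0r //.
by apply/negbTE; apply: contraNneq ji => -[] /val_inj ->.
Qed.

Lemma tr_sel_sel m (s : m.-tuple int) : uniq s -> all (in_range N) s ->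
  (selection m s)^T *m selection m s = 1%:M.
Proof.
move=> us hs; rewrite {2}/selection (tr_sel_mul m (fun i b => (s`_b == i)%:R) hs).
apply/matrixP => a b; rewrite !mxE nth_uniq ?size_tuple //.
by rewrite eq_sym.
Qed.

(** Substitution written as a sum against Kronecker symbols, the form taken by
    products with selection matrices. At most one term of each sum is nonzero. *)
Lemma substituted_sum m (s q : m.-tuple int) (i : 'I_N) (g : int -> F) :
  uniq s ->
  g (substituted s q i.+1%:Z) =
  g i.+1%:Z - \sum_(a < m) (s`_a == i.+1%:Z)%:R * g i.+1%:Z
            + \sum_(a < m) (s`_a == i.+1%:Z)%:R * g q`_a.
Proof.
move=> us; rewrite /substituted; case: ifP => hi; last first.
  rewrite !big1 ?subr0 ?addr0 // => a _; rewrite (_ : _ == _ = false) ?mul0r //;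
  by apply/negbTE; apply: contraFneq hi => <-; apply: mem_nth; rewrite size_tuple.
have im : (index i.+1%:Z s < m)%N by rewrite -{2}(size_tuple s) index_mem.
pose a0 := Ordinal im.
have big (G : 'I_m -> F) : \sum_(a < m) (s`_a == i.+1%:Z)%:R * G a = G a0.
  rewrite (bigD1 a0) //= nth_index // eqxx mul1r big1 ?addr0 //.
  move=> a aa0; rewrite (_ : _ == _ = false) ?mul0r //; apply/negbTE.
  apply: contraNneq aa0 => e; apply/eqP/val_inj => /=.
  by rewrite -e index_uniq ?size_tuple.
by rewrite (big (fun=> g i.+1%:Z)) (big (fun a => g q`_a)) subrr add0r.
Qed.

Lemma mul_sel (m l : nat) (s : m.-tuple int) (g : nat -> int -> F) :
  all (in_range N) s ->
  (\matrix_(a < l, b < N) g a b.+1%:Z) *m selection m s = \matrix_(a, b) g a s`_b.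
Proof.
move=> hs; apply: trmx_inj; rewrite trmx_mul.
have -> : (\matrix_(a < l, b < N) g a b.+1%:Z)^T =
    \matrix_(b < N, a < l) (fun i x => g x i) b.+1%:Z (nat_of_ord a).
  by apply/matrixP => i j; rewrite !mxE.
rewrite (tr_sel_mul l (fun i x => g x i) hs).
by apply/matrixP => i j; rewrite !mxE.
Qed.

Lemma replace_columns (m l : nat) (s q : m.-tuple int) (g : nat -> int -> F) :
  uniq s -> all (in_range N) s ->
  (\matrix_(a < l, b < N) g a b.+1%:Z) *m (1%:M - selection m s *m (selection m s)^T) +
  (\matrix_(a < l, b < m) g a q`_b) *m (selection m s)^T =
  \matrix_(a < l, b < N) g a (substituted s q b.+1%:Z).
Proof.
move=> us hs; rewrite mulmxBr mulmx1 mulmxA mul_sel //; apply/matrixP => a b.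
rewrite !mxE (substituted_sum q b (g a) us); congr (_ - _ + _).
  apply: eq_bigr => j _; rewrite !mxE mulrC; case: eqP => [->|] //.
  by rewrite !mul0r.
by apply: eq_bigr => j _; rewrite !mxE mulrC.
Qed.

Lemma replace_rows (m l : nat) (s q : m.-tuple int) (g : int -> nat -> F) :
  uniq s -> all (in_range N) s ->
  (1%:M - selection m s *m (selection m s)^T) *m (\matrix_(a < N, b < l) g a.+1%:Z b) +
  selection m s *m (\matrix_(a < m, b < l) g q`_a b) =
  \matrix_(a < N, b < l) g (substituted s q a.+1%:Z) b.
Proof.
move=> us hs; apply: trmx_inj.
have tm (u v : nat) (f : nat -> nat -> F) :
    (\matrix_(a < u, b < v) f a b)^T = \matrix_(a, b) f b a.
  by apply/matrixP => i j; rewrite !mxE.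
rewrite linearD /= !trmx_mul linearB /= trmx1 trmx_mul trmxK.
rewrite (tm _ _ (fun a b => g a.+1%:Z b)) (tm _ _ (fun a b => g q`_a b)).
rewrite (tm _ _ (fun a b => g (substituted s q a.+1%:Z) b)).
exact: (replace_columns l q (fun x i => g i x) us hs).
Qed.

Let P : 'M[F]_(n, N) := \matrix_(a < n, b < N) cf (p`_a - b.+1%:Z).
Let D : 'M[F]_(N, r) := \matrix_(a < N, b < r) cf (a.+1%:Z - k`_b).
Let G : 'M[F]_(n, r) := \matrix_(a < n, b < r) cf (p`_a - k`_b).

Lemma det_minor :
  \det (\matrix_(a < N, b < N)
     cf (substituted h p a.+1%:Z - substituted t k b.+1%:Z)) =
  \det T * \det (block_mx (P *m invmx T *m selection n h) (G - P *m invmx T *m D)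
       (- ((selection r t)^T *m invmx T *m selection n h)) ((selection r t)^T *m invmx T *m D)).
Proof.
case: hp => uh _ rh _; case: tk => ut _ rt _.
rewrite -det_replace //; try exact: tr_sel_sel.
congr (\det _); apply/esym.
rewrite (replace_columns N k (fun a j => cf (a.+1%:Z - j)) ut rt).
rewrite (replace_columns n k (fun a j => cf (p`_a - j)) ut rt).
exact: (replace_rows N p (fun i b => cf (i - substituted t k b.+1%:Z)) uh rh).
Qed.

Lemma resolvent_in (w : int -> F) (i : 'I_N) :
  resolvent w i.+1%:Z = \sum_(a < N) w a.+1%:Z * invmx T a i.
Proof.
rewrite /resolvent.
under eq_bigr => a _.
  rewrite (_ : \sum_(b < N) _ = w a.+1%:Z * invmx T a i - w a.+1%:Z * (a == i)%:R).
    over.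
  have -> : (a == i)%:R = (invmx T *m T) a i by rewrite mulVmx // mxE.
  rewrite mxE mulr_sumr (bigD1 i) //= [X in _ = _ - X](bigD1 i) //=.
  rewrite !mxE eqxx mulrBr mulr1 -mulrA opprD addrA; congr (_ + _).
  rewrite -sumrN; apply: eq_bigr => b bi; rewrite !mxE.
  rewrite (_ : _ == _ = false); first by rewrite sub0r mulrN mulrA.
  by apply/negbTE; apply: contraNneq bi => -[] /val_inj ->.
have -> : \sum_(a < N) (w a.+1%:Z * invmx T a i - w a.+1%:Z * (a == i)%:R) =
    \sum_(a < N) w a.+1%:Z * invmx T a i - w i.+1%:Z.
  rewrite sumrB; congr (_ - _); rewrite (bigD1 i) //= eqxx mulr1 big1 ?addr0 //.
  by move=> a /negbTE ->; rewrite mulr0.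
by rewrite addrCA subrr addr0.
Qed.

Lemma resolvent_out (w : int -> F) (j : int) : ~~ in_range N j ->
  resolvent w j = w j - \sum_(a < N) \sum_(b < N)
    w a.+1%:Z * invmx T a b * cf (b.+1%:Z - j).
Proof.
move=> hj; rewrite /resolvent -sumrN; congr (_ + _); apply: eq_bigr => a _.
rewrite -sumrN; apply: eq_bigr => b _.
rewrite (_ : _ == _ = false) ?sub0r ?mulrN //.
apply/negbTE; apply: contraNneq hj => ->; rewrite /in_range.
by have := ltn_ord b; lia.
Qed.

Lemma mul_inv_sel (l m : nat) (s : m.-tuple int) (w : nat -> int -> F) a b :
  all (in_range N) s ->
  ((\matrix_(a < l, x < N) w a x.+1%:Z) *m invmx T *m selection m s) a b =
  resolvent (w a) s`_b.
Proof.
move=> hs; have [i e] := in_rangeP (nth_in_range b hs).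
rewrite e resolvent_in mxE (bigD1 i) //= big1 ?addr0; last first.
  move=> x xi; rewrite !mxE e (_ : _ == _ = false) ?mulr0 //.
  by apply/negbTE; apply: contraNneq xi => -[] /val_inj ->.
by rewrite !mxE e eqxx mulr1; apply: eq_bigr => x _; rewrite !mxE.
Qed.

Lemma mul_inv_out (l m : nat) (q : m.-tuple int) (w : nat -> int -> F) a b :
  all (fun x => ~~ in_range N x) q ->
  ((\matrix_(a < l, x < N) w a x.+1%:Z) *m invmx T *m
      (\matrix_(x < N, b < m) cf (x.+1%:Z - q`_b))) a b =
  w a q`_b - resolvent (w a) q`_b.
Proof.
move=> /allP hq; rewrite resolvent_out; last first.
  by apply: hq; apply: mem_nth; rewrite size_tuple.
rewrite opprB addrC subrK mxE exchange_big /=; apply: eq_bigr => x _.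
by rewrite !mxE mulr_suml; apply: eq_bigr => y _; rewrite !mxE.
Qed.

Let A i j := resolvent (fun x => cf (i - x)) j.
Let B (i j : int) := resolvent (fun x => (i == x)%:R) j.

Lemma det_minor_resolvent :
  \det (\matrix_(a < N, b < N)
     cf (substituted h p a.+1%:Z - substituted t k b.+1%:Z)) =
  \det T * \det (block_mx
     (\matrix_(a < n, b < n) A p`_a h`_b) (\matrix_(a < n, b < r) A p`_a k`_b)
     (\matrix_(a < r, b < n) - B t`_a h`_b) (\matrix_(a < r, b < r) - B t`_a k`_b)).
Proof.
case: (hp) => uh _ rh _; case: (tk) => ut _ rt rk.
rewrite det_minor; congr (_ * \det (block_mx _ _ _ _)); apply/matrixP => a b.
- by rewrite (mul_inv_sel (fun a x => cf (p`_a - x))) // mxE.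
- rewrite [LHS]mxE [X in _ + X]mxE (mul_inv_out (fun a x => cf (p`_a - x))) //.
  by rewrite !mxE opprB addrC subrK.
- have -> : (selection r t)^T = \matrix_(a < r, x < N) (t`_a == x.+1%:Z)%:R.
    by apply/matrixP => i j; rewrite !mxE.
  by rewrite mxE (mul_inv_sel (fun a x => (t`_a == x)%:R)) // mxE.
- have -> : (selection r t)^T = \matrix_(a < r, x < N) (t`_a == x.+1%:Z)%:R.
    by apply/matrixP => i j; rewrite !mxE.
  rewrite (mul_inv_out (fun a x => (t`_a == x)%:R)) // mxE.
  rewrite (_ : _ == _ = false) ?sub0r //; apply/negbTE.
  move/allP: rk => /(_ k`_b (mem_nth _ _)); rewrite size_tuple => /(_ (ltn_ord b)).
  by apply: contraNneq => <-; apply: nth_in_range.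
Qed.

Lemma resolventB (w1 w2 : int -> F) j :
  resolvent (fun x => w1 x - w2 x) j = resolvent w1 j - resolvent w2 j.
Proof.
rewrite /resolvent opprD addrACA -sumrB; congr (_ + _); apply: eq_bigr => a _.
by rewrite -sumrB; apply: eq_bigr => b _; ring.
Qed.

Lemma resolventD (w1 w2 : int -> F) j :
  resolvent (fun x => w1 x + w2 x) j = resolvent w1 j + resolvent w2 j.
Proof.
rewrite /resolvent addrACA -big_split; congr (_ + _); apply: eq_bigr => a _.
by rewrite /= -big_split; apply: eq_bigr => b _ /=; ring.
Qed.

Lemma resolventZ (s : F) (w : int -> F) j :
  resolvent (fun x => s * w x) j = s * resolvent w j.
Proof.
rewrite /resolvent mulrDr mulr_sumr; congr (_ + _); apply: eq_bigr => a _.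
by rewrite mulr_sumr; apply: eq_bigr => b _; ring.
Qed.

(** The moments of index [1, ..., N] of [f z^(N/2 - i)] form the [i]-th row of
    [T], so that [z^(N/2 - i)] is the corresponding solution. *)
Lemma resolvent_toeplitz_row i j : in_range N i -> A i j = (i == j)%:R.
Proof.
move=> /in_rangeP [x ->]; rewrite /A.
have row b : \sum_(a < N) cf (x.+1%:Z - a.+1%:Z) * invmx T a b = (x == b)%:R.
  have -> : (x == b)%:R = (T *m invmx T) x b by rewrite mulmxV // mxE.
  by rewrite mxE; apply: eq_bigr => a _; rewrite !mxE.
rewrite /resolvent exchange_big /=.
under eq_bigr => b _ do rewrite -mulr_suml row.
rewrite (bigD1 x) //= big1 => [|b bx]; last by rewrite eq_sym (negbTE bx) mul0r.
by rewrite eqxx mul1r addr0 [j == _]eq_sym addrCA subrr addr0.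
Qed.

(** The moments of the functions [u_I] of the statement. *)
Definition rhs_I (a : nat) (j : int) : F := cf (p`_a - j) -
  ((a < c)%N%:R * (h`_a == j)%:R + (c <= a)%N%:R * cf (h`_a - j)).

(** The moments of the functions [u_II] of the statement. *)
Definition rhs_II (a : nat) (j : int) : F := cf (t`_a - j) - (t`_a == j)%:R.

Lemma resolvent_rhs_I (a : 'I_n) j : resolvent (rhs_I a) j =
  A p`_a j - ((a < c)%N%:R * B h`_a j + (c <= a)%N%:R * (h`_a == j)%:R).
Proof.
case: (hp) => _ _ rh _.
rewrite resolventB resolventD !resolventZ -[resolvent (fun x => cf (h`_a - x)) j]/(A h`_a j).
by rewrite resolvent_toeplitz_row //; exact: nth_in_range.
Qed.

Lemma resolvent_rhs_II (a : 'I_r) j : resolvent (rhs_II a) j = (t`_a == j)%:R - B t`_a j.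
Proof.
case: (tk) => _ _ rt _.
rewrite resolventB -[resolvent (fun x => cf (t`_a - x)) j]/(A t`_a j).
by rewrite resolvent_toeplitz_row //; exact: nth_in_range.
Qed.

(** For [a <= c] the row [I;a] exceeds the row of [det_minor_resolvent] by the row
    [II;a], as [h_a = t_a]; the shear [S] corrects this. The columns [I;b] and
    [II;b] with [b <= c] are attached to [k_b] and to minus [h_b] instead of [h_b]
    and [k_b], whence the quarter turn [Q]. The Kronecker symbols of the matrix
    cancel those of the moments; for this the overlap of the two families must be
    exactly their first [c] members. *)
Theorem minor_factorization :
  \det (\matrix_(a < N, b < N)
     cf (substituted h p a.+1%:Z - substituted t k b.+1%:Z)) =
  \det T * \det (block_mx
    (\matrix_(a < n, b < n) ((a == b)%:R * (c <= b)%N%:R +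
      ((b < c)%N%:R * resolvent (rhs_I a) k`_b + (c <= b)%N%:R * resolvent (rhs_I a) h`_b)))
    (\matrix_(a < n, b < r)
      (- (b < c)%N%:R * resolvent (rhs_I a) t`_b + (c <= b)%N%:R * resolvent (rhs_I a) k`_b))
    (\matrix_(a < r, b < n)
      ((b < c)%N%:R * resolvent (rhs_II a) k`_b + (c <= b)%N%:R * resolvent (rhs_II a) h`_b))
    (\matrix_(a < r, b < r) ((a == b)%:R * (b < c)%N%:R +
      (- (b < c)%N%:R * resolvent (rhs_II a) t`_b + (c <= b)%N%:R * resolvent (rhs_II a) k`_b)))).
Proof.
case: (hp) => uh _ rh rp; case: (tk) => ut _ rt rk.
have := cnr; rewrite leq_min => /andP[cr cn].
rewrite det_minor_resolvent; congr (_ * _).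
set Z := block_mx _ _ _ _; set M := block_mx _ _ _ _.
(* [pid_mx c] identifies the first [c] indices of the two families. *)
pose S : 'M[F]_(n + r) := block_mx 1%:M (pid_mx c) 0 1%:M.
pose Q : 'M[F]_(n + r) := block_mx (copid_mx c) (- pid_mx c) (pid_mx c) (copid_mx c).
suff -> : M = S *m (Z *m Q).
  rewrite !det_mulmx /S det_ublock !det1 !mul1r det_quarter_turn ?mulr1 //.
  by rewrite minnC.
have kr (b : nat) : (b < r)%N -> ~~ in_range N k`_b.
  by move=> br; move/allP: rk; apply; apply: mem_nth; rewrite size_tuple.
have hin (a : 'I_n) : in_range N h`_a by exact: nth_in_range.
have tin (a : 'I_r) : in_range N t`_a by exact: nth_in_range.
have neq_k (i : int) (b : nat) : in_range N i -> (b < r)%N -> (i == k`_b) = false.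
  by move=> hi /kr hk; apply/negbTE; apply: contraNneq hk => <-.
have [ht hdis] := wo.
rewrite /Z /Q mulmx_block !mulmxN /copid_mx !mulmxBr !mulmx1.
rewrite !(mul_pid_mx_fun _ _ (fun a b => A p`_a h`_b) cn).
rewrite !(mul_pid_mx_fun _ _ (fun a b => A p`_a k`_b) cr).
rewrite !(mul_pid_mx_fun _ _ (fun a b => - B t`_a h`_b) cn).
rewrite !(mul_pid_mx_fun _ _ (fun a b => - B t`_a k`_b) cr).
pose X1 (a b : nat) := A p`_a h`_b; pose X2 (a b : nat) := A p`_a k`_b.
pose Y1 (a b : nat) := - B t`_a h`_b; pose Y2 (a b : nat) := - B t`_a k`_b.
pose L1 (a b : nat) := Y1 a b - (if (b < c)%N then Y1 a b else 0) +
  (if (b < c)%N then Y2 a b else 0).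
pose L2 (a b : nat) := - (if (b < c)%N then Y1 a b else 0) +
  (Y2 a b - (if (b < c)%N then Y2 a b else 0)).
have l1 : (\matrix_(a < r, b < n) - B t`_a h`_b) -
    (\matrix_(a < r, b < n) if (b < c)%N then - B t`_a h`_b else 0) +
    (\matrix_(a < r, b < n) if (b < c)%N then - B t`_a k`_b else 0) =
    \matrix_(a < r, b < n) L1 a b by apply/matrixP => a b; rewrite !mxE.
have l2 : - (\matrix_(a < r, b < r) if (b < c)%N then - B t`_a h`_b else 0) +
    ((\matrix_(a < r, b < r) - B t`_a k`_b) -
    (\matrix_(a < r, b < r) if (b < c)%N then - B t`_a k`_b else 0)) =
    \matrix_(a < r, b < r) L2 a b by apply/matrixP => a b; rewrite !mxE.
rewrite l1 l2 /S mulmx_block !mul1mx !mul0mx !add0r !pid_mx_mul_fun //.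
congr block_mx; apply/matrixP => a b; rewrite !mxE /L1 /L2 /Y1 /Y2.
- have hab : (h`_a == h`_b) = (a == b) by rewrite nth_uniq ?size_tuple.
  rewrite !resolvent_rhs_I hab; case: (ltnP b c) => bc; last first.
    case: (ltnP a c) => ac; last by case: (a == b); simp_ring.
    have ab : (a == b) = false by apply/negbTE; apply: contraTneq ac => ->; rewrite -leqNgt.
    by rewrite ab (ht a ac); simp_ring.
  rewrite (neq_k _ b) //; last exact: leq_trans bc cr.
  by case: (ltnP a c) => ac; rewrite ?(ht a ac); simp_ring.
- have hak : (h`_a == k`_b) = false by exact: neq_k.
  rewrite !resolvent_rhs_I hak; case: (ltnP b c) => bc; last first.
    by case: (ltnP a c) => ac; rewrite ?(ht a ac); simp_ring.
  rewrite -(ht b bc).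
  have hab : (h`_a == h`_b) = (a == b :> nat).
    by rewrite nth_uniq ?size_tuple //; apply: leq_trans bc cn.
  case: (ltnP a c) => ac; first by rewrite (ht a ac); simp_ring.
  have ab : (a == b :> nat) = false.
    by apply/negbTE; apply: contraTneq bc => <-; rewrite -leqNgt.
  by rewrite hab ab; simp_ring.
- rewrite !resolvent_rhs_II; case: (ltnP b c) => bc.
    by rewrite (neq_k _ b) //; [simp_ring | exact: leq_trans bc cr].
  have -> : (t`_a == h`_b) = false.
    apply/negbTE/eqP => e; have [ac|ac] := ltnP a c.
      move: e; rewrite -(ht a ac) => /eqP; rewrite nth_uniq ?size_tuple //; last first.
        by apply: leq_trans ac cn.
      by move=> /eqP e; move: ac; rewrite e ltnNge bc.
    by apply: (hdis b a); rewrite ?bc ?ac ?ltn_ord.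
  by simp_ring.
- rewrite !resolvent_rhs_II (neq_k _ b) //; case: (ltnP b c) => bc; last by simp_ring.
  have -> : (t`_a == t`_b) = (a == b) by rewrite nth_uniq ?size_tuple.
  by rewrite -(ht b bc); simp_ring.
Qed.

End Minor.

End Determinants.

(** * Square integrable functions on the circle *)

Section SquareIntegrable.
Variable R : realType.
Local Notation C := R[i].
Local Notation Re := (@complex.Re R).
Local Notation Im := (@complex.Im R).
Local Notation mu := (@lebesgue_measure R).
Local Notation J := (`[0, 2 * pi]%classic : set R).
Implicit Types (g h b : C -> C).

Lemma continuous_circle_continuous (f : C -> C) :
  (forall z, unit_circle z -> {for z, continuous (f : C^o -> C^o)}) ->
  circle_continuous (Re \o f) /\ circle_continuous (Im \o f).
Proof.
move=> cf.
have key z (e : R) : unit_circle z -> 0 < e -> exists2 d : R, 0 < d &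
    forall w, normc (w - z) < d -> normc (f w - f z) < e.
  move=> uz e0; have eC : (0 : C) < e%:C by rewrite ltcR.
  have /cvgrPdist_lt /(_ _ eC) := cf z uz.
  move=> /nbhs_ballP [d /= d0 hd].
  have dE : d = (Re d)%:C by rewrite RRe_real // gtr0_real.
  exists (Re d); first by move: d0; rewrite dE ltcR.
  move=> w wz; have : ball (z : C^o) d w.
    by rewrite -ball_normE /= dE -normrN opprB -[`|_|]/((normc (w - z))%:C) ltcR.
  move=> /hd /=; rewrite -normrN opprB -[`|_|]/((normc (f w - f z))%:C).
  by rewrite ltcR.
split=> z uz e e0; have [d d0 hd] := key z e uz e0; exists d => // w uw wz.
- by apply: le_lt_trans (hd w wz); rewrite /= -cReB; exact: Re_le_normc.
- by apply: le_lt_trans (hd w wz); rewrite /= -cImB; exact: Im_le_normc.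
Qed.

Lemma holomorphic_circle_continuous (D : set C) (f : C -> C) :
  (forall z, unit_circle z -> D z) -> holomorphic_on D f ->
  circle_continuous (Re \o f) /\ circle_continuous (Im \o f).
Proof.
move=> uD hf; apply: continuous_circle_continuous => z uz.
by apply: differentiable_continuous; apply/derivable1_diffP; apply: hf; apply: uD.
Qed.

Lemma sqrt_branch_unit (q : C -> C) z : sqrt_branch q -> unit_circle z ->
  unit_circle (q z).
Proof.
move=> [hq _] uz; apply/unit_circleE; have := hq z uz.
move=> /(congr1 (@sqnormC R)); rewrite expr2 sqnormCM (proj1 (unit_circleE z) uz).
move=> h; have := sqnormC_ge0 (q z); set a := sqnormC _ in h *; move=> a0.
have /eqP : a ^+ 2 = 1 by rewrite expr2.
by rewrite sqrf_eq1 => /orP[] /eqP; lra.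
Qed.

Lemma open_cis_neq (z0 : C) : open [set x : R | cis x != z0].
Proof.
rewrite openE => x Ux; have d0 : 0 < normc (cis x - z0).
    rewrite lt_def normc_ge0 andbT; apply: contraNneq Ux => /eq0_normc/eqP.
    by rewrite subr_eq0 => /eqP ->.
  apply/nbhs_ballP; exists (normc (cis x - z0)) => //= y.
  rewrite -ball_normE /= => xy; apply/eqP => e; move: xy.
  by rewrite ltNge -e normc_cisB.
Qed.

(** Away from the exceptional point the branch is continuous on an open set of
    angles; on the remaining closed set it is constant. *)
Lemma bm_sqrt_branch (q : C -> C) : sqrt_branch q -> bounded_meas (q \o @cis R).
Proof.
move=> qb; split; last first.
  by exists 1 => x; rewrite unit_normc //; apply: sqrt_branch_unit => //; exact: cis_unit.
have [_ [z0 uz0 cq]] := qb.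
pose U : set R := [set x | cis x != z0].
have key x (e : R) : U x -> 0 < e -> exists2 d : R, 0 < d &
    forall y, `|x - y| < d -> U y -> normc (q (cis y) - q (cis x)) < e.
  move=> Ux e0; have eC : (0 : C) < e%:C by rewrite ltcR.
  have Ax : (@unit_circle R `\ z0) (cis x) by split; [exact: cis_unit | apply/eqP].
  move: cq => /subspace_continuousP /(_ _ Ax) /cvgrPdist_lt /(_ _ eC).
  rewrite near_withinE => /nbhs_ballP [d /= d0 hd].
  have dE : d = (Re d)%:C by rewrite RRe_real // gtr0_real.
  exists (Re d); first by move: d0; rewrite dE ltcR.
  move=> y xy Uy; have : ball (cis x : C^o) d (cis y).
    rewrite -ball_normE /= dE -[`|_|]/((normc (cis x - cis y))%:C) ltcR.
    exact: le_lt_trans (normc_cisB _ _) xy.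
  move=> /hd /= -/(_ _); rewrite -normrN opprB.
  rewrite -[`|_|]/((normc (q (cis y) - q (cis x)))%:C) ltcR; apply.
  by split; [exact: cis_unit | apply/eqP].
have oU : open U by exact: open_cis_neq.
have mU : measurable U by exact: open_measurable.
have meas (P : C -> R) : (forall z w, `|P z - P w| <= normc (z - w)) ->
    measurable_fun J (P \o (q \o @cis R)).
  move=> hP; suff : measurable_fun (U `|` ~` U) (P \o (q \o @cis R)).
    by rewrite setUv; apply: measurable_funS.
  apply/measurable_funU => //; first exact: measurableC.
  split.
    apply: open_continuous_measurable_fun => // x /set_mem Ux.
    apply/cvgrPdist_lt => e e0; have [d d0 hd] := key x e Ux e0.
    have nU : nbhs x U by move: oU; rewrite openE; apply.
    near=> y; apply: le_lt_trans (hP _ _) _; rewrite normcB; apply: hd.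
      by near: y; apply: cvgr_dist_lt.
    by near: y.
  have : measurable_fun (~` U) (fun=> P (q z0)) by exact: measurable_cst.
  apply: eq_measurable_fun => x /set_mem /negP; rewrite negbK => /eqP /= ->.
  by [].
split; apply: meas => z w.
- by rewrite -cReB; exact: Re_le_normc.
- by rewrite -cImB; exact: Im_le_normc.
Unshelve. all: by end_near. Qed.

Lemma bm_half_pow (q : C -> C) (j : int) : sqrt_branch q ->
  bounded_meas (fun x => half_pow q (cis x) j).
Proof.
move=> qb; have bq := bm_sqrt_branch qb.
case: j => n; first exact: (bmX n bq).
apply: bm_ext (bmX n.+1 (bmJ bq)) => x /=.
have u := sqrt_branch_unit qb (cis_unit x).
by rewrite /half_pow NegzE -exprz_inv unit_inv // exprnP.
Qed.

Definition sqabs g x := sqnormC (g (cis x)).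

Lemma measurable_sqabs g : cmeas (g \o @cis R) -> measurable_fun J (sqabs g).
Proof.
move=> [a b]; apply: measurable_funD; apply: measurable_funX => //.
Qed.

Lemma in_L2P g : in_L2 g <->
  cmeas (g \o @cis R) /\ mu.-integrable J (EFin \o sqabs g).
Proof.
split=> [[a b c]|[[a b] i]].
  have m : cmeas (g \o @cis R) by split.
  split=> //; apply/integrableP; split.
    by apply/measurable_EFinP; exact: measurable_sqabs.
  move: c; rewrite /L2_sqnorm; under eq_integral => x _.
    rewrite -[(_)%:E]gee0_abs ?lee_fin ?sqnormC_ge0 //.
    over.
  by [].
split=> //; have /integrableP[_] := i.
under eq_integral => x _ do rewrite /= ger0_norm ?sqnormC_ge0 //.
by [].
Qed.

Definition L2sq g : R := (\int[mu]_(x in J) sqabs g x)%R.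

Lemma L2_sqnormE g : in_L2 g -> L2_sqnorm g = (L2sq g)%:E.
Proof.
move=> /in_L2P [_ i]; rewrite /L2sq /Rintegral fineK //.
exact: integrable_fin_num.
Qed.

Lemma bm_in_L2 b : bounded_meas (b \o @cis R) -> in_L2 b.
Proof.
move=> [m [M hM]]; apply/in_L2P; split=> //.
apply: (bounded_integrable (M := M ^+ 2)); first exact: measurable_sqabs.
move=> x; rewrite ger0_norm ?sqnormC_ge0 // /sqabs -sqr_normcE.
have := hM x; rewrite /= => h.
by rewrite ler_pXn2r ?nnegrE ?normc_ge0 //; apply: le_trans h; exact: normc_ge0.
Qed.

Lemma integrableZ_fin (s : R) (u : R -> R) : mu.-integrable J (EFin \o u) ->
  mu.-integrable J (EFin \o (fun x => s * u x)).
Proof. by move=> h; apply: eq_integrable (integrableZl _ s h) => //; exact: measurable_itv. Qed.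

Lemma integrableD_fin (u v : R -> R) : mu.-integrable J (EFin \o u) ->
  mu.-integrable J (EFin \o v) -> mu.-integrable J (EFin \o (fun x => u x + v x)).
Proof.
by move=> a b; apply: eq_integrable (integrableD _ a b) => //; exact: measurable_itv.
Qed.

Lemma in_L2_cintegrable g : in_L2 g -> cintegrable (g \o @cis R).
Proof.
move=> /in_L2P [[a b] i].
have i1 : mu.-integrable J (EFin \o (fun x => 1 + sqabs g x)).
  apply: integrableD_fin => //; apply: (bounded_integrable (M := 1)) => //.
  by move=> x; rewrite normr1.
have le1 (u : R) x : u ^+ 2 <= sqabs g x -> `|u| <= 1 + sqabs g x.
  by rewrite -real_normK ?num_real //; set v := `|u|; have := sqr_ge0 (v - 1); nra.
have mJ : measurable J by exact: measurable_itv.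
split.
- have i2 := i1; apply: le_integrable i2; [exact: mJ | by apply/measurable_EFinP |].
  move=> x _; rewrite /= lee_fin [leRHS]ger0_norm; last first.
    by apply: addr_ge0 => //; exact: sqnormC_ge0.
  by apply: le1; rewrite /sqabs /sqnormC lerDl sqr_ge0.
- have i2 := i1; apply: le_integrable i2; [exact: mJ | by apply/measurable_EFinP |].
  move=> x _; rewrite /= lee_fin [leRHS]ger0_norm; last first.
    by apply: addr_ge0 => //; exact: sqnormC_ge0.
  by apply: le1; rewrite /sqabs /sqnormC lerDr sqr_ge0.
Qed.

Lemma sqnormCD_le (z w : C) : sqnormC (z + w) <= 2 * sqnormC z + 2 * sqnormC w.
Proof.
rewrite /sqnormC !cReD !cImD.
by have := sqr_ge0 (Re z - Re w); have := sqr_ge0 (Im z - Im w); nra.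
Qed.

Lemma in_L2D g h : in_L2 g -> in_L2 h ->
  in_L2 (fun z => g z + h z) /\ L2sq (fun z => g z + h z) <= 2 * L2sq g + 2 * L2sq h.
Proof.
move=> /in_L2P[mg ig] /in_L2P[mh ih].
have i2 := integrableD_fin (integrableZ_fin 2 ig) (integrableZ_fin 2 ih).
have m : cmeas ((fun z => g z + h z) \o @cis R) by exact: cmeasD mg mh.
have i : mu.-integrable J (EFin \o sqabs (fun z => g z + h z)).
  apply: le_integrable i2; first exact: measurable_itv.
    by apply/measurable_EFinP; exact: measurable_sqabs.
  move=> x _; rewrite /= lee_fin ger0_norm ?sqnormC_ge0 // ger0_norm; last first.
    by apply: addr_ge0; apply: mulr_ge0 => //; exact: sqnormC_ge0.
  exact: sqnormCD_le.
split; first by apply/in_L2P.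
rewrite /L2sq -!RintegralZl //; try exact: measurable_itv.
rewrite -RintegralD //; try exact: integrableZ_fin; try exact: measurable_itv.
apply: le_Rintegral => //.
by move=> x _; exact: sqnormCD_le.
Qed.

Lemma in_L2_scale (k : C) b (M : R) : bounded_meas (b \o @cis R) ->
  (forall x, normc (b (cis x)) <= M) -> in_L2 (fun z => b z * k) /\
  L2sq (fun z => b z * k) <= 2 * pi * M ^+ 2 * sqnormC k.
Proof.
move=> bb hM.
have bk : bounded_meas ((fun z => b z * k) \o @cis R) by apply: bmM => //; exact: bm_cst.
have L := bm_in_L2 bk; split=> //.
have /in_L2P[_ i] := L.
rewrite /L2sq; have -> : 2 * pi * M ^+ 2 * sqnormC k =
    (\int[mu]_(x in J) (M ^+ 2 * sqnormC k))%R.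
  by rewrite Rintegral_cstJ; ring.
apply: le_Rintegral => //.
  apply: (bounded_integrable (M := `|M ^+ 2 * sqnormC k|)) => //.
move=> x _; rewrite /sqabs sqnormCM ler_wpM2r ?sqnormC_ge0 // -sqr_normcE.
by rewrite ler_pXn2r ?nnegrE ?normc_ge0 //; apply: le_trans (hM x); exact: normc_ge0.
Qed.

Lemma in_L2Z (k : C) g : in_L2 g -> in_L2 (fun z => k * g z).
Proof.
move=> /in_L2P[m i]; apply/in_L2P; split; first exact: cmeasM (cmeas_cst k) m.
have := integrableZ_fin (sqnormC k) i; apply: eq_integrable => //.
by move=> x _; rewrite /= /sqabs sqnormCM.
Qed.

(** The variance of [u] is nonnegative. *)
Lemma Rintegral_sqr_le (u : R -> R) : mu.-integrable J (EFin \o u) ->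
  mu.-integrable J (EFin \o (fun x => u x ^+ 2)) ->
  (\int[mu]_(x in J) u x)%R ^+ 2 <= 2 * pi * (\int[mu]_(x in J) (u x ^+ 2))%R.
Proof.
move=> iu iu2; set I := (\int[mu]_(x in J) u x)%R.
have tp : 0 < 2 * pi :> R by rewrite mulr_gt0 ?pi_gt0.
(* [m] is the mean value of [u]. *)
pose m := I / (2 * pi).
have ic (s : R) : mu.-integrable J (EFin \o (fun=> s)).
  by apply: (bounded_integrable (M := `|s|)).
have mJ : measurable J by exact: measurable_itv.
have : 0 <= (\int[mu]_(x in J) (u x ^+ 2 + ((- 2 * m) * u x + m ^+ 2)))%R.
  apply: Rintegral_ge0 => x _; have := sqr_ge0 (u x - m); nra.
rewrite RintegralD //; last exact: integrableD_fin (integrableZ_fin _ iu) (ic _).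
rewrite RintegralD //; last exact: integrableZ_fin.
rewrite RintegralZl // Rintegral_cstJ -/I.
have -> : - 2 * m * I + m ^+ 2 * (2 * pi) = - (I ^+ 2 / (2 * pi)).
  by rewrite /m; set w := 2 * pi in tp *; field; rewrite gt_eqF.
by rewrite subr_ge0 ler_pdivrMr // mulrC.
Qed.

Lemma sqnormC_cint_le g (G : R -> C) : in_L2 g -> cintegrable G ->
  (forall x, sqnormC (G x) <= sqabs g x) ->
  sqnormC (cint G) <= 4 * pi * L2sq g.
Proof.
move=> /in_L2P[_ i] iG hG.
have [a b] := cintegrable_cmeas iG; have [c d] := iG.
have part (u : R -> R) : mu.-integrable J (EFin \o u) -> measurable_fun J u ->
    (forall x, u x ^+ 2 <= sqabs g x) ->
    (\int[mu]_(x in J) u x)%R ^+ 2 <= 2 * pi * L2sq g.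
  move=> iu mu_ hu.
  have iu2 : mu.-integrable J (EFin \o (fun x => u x ^+ 2)).
    apply: le_integrable i; first exact: measurable_itv.
      by apply/measurable_EFinP; exact: measurable_funX.
    move=> x _; rewrite /= lee_fin !ger0_norm ?sqr_ge0 ?sqnormC_ge0 //.
  apply: le_trans (Rintegral_sqr_le iu iu2) _.
  apply: ler_wpM2l; first by rewrite mulr_ge0 ?pi_ge0.
  exact: le_Rintegral.
have -> : 4 * pi * L2sq g = 2 * pi * L2sq g + 2 * pi * L2sq g by ring.
apply: lerD.
- by apply: part c a _ => x; apply: le_trans (hG x); rewrite lerDl sqr_ge0.
- by apply: part d b _ => x; apply: le_trans (hG x); rewrite lerDr sqr_ge0.
Qed.

End SquareIntegrable.

(** * The operator V0 and its inverse *)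

Section FiniteRank.
Variable R : realType.
Local Notation C := R[i].
Local Notation Re := (@complex.Re R).
Local Notation Im := (@complex.Im R).
Local Notation mu := (@lebesgue_measure R).
Local Notation J := (`[0, 2 * pi]%classic : set R).
Implicit Types (g h b : C -> C).

Lemma circle_integral_ext g h : (forall z, unit_circle z -> g z = h z) ->
  circle_integral g = circle_integral h.
Proof.
move=> e; apply: cint_ext => x _; rewrite e //; exact: cis_unit.
Qed.

Lemma twoipi_neq0 : twoipi R != 0.
Proof.
rewrite /twoipi !mulf_neq0 //.
- by apply/eqP => -[] /eqP; rewrite oner_eq0.
- by rewrite (fmorph_eq0 (real_complex R)) gt_eqF // pi_gt0.
Qed.

Lemma laurent_coef_cst1 (m : int) : laurent_coef (fun=> 1 : C) m = (m == 0)%:R.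
Proof.
rewrite laurent_coefE; last exact: bm_cst.
rewrite /fourier -oppr_eq0 -mean_cis; apply: mean_ext => x; exact: mul1r.
Qed.

Variables (f q : C -> C) (N : nat).
Hypotheses (bf : bounded_meas (f \o @cis R)) (qb : sqrt_branch q).

(** The modulus-one density of [moment] with respect to the angle. *)
Definition weight (j : int) (x : R) : C :=
  half_pow q (cis x) (2 * j - 2 - N%:Z) * ('i%C * cis x).

(** Integration against [z^(j - 1 - N/2)]; the functions [v_I] and [v_II] of the
    statement are combinations of these powers. *)
Definition moment (j : int) g : C :=
  circle_integral (fun z => g z * half_pow q z (2 * j - 2 - N%:Z)).

Lemma momentE j g : moment j g = cint (fun x => weight j x * g (cis x)).
Proof. by apply: cint_ext => x _; rewrite /weight; ring. Qed.

Lemma bm_weight j : bounded_meas (weight j).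
Proof.
apply: bmM; first exact: bm_half_pow.
by apply: bmZ; exact: bm_cis.
Qed.

Lemma unit_half_pow z j : unit_circle z -> unit_circle (half_pow q z j).
Proof. by move=> uz; apply: unitXz; apply: sqrt_branch_unit. Qed.

Lemma sqnormC_weight j x : sqnormC (weight j x) = 1.
Proof.
rewrite /weight !sqnormCM (proj1 (unit_circleE _) (unit_half_pow _ (cis_unit x))).
by rewrite (proj1 (unit_circleE _) (cis_unit x)) /sqnormC /=; ring.
Qed.

Lemma cintegrable_moment j g : in_L2 g ->
  cintegrable (fun x => weight j x * g (cis x)).
Proof. by move=> L; apply: cintegrableM (bm_weight j) (in_L2_cintegrable L). Qed.

Lemma moment_linear j (a : C) g h : in_L2 g -> in_L2 h ->
  moment j (fun z => a * g z + h z) = a * moment j g + moment j h.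
Proof.
move=> Lg Lh; rewrite !momentE -cintZ; last exact: cintegrable_moment.
rewrite -cintD; last exact: cintegrable_moment.
  by apply: cint_ext => x _; ring.
by apply: cintegrableZ; exact: cintegrable_moment.
Qed.

Lemma moment_sum (I : Type) (r : seq I) j (F : I -> C -> C) (s : I -> C) :
  (forall i, in_L2 (F i)) ->
  moment j (fun z => \sum_(i <- r) F i z * s i) = \sum_(i <- r) moment j (F i) * s i.
Proof.
move=> L; rewrite momentE.
under [RHS]eq_bigr => i _.
  rewrite momentE mulrC -cintZ; last exact: cintegrable_moment.
  over.
rewrite -cint_sum; last by move=> i; apply: cintegrableZ; exact: cintegrable_moment.
apply: cint_ext => x _; rewrite mulr_sumr; apply: eq_bigr => i _; ring.
Qed.

Lemma moment_bound j g : in_L2 g -> sqnormC (moment j g) <= 4 * pi * L2sq g.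
Proof.
move=> L; rewrite momentE; apply: sqnormC_cint_le => //.
  exact: cintegrable_moment.
by move=> x; rewrite sqnormCM sqnormC_weight mul1r.
Qed.

Lemma moment_ae j g h : in_L2 g -> in_L2 h -> circle_ae_eq g h ->
  moment j g = moment j h.
Proof.
move=> Lg Lh e; rewrite !momentE /cint.
have [mg mg'] := cintegrable_cmeas (cintegrable_moment j Lg).
have [mh mh'] := cintegrable_cmeas (cintegrable_moment j Lh).
congr (_ +i* _); congr fine; apply: ae_eq_integral;
  try exact: measurable_itv; try by apply/measurable_EFinP.
- by apply: filterS e => x + Jx => /(_ Jx) /= ->.
- by apply: filterS e => x + Jx => /(_ Jx) /= ->.
Qed.

Lemma half_powD z i j : unit_circle z ->
  half_pow q z i * half_pow q z j = half_pow q z (i + j).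
Proof.
move=> uz; rewrite /half_pow -expfzDr //; apply: unit_neq0.
exact: sqrt_branch_unit.
Qed.

Lemma half_pow_double z i : unit_circle z -> half_pow q z (2 * i) = z ^ i.
Proof.
by move=> uz; rewrite /half_pow -exprz_exp; congr (_ ^ i); case: qb => h _; exact: h.
Qed.

Lemma moment_power b (i j : int) :
  moment j (fun z => b z / twoipi R * half_pow q z (N%:Z - 2 * i)) =
  laurent_coef b (i - j).
Proof.
apply: circle_integral_ext => z uz; rewrite -mulrA half_powD //.
rewrite (_ : N%:Z - 2 * i + (2 * j - 2 - N%:Z) = 2 * (- (i - j + 1))); last by lia.
by rewrite half_pow_double // -invr_expz mulrAC.
Qed.

(** The function [(f - 1) z^(N/2 - i) / (2 i pi)]. For [i] in [1, ..., N] these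
    functions span a space that contains the range of [V0]. *)
Definition symbol_vec (i : int) : C -> C :=
  fun z => (f z - 1) / twoipi R * half_pow q z (N%:Z - 2 * i).

Lemma bm_power b (i : int) : bounded_meas (b \o @cis R) ->
  bounded_meas ((fun z => b z / twoipi R * half_pow q z (N%:Z - 2 * i)) \o @cis R).
Proof.
move=> bb; apply: bmM; last exact: bm_half_pow.
by apply: bmM => //; exact: bm_cst.
Qed.

Lemma bm_symbol_vec i : bounded_meas (symbol_vec i \o @cis R).
Proof. by apply: bm_power; apply: bmB => //; exact: bm_cst. Qed.

Lemma in_L2_power b i : bounded_meas (b \o @cis R) ->
  in_L2 (fun z => b z / twoipi R * half_pow q z (N%:Z - 2 * i)).
Proof. by move=> bb; apply: bm_in_L2; exact: bm_power. Qed.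

Lemma moment_symbol_vec (i j : int) :
  moment j (symbol_vec i) = laurent_coef f (i - j) - (i == j)%:R.
Proof.
rewrite -subr_eq0 -laurent_coef_cst1 -!moment_power.
transitivity (moment j (fun z =>
  -1 * ((fun=> 1 : C) z / twoipi R * half_pow q z (N%:Z - 2 * i)) +
  f z / twoipi R * half_pow q z (N%:Z - 2 * i))).
  by apply: circle_integral_ext => z uz; rewrite /symbol_vec; ring.
rewrite moment_linear; last exact: in_L2_power.
  by rewrite mulN1r addrC.
by apply: in_L2_power; exact: bm_cst.
Qed.

(** Operators differing from the identity by an endomorphism that reads the [N]
    moments and combines the [N] functions [symbol_vec]; [K] is its matrix. The
    operators [I + V0] and its inverse are the cases [K = 1] and [K = - T^-1]. *)
Definition finite_rank (K : 'M[C]_N) g : C -> C := fun z =>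
  g z + \sum_(a < N) symbol_vec a.+1%:Z z * \sum_(b < N) moment b.+1%:Z g * K b a.

Lemma in_L2_symbol_sum (s : 'I_N -> C) :
  in_L2 (fun z => \sum_(a < N) symbol_vec a.+1%:Z z * s a).
Proof.
by apply: bm_in_L2; apply: bm_sum => i; apply: bmM (bm_symbol_vec _) (bm_cst _).
Qed.

Lemma in_L2_finite_rank K g : in_L2 g -> in_L2 (finite_rank K g).
Proof. by move=> L; exact: (in_L2D L (in_L2_symbol_sum _)).1. Qed.

(** Finitely many uses of [|a + b|^2 <= 2 |a|^2 + 2 |b|^2]. The point is that [M]
    does not depend on the coefficients [s]. *)
Lemma L2sq_sum_le (I : Type) (r : seq I) (F : I -> C -> C) :
  (forall i, bounded_meas (F i \o @cis R)) ->
  exists2 M : R, 0 <= M & forall s : I -> C,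
    L2sq (fun z => \sum_(i <- r) F i z * s i) <= M * \sum_(i <- r) sqnormC (s i).
Proof.
move=> bF; have L (r' : seq I) s : in_L2 (fun z => \sum_(i <- r') F i z * s i).
  by apply: bm_in_L2; apply: bm_sum => i; apply: bmM (bF i) (bm_cst _).
elim: r => [|i r [M M0 ih]].
  exists 0 => // s; rewrite mul0r le_eqVlt; apply/orP; left; apply/eqP.
  rewrite /L2sq -[RHS](mul0r (2 * pi)) -Rintegral_cstJ; apply: eq_Rintegral => x _.
  by rewrite /sqabs big_nil /sqnormC /= expr0n addr0.
have [_ [Mi hMi]] := bF i.
have a0 : 0 <= 4 * pi * Mi ^+ 2.
  by apply: mulr_ge0; [apply: mulr_ge0 => //; exact: pi_ge0 | exact: sqr_ge0].
exists (4 * pi * Mi ^+ 2 + 2 * M); first by apply: addr_ge0 => //; exact: mulr_ge0.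
move=> s; rewrite big_cons.
have [Li hi] := in_L2_scale (s i) (bF i) hMi.
have -> : (fun z => \sum_(j <- i :: r) F j z * s j) =
    (fun z => F i z * s i + \sum_(j <- r) F j z * s j).
  by apply/funext => z; rewrite big_cons.
apply: le_trans (in_L2D Li (L r s)).2 _.
have s1 := sqnormC_ge0 (s i).
have s2 : 0 <= \sum_(j <- r) sqnormC (s j) by apply: sumr_ge0 => j _; exact: sqnormC_ge0.
have h2 := ih s.
move: hi h2 s1 s2; set A := L2sq _; set B := L2sq _; set x := sqnormC _; set y := \sum_(_ <- _) _.
have -> : 2 * pi * Mi ^+ 2 * x = (4 * pi * Mi ^+ 2) * x / 2 by field.
set k := 4 * pi * Mi ^+ 2 in a0 *; move=> hA hB x0 y0.
have : 0 <= k * y by exact: mulr_ge0.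
have : 0 <= M * x by exact: mulr_ge0.
nra.
Qed.

Lemma sqnormC_sum_le (I : Type) (r : seq I) (k : I -> C) :
  exists2 M : R, 0 <= M & forall (x : I -> C) (B : R), 0 <= B ->
    (forall i, sqnormC (x i) <= B) ->
    sqnormC (\sum_(i <- r) x i * k i) <= M * B.
Proof.
elim: r => [|i r [M M0 ih]].
  exists 0 => // x B B0 _; by rewrite big_nil mul0r /sqnormC /= expr0n addr0.
exists (2 * sqnormC (k i) + 2 * M).
  by apply: addr_ge0; apply: mulr_ge0 => //; exact: sqnormC_ge0.
move=> x B B0 hx; rewrite big_cons; apply: le_trans (sqnormCD_le _ _) _.
have h1 : sqnormC (x i * k i) <= sqnormC (k i) * B.
  by rewrite sqnormCM mulrC ler_wpM2l ?sqnormC_ge0.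
by have := ih x B B0 hx; lra.
Qed.

Lemma L2sq_ge0 g : 0 <= L2sq g.
Proof. by apply: Rintegral_ge0 => x _; exact: sqnormC_ge0. Qed.

Lemma L2sq_finite_rank K : exists M : R, forall g, in_L2 g ->
  L2sq (finite_rank K g) <= M * L2sq g.
Proof.
have [M M0 hM] := L2sq_sum_le (index_enum 'I_N) (fun a : 'I_N => bm_symbol_vec a.+1%:Z).
have ex (a : 'I_N) : exists2 Ma : R, 0 <= Ma & forall g, in_L2 g ->
    sqnormC (\sum_(b < N) moment b.+1%:Z g * K b a) <= Ma * L2sq g.
  have [Ma Ma0 hMa] := sqnormC_sum_le (index_enum 'I_N) (fun b : 'I_N => K b a).
  exists (Ma * (4 * pi)); first by rewrite !mulr_ge0 ?pi_ge0.
  move=> g L; rewrite -mulrA; apply: (hMa (fun b : 'I_N => moment b.+1%:Z g)).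
    by rewrite !mulr_ge0 ?pi_ge0 ?L2sq_ge0.
  by move=> b; exact: moment_bound.
have [Mf hMf] := choice (fun a => let: ex_intro2 m p q := ex a in
  ex_intro (fun m => 0 <= m /\ forall g, in_L2 g ->
    sqnormC (\sum_(b < N) moment b.+1%:Z g * K b a) <= m * L2sq g) m (conj p q)).
exists (2 + 2 * (M * \sum_a Mf a)) => g L.
apply: le_trans (in_L2D L (in_L2_symbol_sum _)).2 _.
rewrite [leRHS]mulrDl lerD2l -[leRHS]mulrA ler_pM2l //.
apply: le_trans (hM _) _; rewrite -[leRHS]mulrA ler_wpM2l // mulr_suml.
by apply: ler_sum => a _; apply: (hMf a).2.
Qed.

Lemma moment_finite_rank K g j : in_L2 g ->
  moment j (finite_rank K g) = moment j g +
   \sum_(a < N) (laurent_coef f (a.+1%:Z - j) - (a.+1%:Z == j)%:R) *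
     \sum_(b < N) moment b.+1%:Z g * K b a.
Proof.
move=> L; rewrite -[in RHS](mul1r (moment j g)).
under eq_bigr do rewrite -moment_symbol_vec.
rewrite -moment_sum; last by move=> a; apply: bm_in_L2; exact: bm_symbol_vec.
rewrite -moment_linear //; last exact: in_L2_symbol_sum.
by apply: circle_integral_ext => z _; rewrite mul1r.
Qed.

Lemma eq_circle_ae g h : (forall z, unit_circle z -> g z = h z) -> circle_ae_eq g h.
Proof. by move=> e; apply: aeW => x _ /=; apply: e; exact: cis_unit. Qed.

Lemma circle_ae_trans g h b : circle_ae_eq g h -> circle_ae_eq h b -> circle_ae_eq g b.
Proof. by move=> e1 e2; apply: filterS2 e1 e2 => x + + Jx => /(_ Jx) -> /(_ Jx). Qed.

Lemma circle_ae_sym g h : circle_ae_eq g h -> circle_ae_eq h g.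
Proof. by apply: filterS => x + Jx => /(_ Jx). Qed.

Lemma in_L2_ext g h : (forall z, unit_circle z -> g z = h z) -> in_L2 g -> in_L2 h.
Proof.
move=> e /in_L2P; rewrite in_L2P.
have e1 : g \o @cis R = h \o @cis R by apply/funext => x; apply: e; exact: cis_unit.
have e2 : sqabs g = sqabs h.
  by apply/funext => x; rewrite /sqabs (e _ (cis_unit x)).
by rewrite e1 e2.
Qed.

Lemma L2_sqnorm_ext g h : (forall z, unit_circle z -> g z = h z) ->
  L2_sqnorm g = L2_sqnorm h.
Proof.
by move=> e; apply: eq_integral => x _; rewrite (e _ (cis_unit x)).
Qed.

Lemma finite_rank_ae K g h : in_L2 g -> in_L2 h -> circle_ae_eq g h ->
  circle_ae_eq (finite_rank K g) (finite_rank K h).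
Proof.
move=> Lg Lh e; have e2 := e; apply: filterS e2 => x + Jx => /(_ Jx) /= gh.
rewrite /finite_rank gh; congr (_ + _); apply: eq_bigr => a _; congr (_ * _).
by apply: eq_bigr => b _; rewrite (moment_ae _ Lg Lh).
Qed.

Lemma finite_rank_linear K (a : C) g h z : in_L2 g -> in_L2 h ->
  finite_rank K (fun z => a * g z + h z) z =
  a * finite_rank K g z + finite_rank K h z.
Proof.
move=> Lg Lh; rewrite /finite_rank mulrDr addrACA; congr (_ + _).
rewrite mulr_sumr -big_split; apply: eq_bigr => i _ /=.
rewrite mulrCA -mulrDr; congr (_ * _); rewrite mulr_sumr -big_split.
by apply: eq_bigr => b _ /=; rewrite moment_linear //; ring.
Qed.

Lemma finite_rank_bounded (T : (C -> C) -> (C -> C)) (K : 'M[C]_N) :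
  (forall g, in_L2 g -> forall z, unit_circle z -> T g z = finite_rank K g z) ->
  L2_bounded_operator T.
Proof.
move=> TE.
have TL g : in_L2 g -> in_L2 (T g).
  move=> L; apply: in_L2_ext (in_L2_finite_rank K L) => z uz.
  by rewrite TE.
split=> //.
- move=> g h Lg Lh e; apply: (circle_ae_trans (eq_circle_ae (TE g Lg))).
  apply: (circle_ae_trans (finite_rank_ae K Lg Lh e)).
  by apply: circle_ae_sym; apply: eq_circle_ae; exact: TE.
- move=> a g h Lg Lh; apply: eq_circle_ae => z uz.
  have Lgh : in_L2 (fun z => a * g z + h z) by exact: (in_L2D (in_L2Z a Lg) Lh).1.
  by rewrite !TE // finite_rank_linear.
have [M hM] := L2sq_finite_rank K; exists M => g L.
rewrite (L2_sqnorm_ext (TE g L)) !L2_sqnormE //; last exact: in_L2_finite_rank.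
by rewrite -EFinM lee_fin; exact: hM.
Qed.

Definition toeplitz : 'M[C]_N :=
  \matrix_(a < N, b < N) laurent_coef f (a.+1%:Z - b.+1%:Z).

Definition moments g : 'rV[C]_N := \row_b moment b.+1%:Z g.

Lemma finite_rankE K g z :
  finite_rank K g z = g z + \sum_(a < N) symbol_vec a.+1%:Z z * (moments g *m K) 0 a.
Proof.
congr (_ + _); apply: eq_bigr => a _; congr (_ * _).
by rewrite mxE; apply: eq_bigr => b _; rewrite mxE.
Qed.

Lemma moments_finite_rank K g : in_L2 g ->
  moments (finite_rank K g) = moments g + moments g *m K *m (toeplitz - 1%:M).
Proof.
move=> L; apply/rowP => b; rewrite !mxE moment_finite_rank //; congr (_ + _).
apply: eq_bigr => a _; rewrite mulrC; congr (_ * _).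
  by rewrite mxE; apply: eq_bigr => d _; rewrite mxE.
by rewrite !mxE.
Qed.

(** The moments of the functions [symbol_vec] form the matrix [T - 1], so that
    composition becomes a product of matrices. *)
Lemma finite_rank_comp K K' g z : in_L2 g ->
  finite_rank K (finite_rank K' g) z =
  finite_rank (K' + K + K' *m (toeplitz - 1%:M) *m K) g z.
Proof.
move=> L; rewrite !finite_rankE moments_finite_rank // -addrA -big_split.
congr (_ + _); apply: eq_bigr => a _ /=; rewrite -mulrDr; congr (_ * _).
by rewrite !(mulmxDl, mulmxDr) !mulmxA -[in RHS]addrA [in RHS]mxE.
Qed.

Lemma finite_rank0 g z : finite_rank 0 g z = g z.
Proof.
rewrite finite_rankE mulmx0 big1 ?addr0 // => a _; by rewrite mxE mulr0.
Qed.

(** A point of the circle has at most two angles in the closed period, found with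
    the arc cosine on each half of it. *)
Lemma cis_fiber_null (z : C) : exists2 A : set R,
  measurable A /\ mu A = 0%E & forall x, J x -> cis x = z -> A x.
Proof.
exists ([set acos (Re z)] `|` [set 2 * pi - acos (Re z)]).
  split; first by apply: measurableU; exact: measurable_set1.
  by apply: countable_lebesgue_measure0; apply: finite_set_countable; rewrite finite_setU; split.
move=> x; rewrite /= in_itv /= => /andP[x0 x2] <- /=.
have [xp|xp] := leP x pi; [left | right].
  by rewrite cosK // in_itv /= x0.
have -> : cos x = cos (2 * pi - x).
  have -> : 2 * pi - x = - x + pi *+ 2 by rewrite mulr_natl addrC.
  by rewrite cosD2pi cosN.
by rewrite cosK ?in_itv /=; [lra | apply/andP; split; lra].
Qed.

(** Off the diagonal the quotient [(z^N - s^N) / (z - s)] is a geometric sum. *)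
Lemma V0_kernelE z s : unit_circle z -> unit_circle s -> s != z ->
  V0_kernel f q N z s = \sum_(a < N) symbol_vec a.+1%:Z z *
    half_pow q s (2 * a.+1%:Z - 2 - N%:Z).
Proof.
move=> uz us sz; have zs : z - s != 0 by rewrite subr_eq0 eq_sym.
have tp := twoipi_neq0; have z0 := unit_neq0 uz; have s0 := unit_neq0 us.
have zN : half_pow q z N%:Z = half_pow q z (- N%:Z) * z ^+ N.
  by rewrite [z ^+ N]exprnP -half_pow_double // half_powD //; congr half_pow; lia.
have sN : half_pow q s N%:Z = half_pow q s (- N%:Z) * s ^+ N.
  by rewrite [s ^+ N]exprnP -half_pow_double // half_powD //; congr half_pow; lia.
rewrite /V0_kernel zN sN.
set zi := half_pow q z _; set si := half_pow q s _.
have -> : zi * z ^+ N * si - zi * (si * s ^+ N) = zi * si * ((z - s) *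
    \sum_(a < N) z ^+ (N.-1 - a) * s ^+ a).
  by rewrite -subrXX; ring.
have -> : (f z - 1) * (zi * si * ((z - s) * \sum_(a < N) z ^+ (N.-1 - a) * s ^+ a) /
    (twoipi R * (z - s))) =
    (f z - 1) / twoipi R * (zi * si * \sum_(a < N) z ^+ (N.-1 - a) * s ^+ a).
  by move: (\sum_(a < N) _) => S; field; rewrite tp zs.
rewrite !mulr_sumr; apply: eq_bigr => a _; rewrite /symbol_vec -!mulrA.
congr (_ * (_ * _)).
have -> : half_pow q z (N%:Z - 2 * a.+1%:Z) = zi * z ^+ (N.-1 - a).
  rewrite [z ^+ _]exprnP -half_pow_double // half_powD //; congr half_pow.
  by have := ltn_ord a; lia.
have -> : half_pow q s (2 * a.+1%:Z - 2 - N%:Z) = si * s ^+ a.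
  by rewrite [s ^+ _]exprnP -half_pow_double // half_powD //; congr half_pow; lia.
ring.
Qed.

(** The kernel is a finite sum of products except at [s = z], which is a null set
    of angles. *)
Lemma V0_finite_rank g z : in_L2 g -> unit_circle z ->
  id_plus (V0 f q N) g z = finite_rank 1%:M g z.
Proof.
move=> L uz; rewrite /id_plus /finite_rank; congr (_ + _).
pose H x := \sum_(a < N) symbol_vec a.+1%:Z z * (weight a.+1%:Z x * g (cis x)).
have iH : cintegrable H.
  by apply: cintegrable_sum => a; apply: cintegrableZ; exact: cintegrable_moment.
have -> : \sum_(a < N) symbol_vec a.+1%:Z z *
    \sum_(b < N) moment b.+1%:Z g * (1%:M : 'M[C]_N) b a = cint H.
  rewrite cint_sum; last by move=> a; apply: cintegrableZ; exact: cintegrable_moment.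
  apply: eq_bigr => a _; rewrite cintZ; last exact: cintegrable_moment.
  rewrite -momentE (bigD1 a) //= mxE eqxx mulr1 big1 ?addr0 // => b ba.
  by rewrite mxE (negbTE ba) mulr0.
rewrite /V0 /circle_integral.
(* On the diagonal the kernel is zero by the convention on division, so it is
   the finite sum times this indicator. *)
pose ind (x : R) : C := (cis x != z)%:R.
pose G x := ind x * H x.
have GE x : V0_kernel f q N z (cis x) * g (cis x) * ('i%C * cis x) = G x.
  rewrite /G /ind; case: eqVneq => [->|ne].
    by rewrite /V0_kernel subrr mulr0 invr0 !(mulr0, mul0r).
  rewrite V0_kernelE //; last exact: cis_unit.
  rewrite mul1r !mulr_suml; apply: eq_bigr => a _; rewrite /weight; ring.
transitivity (cint G); first by apply: cint_ext => x _; exact: GE.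
have [A [mA A0] hA] := cis_fiber_null z.
have mind : cmeas ind.
  have mU : measurable [set x : R | cis x != z] by apply: open_measurable; exact: open_cis_neq.
  split.
    rewrite (_ : _ \o _ = \1_[set x | cis x != z]); first exact: measurable_indic.
    apply/funext => x; rewrite /= indicE /ind; case: (boolP (cis x != z)) => h.
      by rewrite mem_set.
    by rewrite memNset //; apply/negP.
  rewrite (_ : _ \o _ = cst 0); first exact: measurable_cst.
  by apply/funext => x; rewrite /= /ind; case: (_ != _).
have [mG mG'] := cmeasM mind (cintegrable_cmeas iH).
have [mH mH'] := cintegrable_cmeas iH.
have ae : ae_eq mu J G H.
  exists A; split => // x /= /not_implyP [Jx ne]; apply: hA => //.
  by apply: contrapT => /eqP h; apply: ne; rewrite /G /ind h mul1r.
rewrite /cint; congr (_ +i* _); congr fine; apply: ae_eq_integral;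
  try exact: measurable_itv; try by apply/measurable_EFinP.
- by apply: filterS ae => x + Jx => /(_ Jx) /= ->.
- by apply: filterS ae => x + Jx => /(_ Jx) /= ->.
Qed.

(** The matrices [1] and [- T^-1] are inverse to each other for the composition
    law of [finite_rank_comp]. *)
Lemma inverse_exists : toeplitz \in unitmx ->
  exists R0, L2_inverse (id_plus (V0 f q N)) (id_minus R0).
Proof.
move=> uT; pose K := - invmx toeplitz.
exists (fun g z => g z - finite_rank K g z).
set S := id_minus _.
have SE g z : S g z = finite_rank K g z by rewrite /S /id_minus subKr.
have SL g : in_L2 g -> in_L2 (S g).
  by move=> L; apply: in_L2_ext (in_L2_finite_rank K L) => z _; rewrite SE.
split.
- by apply: (finite_rank_bounded (K := 1%:M)) => g L z uz; exact: V0_finite_rank.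
- by apply: (finite_rank_bounded (K := K)) => g L z uz; exact: SE.
- move=> g L; apply: eq_circle_ae => z uz.
  rewrite V0_finite_rank //; last exact: SL.
  rewrite (_ : S g = finite_rank K g); last by apply/funext.
  rewrite finite_rank_comp // -[RHS]finite_rank0; congr (finite_rank _ _ _).
  by rewrite mulmx1 /K mulNmx mulmxBr mulmx1 mulVmx // opprB addrACA addNr subrr addr0.
- move=> g L; have LT : in_L2 (id_plus (V0 f q N) g).
    apply: in_L2_ext (in_L2_finite_rank 1%:M L) => z uz.
    by rewrite V0_finite_rank.
  apply: (circle_ae_trans (h := finite_rank K (finite_rank 1%:M g))).
    rewrite (_ : S _ = finite_rank K (id_plus (V0 f q N) g)); last by apply/funext.
    apply: finite_rank_ae => //; first exact: in_L2_finite_rank.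
    by apply: eq_circle_ae => z uz; exact: V0_finite_rank.
  apply: eq_circle_ae => z uz.
  rewrite finite_rank_comp // -[RHS]finite_rank0; congr (finite_rank _ _ _).
  by rewrite mul1mx /K mulmxN mulmxBl mul1mx mulmxV // subrr.
Qed.

(** Taking the moments of [(I + V0) U = u] gives a linear system with matrix [T]
    for the moments of index [1, ..., N], and then expresses all the others.
    The inverse operator enters only through this equation, which its values
    solve almost everywhere. *)
Lemma moment_inverse R0 u j : toeplitz \in unitmx ->
  L2_inverse (id_plus (V0 f q N)) (id_minus R0) -> in_L2 u ->
  moment j (id_minus R0 u) = resolvent (laurent_coef f) N (fun i => moment i u) j.
Proof.
move=> uT [_ [SL _ _ _] TS _] L; set U := id_minus R0 u.
have LU : in_L2 U by exact: SL.
have e : circle_ae_eq (finite_rank 1%:M U) u.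
  apply: circle_ae_trans (TS u L); apply: circle_ae_sym; apply: eq_circle_ae => z uz.
  exact: V0_finite_rank.
have LF := in_L2_finite_rank 1%:M LU.
have Pw : moments U = moments u *m invmx toeplitz.
  apply: (can_inj (mulmxK uT)); rewrite mulmxKV //.
  have -> : moments u = moments (finite_rank 1%:M U).
    by apply/rowP => b; rewrite !mxE (moment_ae _ LF L e).
  by rewrite moments_finite_rank // mulmx1 mulmxBr mulmx1 addrCA subrr addr0.
have e1 := moment_finite_rank 1%:M j LU; rewrite (moment_ae _ LF L e) in e1.
rewrite /resolvent e1 -addrA -[LHS]addr0; congr (_ + _); apply/esym.
rewrite [X in _ + X]exchange_big -big_split big1 //= => b _.
have -> : \sum_(a < N) moment a.+1%:Z U * (1%:M : 'M[C]_N) a b =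
    \sum_(a < N) moment a.+1%:Z u * invmx toeplitz a b.
  transitivity ((moments U *m 1%:M) 0 b).
    by rewrite mxE; apply: eq_bigr => a _; rewrite !mxE.
  by rewrite mulmx1 Pw mxE; apply: eq_bigr => a _; rewrite mxE.
by rewrite -mulr_suml [j == _]eq_sym; ring.
Qed.

End FiniteRank.

(** * The minor identity *)

Section Assembly.
Variable R : realType.
Local Notation C := R[i].
Variables (f q : C -> C) (N c : nat).
Hypotheses (bf : bounded_meas (f \o @cis R)) (qb : sqrt_branch q).

Lemma bm_cst1 : bounded_meas ((fun=> 1 : C) \o @cis R). Proof. exact: bm_cst. Qed.

Lemma moment_pow1 (i j : int) :
  moment q N j (fun z => 1 / twoipi R * half_pow q z (N%:Z - 2 * i)) = (i == j)%:R.
Proof.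
by rewrite (moment_power N qb (fun=> 1)) laurent_coef_cst1 subr_eq0.
Qed.

Lemma bm_u_I (h p : seq int) a : bounded_meas (u_I f q N c h p a \o @cis R).
Proof.
have bh (i : int) : bounded_meas (fun x => half_pow q (cis x) i) by exact: bm_half_pow.
apply: bmB; first by apply: bmM => //; apply: bmM => //; exact: bm_cst.
apply: bmM; first by apply: bmM => //; exact: bm_cst.
by apply: bmD; [exact: bm_cst | apply: bmZ].
Qed.

Lemma moment_u_I (h p : seq int) a j : moment q N j (u_I f q N c h p a) =
  laurent_coef f (p`_a - j) -
  ((a < c)%N%:R * (h`_a == j)%:R + (c <= a)%N%:R * laurent_coef f (h`_a - j)).
Proof.
pose F1 i z := f z / twoipi R * half_pow q z (N%:Z - 2 * i).
pose F0 i z := (1 : C) / twoipi R * half_pow q z (N%:Z - 2 * i).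
have L1 i : in_L2 (F1 i) by exact: (in_L2_power N qb i bf).
have L0 i : in_L2 (F0 i) by exact: (in_L2_power N qb i bm_cst1).
have m1 i : moment q N j (F1 i) = laurent_coef f (i - j) by exact: moment_power.
have m0 i : moment q N j (F0 i) = (i == j)%:R by exact: moment_pow1.
transitivity (moment q N j (fun z => - (a < c)%N%:R * F0 h`_a z +
    (- (c <= a)%N%:R * F1 h`_a z + F1 p`_a z))).
  by apply: circle_integral_ext => z _; rewrite /u_I /F0 /F1; ring.
have L2 : in_L2 (fun z => - (c <= a)%N%:R * F1 h`_a z + F1 p`_a z).
  exact: (in_L2D (in_L2Z _ (L1 _)) (L1 _)).1.
by rewrite !moment_linear // !m1 m0; ring.
Qed.

Lemma bm_u_II (t : seq int) a : bounded_meas (u_II f q N t a \o @cis R).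
Proof.
have bh (i : int) : bounded_meas (fun x => half_pow q (cis x) i) by exact: bm_half_pow.
by apply: bmM => //; apply: bmM; [apply: bmB => // | ]; exact: bm_cst.
Qed.

Lemma moment_u_II (t : seq int) a j : moment q N j (u_II f q N t a) =
  laurent_coef f (t`_a - j) - (t`_a == j)%:R.
Proof. exact: moment_symbol_vec. Qed.

Lemma circle_integral_combination g (i j : int) (s1 s2 : C) : in_L2 g ->
  circle_integral (fun z => g z * (s1 * half_pow q z (2 * i - 2 - N%:Z) +
    s2 * half_pow q z (2 * j - 2 - N%:Z))) =
  s1 * moment q N i g + s2 * moment q N j g.
Proof.
move=> L; rewrite !momentE -!cintZ; try exact: cintegrable_moment.
rewrite -cintD; try by apply: cintegrableZ; exact: cintegrable_moment.
by apply: cint_ext => x _; rewrite /weight; ring.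
Qed.

Lemma integral_v_I (h k : seq int) b g : in_L2 g ->
  circle_integral (fun z => g z * v_I q N c h k b z) =
  (b < c)%N%:R * moment q N k`_b g + (c <= b)%N%:R * moment q N h`_b g.
Proof.
move=> L; rewrite -circle_integral_combination //; apply: circle_integral_ext => z _.
rewrite /v_I; congr (_ * (_ * half_pow q z _ + _)); by lia.
Qed.

Lemma integral_v_II (t k : seq int) b g : in_L2 g ->
  circle_integral (fun z => g z * v_II q N c t k b z) =
  - (b < c)%N%:R * moment q N t`_b g + (c <= b)%N%:R * moment q N k`_b g.
Proof.
move=> L; rewrite -circle_integral_combination //; apply: circle_integral_ext => z _.
rewrite /v_II; congr (_ * (_ * half_pow q z _ + _)); by lia.
Qed.

Theorem minor_identity (R0 : (C -> C) -> C -> C) (n r : nat)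
    (h p : n.-tuple int) (t k : r.-tuple int) :
  toeplitz f N \in unitmx ->
  L2_inverse (id_plus (V0 f q N)) (id_minus R0) ->
  admissible N h p -> admissible N t k -> (c <= minn r n)%N -> well_ordered c h t ->
  \det (\matrix_(a < N, b < N)
     laurent_coef f (substituted h p a.+1%:Z - substituted t k b.+1%:Z))
  = \det (toeplitz f N) * \det (calN f q N c h p t k R0).
Proof.
move=> uT inv hp tk cnr wo.
rewrite (minor_factorization (cf := laurent_coef f) hp tk cnr wo uT).
have [_ [SL _ _ _] _ _] := inv.
have LI a : in_L2 (u_I f q N c h p a) by apply: bm_in_L2; exact: bm_u_I.
have LII a : in_L2 (u_II f q N t a) by apply: bm_in_L2; exact: bm_u_II.
have mI a j : moment q N j (id_minus R0 (u_I f q N c h p a)) =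
    resolvent (laurent_coef f) N (rhs_I (laurent_coef f) c h p a) j.
  rewrite (moment_inverse bf qb j uT inv (LI a)); congr resolvent.
  by apply/funext => i; rewrite moment_u_I.
have mII a j : moment q N j (id_minus R0 (u_II f q N t a)) =
    resolvent (laurent_coef f) N (rhs_II (laurent_coef f) t a) j.
  rewrite (moment_inverse bf qb j uT inv (LII a)); congr resolvent.
  by apply/funext => i; rewrite moment_u_II.
congr (_ * \det (block_mx _ _ _ _)); apply/matrixP => a b; rewrite !mxE.
- by rewrite integral_v_I ?mI //; exact: SL.
- by rewrite integral_v_II ?mI //; exact: SL.
- by rewrite integral_v_I ?mII //; exact: SL.
- by rewrite integral_v_II ?mII //; exact: SL.
Qed.

End Assembly.

Theorem proposition2p1 (R : realType) (D : set (R[i]^o)) (f lnf q : R[i] -> R[i])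
    (D_open : open D) (circle_D : forall z, unit_circle z -> D z)
    (f_holo : holomorphic_on D f) (f_neq0 : forall z, D z -> f z <> 0)
    (lnf_holo : holomorphic_on D lnf)
    (lnfE : forall z, D z -> cexp (lnf z) = f z)
    (q_branch : sqrt_branch q) :
  exists N0 : nat, forall N : nat, (N0 <= N)%N ->
    (exists R0, L2_inverse (id_plus (V0 f q N)) (id_minus R0)) /\
    (forall R0, L2_inverse (id_plus (V0 f q N)) (id_minus R0) ->
      forall (n r c : nat) (h p : n.-tuple int) (t k : r.-tuple int),
        admissible N h p -> admissible N t k ->
        (c <= minn r n)%N -> well_ordered c h t ->
        \det (\matrix_(a < N, b < N)
           laurent_coef f (substituted h p a.+1%:Z - substituted t k b.+1%:Z))
        = \det (\matrix_(a < N, b < N) laurent_coef f (a.+1%:Z - b.+1%:Z))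
          * \det (calN f q N c h p t k R0)).
Proof.
have [fR fI] := holomorphic_circle_continuous circle_D f_holo.
have [gR gI] := holomorphic_circle_continuous circle_D lnf_holo.
have bf := bm_circle_continuous fR fI.
have [psi1 [psi2 [c0 c0_gt0 hpsi]]] :=
  sectorial_multipliers (fun z uz => lnfE z (circle_D z uz)) gR gI.
have [N0 hN0] := toeplitz_invertible fR fI c0_gt0 hpsi.
exists N0 => N NN0.
have uT : toeplitz f N \in unitmx.
  rewrite unitmxE unitfE; have := hN0 N NN0; congr (\det _ != 0).
  by apply/matrixP => a b; rewrite !mxE laurent_coefE.
split; first exact: inverse_exists.
by move=> R0 inv n r c h p t k; exact: minor_identity.
Qed.
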